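(* Let $M$ be a connected matroid with $|E(M)|\ge 3$ (finite or infinite). (i) $M$ has an irredundant tree-decomposition of uniform adhesion $2$ every torso of which is either $3$-connected, or a circuit, or a cocircuit. (ii) This decomposition is unique in the following sense: if $(T,R)$ and $(T',R')$ are two irredundant tree-decompositions of $M$ of uniform adhesion $2$ all of whose torsos are $3$-connected, circuits, or cocircuits, then there is a graph isomorphism $v\mapsto v'$ from $T$ to $T'$ such that $R_v=R'_{v'}$ for every node $v$ of $T$.
   Context: Matroids are possibly infinite matroids in the sense of Bruhn, Diestel, Kriesell, Pendavingh and Wollan (given e.g. by the circuit axioms: (C1) $\emptyset$ is not a circuit; (C2) no circuit properly contains another; (C3) infinite circuit elimination: if $X\subseteq C\in\mathcal C(M)$ and $\{C_x:x\in X\}$ are circuits with $x\in C_y\iff x=y$ for $x,y\in X$, then for every $z\in C\setminus\bigcup_x C_x$ there is a circuit $C'$ with $z\in C'\subseteq (C\cup\bigcup_x C_x)\setminus X$; (CM) for every independent $I\subseteq S\subseteq E(M)$ there is a maximal independent subset of $S$ containing $I$). For $S\subseteq E(M)$ write $S^\complement=E(M)\setminus S$. $M$ is connected if every two elements lie in a common circuit. For a partition $(X,Y)$ of $E(M)$ (parts may be empty), pick bases $B_X$ of $M|X$, $B_Y$ of $M|Y$ and $F\subseteq B_X\cup B_Y$ with $(B_X\cup B_Y)\setminus F$ a base of $M$; $k=|F|$ depends only on $(X,Y)$. If moreover $|X|,|Y|\ge k+1$, $(X,Y)$ is a $(k+1)$-separation (a separation of order $k+1$). $M$ is $n$-connected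 if it has no $\ell$-separation for any $\ell<n$. $M$ is a circuit (cocircuit) if $E(M)$ is a circuit of $M$ (of the dual $M^*$). Tree-decomposition: a pair $(T,R)$ where $T$ is a tree and $R=(R_v)_{v\in V(T)}$ is a partition of $E(M)$ (parts may be empty) such that for every edge $e=vw$ of $T$, writing $T_v,T_w$ for the components of $T-e$ containing $v,w$ and $S(e,v)=\bigcup_{u\in T_v}R_u$, $S(e,w)=\bigcup_{u\in T_w}R_u$, the partition $(S(e,v),S(e,w))$ is a separation of $M$. It has uniform adhesion $2$ if all these separations are $2$-separations. For a node $v$ let $F_v$ be the set of edges of $T$ at $v$; the torso $M_v$ is the matroid on $R_v\cup F_v$ whose circuits are the sets $(C\cap R_v)\cup\{e\in F_v: e=vw,\ C\cap S(e,w)\ne\emptyset\}$ where $C$ ranges over circuits of $M$ not contained in any $S(vw,w)$ ($vw\in F_v$). $(T,R)$ is irredundant if all torsos have at least three elements and for every edge $vw$ of $T$ the torsos $M_v,M_w$ are not both circuits and not both cocircuits. *)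

(* Defs.v *)
From mathcomp Require Export all_boot.
From mathcomp Require Export boolp classical_sets functions cardinality.

Set Implicit Arguments.
Unset Strict Implicit.
Unset Printing Implicit Defensive.

Local Open Scope classical_set_scope.
Local Open Scope card_scope.

(* The axioms are kept apart from the data, so that the torso of a
   tree-decomposition can be written down before it is known to be a matroid. *)
Record circuit_system (T : Type) := CircuitSystem {
  ground : set T;
  circuits : set (set T)
}.

Section Matroids.
Variable T : Type.
Implicit Types (M : circuit_system T) (A B I S X Y F : set T) (k l n : nat).

Definition maximal (P : set (set T)) A :=
  P A /\ forall B, P B -> A `<=` B -> B = A.

Definition minimal (P : set (set T)) A :=
  P A /\ forall B, P B -> B `<=` A -> B = A.

Definition indep M I :=
  I `<=` ground M /\ forall C, circuits M C -> ~ C `<=` I.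

Definition base M := maximal (indep M).

Record is_matroid M : Prop := IsMatroid {
  circuits_sub : forall C, circuits M C -> C `<=` ground M;
  circuits_C1 : ~ circuits M set0;
  circuits_C2 : forall C D, circuits M C -> circuits M D -> ~ C `<` D;
  circuits_C3 : forall X C (D : T -> set T),
    X `<=` C -> circuits M C ->
    (forall x, X x -> circuits M (D x)) ->
    (forall x y, X x -> X y -> (D y x <-> x = y)) ->
    forall z, (C `\` \bigcup_(x in X) D x) z ->
    exists C', [/\ circuits M C', C' z &
                   C' `<=` (C `|` \bigcup_(x in X) D x) `\` X];
  circuits_CM : forall I S,
    indep M I -> I `<=` S -> S `<=` ground M ->
    exists J, maximal [set K | [/\ indep M K, I `<=` K & K `<=` S]] J
}.

Definition restriction M X : circuit_system T :=
  CircuitSystem X [set C | circuits M C /\ C `<=` X].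

(* The bases of the dual are the complements of the bases of M, and its
   circuits are the minimal sets contained in none of these. *)
Definition dual M : circuit_system T :=
  CircuitSystem (ground M)
    (minimal [set C | C `<=` ground M /\
                forall B, base M B -> ~ C `<=` ground M `\` B]).

Definition is_circuit M := circuits M (ground M).

Definition is_cocircuit M := is_circuit (dual M).

Definition connected_matroid M :=
  forall x y, ground M x -> ground M y -> x <> y ->
  exists C, [/\ circuits M C, C x & C y].

Definition bipartition A X Y := X `|` Y = A /\ X `&` Y = set0.

(* In a matroid the number k is determined by (X, Y). *)
Definition connectivity M X Y k :=
  exists BX BY F, [/\ base (restriction M X) BX, base (restriction M Y) BY,
    F `<=` BX `|` BY, base M ((BX `|` BY) `\` F) & F #= `I_k].

Definition separation M l X Y :=
  bipartition (ground M) X Y /\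
  exists k, [/\ l = k.+1, connectivity M X Y k,
                `I_k.+1 #<= X & `I_k.+1 #<= Y].

Definition n_connected n M :=
  forall l X Y, (l < n)%N -> ~ separation M l X Y.

End Matroids.

Section Graphs.
Variable V : eqType.
Implicit Types (e : rel V) (u v w : V).

Definition reachable e v : set V :=
  [set u | exists p, path e v p /\ last v p = u].

Record is_tree e : Prop := IsTree {
  tree_sym : symmetric e;
  tree_irrefl : irreflexive e;
  tree_nonempty : exists v : V, True;
  tree_connected : forall v w, reachable e v w;
  tree_acyclic : forall c : seq V, (2 < size c)%N -> ~ ucycle e c
}.

Definition delete_edge e v w : rel V :=
  [rel a b | e a b && ~~ ((a == v) && (b == w) || (a == w) && (b == v))].

Definition edges_at e v : set (set V) := [set [set v; w] | w in [set w | e v w]].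

End Graphs.

Section TreeDecompositions.
Variables (T : Type) (M : circuit_system T).
Variables (V : eqType) (e : rel V) (R : V -> set T).

(* S(vw, w): the part of the ground set on the side of w. *)
Definition side (v w : V) : set T :=
  \bigcup_(u in reachable (delete_edge e v w) w) R u.

Definition tree_decomposition :=
  [/\ is_tree e, \bigcup_v R v = ground M, trivIset setT R &
      forall v w, e v w -> exists l, separation M l (side w v) (side v w)].

Definition uniform_adhesion (n : nat) :=
  forall v w, e v w -> separation M n (side w v) (side v w).

(* The elements of the torso are those of R v (inl) and the edges at v (inr);
   an edge is the set of its two ends. *)
Definition torso (v : V) : circuit_system (T + set V) :=
  CircuitSystem
    ([set inl x | x in R v] `|` [set inr f | f in edges_at e v])
    [set [set inl x | x in C `&` R v] `|`
         [set inr [set v; w] | w in [set w | e v w /\ C `&` side v w !=set0]]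
    | C in [set C | circuits M C /\ forall w, e v w -> ~ C `<=` side v w]].

Definition irredundant :=
  (forall v, `I_3 #<= ground (torso v)) /\
  (forall v w, e v w ->
     ~ (is_circuit (torso v) /\ is_circuit (torso w)) /\
     ~ (is_cocircuit (torso v) /\ is_cocircuit (torso w))).

Definition torsos_3connected_or_circuits_or_cocircuits :=
  forall v, n_connected 3 (torso v) \/ is_circuit (torso v) \/
            is_cocircuit (torso v).

Definition canonical_decomposition :=
  [/\ tree_decomposition, uniform_adhesion 2, irredundant &
      torsos_3connected_or_circuits_or_cocircuits].

End TreeDecompositions.

Definition graph_isomorphism (V V' : eqType) (e : rel V) (e' : rel V')
    (f : V -> V') :=
  bijective f /\ forall v w, e' (f v) (f w) = e v w.

(* Main.v *)
(* Call X separated if the connectivity between X and its complement is 1. Whether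
   X is separated can be read off the circuits crossing X: any two of their traces
   on X contain a circuit through any prescribed element of their difference, and
   traces on the two sides then combine freely. Hence a partition into separated
   sets has a quotient matroid, of which the torsos are instances; infinitely many
   traces are exchanged at once by infinite circuit elimination.

   If two separated sets cross, the four corners are separated and their quotient
   is U_{1,4} (parallel) or U_{3,4} (series). Call a separated set good if it is
   crossed by no other. Good sets are nested, and no strictly increasing sequence
   of good sets misses an element: consecutive good sets are neither in series nor
   in parallel, so that infinitely many elements of a circuit running through the
   whole sequence could be eliminated simultaneously, and nothing would be left of
   it. This makes the good sets the edges of a tree, whose nodes are the partitions
   into at least three good sets which no good set splits. If a node is not
   3-connected, some union of its parts is crossed; Zorn's lemma shrinks this union
   to single parts while keeping the type of the crossing, so the torso is a
   cocircuit in the parallel and a circuit in the series case.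

   For uniqueness, a 2-separation crossing an edge separation of a canonical
   decomposition, in parallel say, would force the torsos at both ends of the edge
   to be cocircuits. So all edge separations are good, the decomposition induces
   nodes in the above sense, and every node arises in this way. *)
Require Import Defs.
Local Open Scope classical_set_scope.
Local Open Scope card_scope.

Set Implicit Arguments.
Unset Strict Implicit.
Unset Printing Implicit Defensive.

(** * Connectivity 1 in terms of circuits *)

(** Each case is therefore argued with circuits of [M]. In place of a submodular connectivity
    function, traces of circuits are recombined along separated sets. Finite descent fails as well;
    its substitutes are induction on good sets that avoid a fixed element, for maximal good sets and
    for walks in trees, and Zorn's lemma, which is applied to complements because [tsep] passes to
    unions of chains. For uniqueness, two decompositions are not compared with each other: each is
    shown isomorphic to the tree of nodes. *)

Section Circuits.
Variables (T : Type) (M : circuit_system T).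
Local Notation Ci := (circuits M).
Local Notation E := (ground M).
Implicit Types (A B C D G H I K O S X Y Z : set T) (x y z p q : T).

Definition crosses C X := (exists2 x, C x & X x) /\ (exists2 x, C x & ~ X x).

Lemma crossesC C X : crosses C X -> crosses C (~` X).
Proof. by move=> [[x Cx Xx] [y Cy Xy]]; split; [exists y | exists x => //; apply]. Qed.

(** A base of the restriction to [S], given by fundamental circuits instead of maximality. [S] may
    exceed [E], so that complements can be taken in the whole type. *)
Definition basis S B :=
  [/\ forall x, B x -> S x /\ E x, forall C, Ci C -> ~ C `<=` B &
      forall x, S x -> E x -> ~ B x ->
        exists D, [/\ Ci D, D x & forall y, D y -> B y \/ y = x]].

(* Connectivity exactly 1 between X and ~` X. The second clause looks at one side
   only, which makes it inherited by unions of chains. *)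
Definition tsep X :=
  (exists2 C, Ci C & crosses C X) /\
  forall C H q, Ci C -> Ci H -> crosses C X -> crosses H X ->
    X q -> H q -> ~ C q ->
    exists K, [/\ Ci K, K q & forall x, K x -> (C x \/ H x) /\ X x].

Hypothesis Mm : is_matroid M.

Lemma circ_sub C x : Ci C -> C x -> E x.
Proof. by move=> /(circuits_sub Mm); apply. Qed.

Lemma circ_eq C D : Ci C -> Ci D -> C `<=` D -> C = D.
Proof.
move=> cC cD CD; apply/seteqP; split=> //.
by apply: contrapT => nDC; apply: (circuits_C2 Mm cC cD).
Qed.

Lemma circ_neq0 C : Ci C -> exists x, C x.
Proof.
move=> cC; apply: contrapT => nC; apply: (circuits_C1 Mm).
suff <- : C = set0 by [].
by apply/seteqP; split=> // x Cx; apply: nC; exists x.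
Qed.

Lemma circ_diff C D : Ci C -> Ci D -> C <> D -> exists2 x, C x & ~ D x.
Proof.
move=> cC cD CD; apply: contrapT => nx; apply: CD; apply: circ_eq => // x Cx.
by apply: contrapT => nDx; apply: nx; exists x.
Qed.

Lemma circ_elim C D x z : Ci C -> Ci D -> C x -> D x -> C z -> ~ D z ->
  exists C', [/\ Ci C', C' z & forall y, C' y -> (C y \/ D y) /\ y <> x].
Proof.
move=> cC cD Cx Dx Cz Dz.
have [||||C' [cC' C'z C's]] := circuits_C3 Mm (X := [set x]) (C := C)
  (D := fun=> D) _ cC _ _ (z := z).
- by move=> _ ->.
- by [].
- by move=> ? ? -> ->.
- by split=> // -[? ? /=].
exists C'; split=> // y /C's [Cy yx]; split; last by move=> yx'; apply: yx.
by case: Cy => [|[]]; [left | right].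
Qed.

Lemma basis_ext S I : (forall x, I x -> S x /\ E x) ->
  (forall C, Ci C -> ~ C `<=` I) -> exists2 B, basis S B & I `<=` B.
Proof.
move=> IS Iindep.
have indI : indep M I by split=> // x /IS[].
have [||J [[[JE Jind] IJ JS] Jmax]] := circuits_CM Mm (I := I) (S := S `&` E) indI.
- by move=> x /IS.
- by move=> x [].
exists J => //; split=> // x Sx Ex nJx.
apply: contrapT => nD; apply: (nJx); rewrite -(Jmax (x |` J)); first by left.
- split.
  + split=> [y [->|/JE]//|C cC CJ].
    apply: (nD); exists C; split=> //; last by move=> y /CJ [->|]; [right | left].
    apply: contrapT => nCx; apply: (Jind _ cC) => y Cy.
    by have [yx|//] := CJ _ Cy; case: nCx; rewrite -[x]yx.
  + by move=> y Iy; right; apply: IJ.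
  + by move=> y [->|/JS].
- by move=> y; right.
Qed.

Lemma basis_ex S : exists B, basis S B.
Proof.
have [||B bB _] := @basis_ext S set0; [by []| |by exists B].
by move=> C cC C0; have [x /C0] := circ_neq0 cC.
Qed.

Lemma base_restriction S B : S `<=` E ->
  base (restriction M S) B <-> basis S B.
Proof.
move=> SE; split.
- move=> [[BS Bi] Bmax]; split.
  + by move=> x Bx; split; [exact: BS | exact/SE/BS].
  + by move=> C cC CB; apply: (Bi C) => //; split=> // x /CB /BS.
  + move=> x Sx _ nBx; apply: contrapT => nD; apply: (nBx).
    rewrite -(Bmax (x |` B)); [by left| |by right].
    split=> [y [->//|/BS]//|C [cC _] CB].
    apply: nD; exists C; split=> //; last by move=> y /CB [->|]; [right | left].
    apply: contrapT => nCx; apply: (Bi C).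
      by split=> // y /CB [->|/BS].
    by move=> y Cy; have [yx|//] := CB _ Cy; case: nCx; rewrite -[x]yx.
- move=> [BS Bi Bx]; split.
    by split=> [x /BS[]//|C [cC _]]; exact: Bi.
  move=> B' [B'S B'i] BB'; apply/seteqP; split=> // x B'x.
  apply: contrapT => nBx.
  have [D [cD Dx DB]] := Bx _ (B'S _ B'x) (SE _ (B'S _ B'x)) nBx.
  have DB' : D `<=` B' by move=> y /DB [/BB'|->].
  by apply: (B'i D) => //; split=> // y /DB' /B'S.
Qed.

Lemma base_ground B : base M B <-> basis setT B.
Proof.
have -> : basis setT B = basis E B.
  apply/propext; split=> -[BS Bi Bx]; split=> // x; first by move=> /BS[].
  - by move=> _; exact: Bx.
  - by move=> /BS[].
  - by move=> _ Ex; exact: Bx.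
rewrite -base_restriction //.
suff -> : base M = base (restriction M E) by [].
rewrite /base; congr maximal; apply/funext => I; apply/propext; split.
- by move=> [IE Ii]; split=> // C [cC _]; exact: Ii.
- move=> [IE Ii]; split=> // C cC; apply: Ii; split=> // x.
  exact: circ_sub.
Qed.

(** A fundamental circuit has only one element outside [B]. So all elements of [C] in [S] but not in
    [B] can be eliminated at once, and [z] survives because it is outside [S]. *)
Lemma reduce S B C z : basis S B -> Ci C -> C z -> ~ S z ->
  exists C', [/\ Ci C', C' z & forall x, C' x -> C x /\ ~ S x \/ B x].
Proof.
move=> [BS Bi Bx] cC Cz nSz.
pose X := [set x | [/\ C x, S x & ~ B x]].
have /choice[D Dp] : forall x, exists D, X x ->
    [/\ Ci D, D x & forall y, D y -> B y \/ y = x].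
  move=> x; have [[Cx Sx nBx]|nX] := EM (X x); last by exists set0.
  by have [D ?] := Bx _ Sx (circ_sub cC Cx) nBx; exists D.
have [|||||C' [cC' C'z C's]] := circuits_C3 Mm (X := X) (C := C) (D := D) _ _ _ _ (z := z).
- by move=> x [].
- by [].
- by move=> x /Dp[].
- move=> x y Xx Xy; split=> [Dyx|->]; last by have [] := Dp _ Xy.
  by have [_ _ /(_ _ Dyx) [|//]] := Dp _ Xy; case: Xx.
- split=> // -[x Xx Dxz]; have [_ _ /(_ _ Dxz)] := Dp _ Xx.
  by case=> [/BS[]//|zx]; case: Xx => _ Sx _; apply: nSz; rewrite zx.
exists C'; split=> // x /C's [[Cx|[y Xy Dyx]] nXx].
- have [Sx|] := EM (S x); last by left.
  by right; apply: contrapT => nBx; apply: nXx.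
- have [_ _ /(_ _ Dyx)[|xy]] := Dp _ Xy; first by right.
  by case: nXx; rewrite xy.
Qed.

Lemma reduce_cross S B C z : basis S B -> Ci C -> crosses C S -> C z -> ~ S z ->
  exists C', [/\ Ci C', crosses C' S, C' z &
    forall x, C' x -> C x /\ ~ S x \/ B x].
Proof.
move=> bB cC [[s Cs Ss] _] Cz nSz.
have [C' [cC' C'z C'B]] := reduce bB cC Cz nSz.
exists C'; split=> //; split; last by exists z.
apply: contrapT => nC'; have C'C : C' `<=` C.
  move=> x C'x; have [[]//|Bx] := C'B _ C'x.
  by case: nC'; exists x => //; case: bB => /(_ _ Bx)[].
by apply: nC'; exists s => //; rewrite (circ_eq cC' cC C'C).
Qed.

(** Uniqueness of [O] expresses connectivity 1: deleting any one element of [O] from [BX ∪ BY]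
    leaves a base. *)
Definition split_circuit X BX BY O :=
  [/\ basis X BX, basis (~` X) BY, Ci O,
      forall x, O x -> BX x \/ BY x &
      forall O', Ci O' -> (forall x, O' x -> BX x \/ BY x) -> O' = O].

Lemma split_circuitC X BX BY O :
  split_circuit X BX BY O -> split_circuit (~` X) BY BX O.
Proof.
move=> [bX bY cO OB Ou]; split=> //; first by rewrite setCK.
  by move=> x /OB[]; [right | left].
by move=> O' cO' O'B; apply: Ou => // x /O'B[]; [right | left].
Qed.

Lemma basis_cross X BX BY O : basis X BX -> basis (~` X) BY -> Ci O ->
  (forall x, O x -> BX x \/ BY x) -> crosses O X.
Proof.
move=> [BXX BXi _] [BYX BYi _] cO OB; split; apply: contrapT => nO.
- apply: (BYi _ cO) => x Ox; have [Bx|//] := OB _ Ox.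
  by case: nO; exists x => //; case: (BXX _ Bx).
- apply: (BXi _ cO) => x Ox; have [//|Bx] := OB _ Ox.
  by case: nO; exists x => //; case: (BYX _ Bx).
Qed.

Lemma split_circuit_ex X BX BY C : basis X BX -> basis (~` X) BY ->
  Ci C -> crosses C X ->
  exists O, [/\ Ci O, crosses O X & forall x, O x -> BX x \/ BY x].
Proof.
move=> bX bY cC CX; have [_ [z Cz nXz]] := CX.
have [C1 [cC1 C1X C1z C1B]] := reduce_cross bX cC CX Cz nXz.
have [[y C1y Xy] _] := C1X.
have [|C2 [cC2 C2X C2y C2B]] := reduce_cross bY cC1 (crossesC C1X) C1y; first exact.
exists C2; split=> //; first by move: (crossesC C2X); rewrite setCK.
move=> x /C2B [[/C1B[[_ nXx nnXx]|Bx _]]|Bx]; [by case: nnXx|by left|by right].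
Qed.

Lemma tsep_split X BX BY : tsep X -> basis X BX -> basis (~` X) BY ->
  exists O, split_circuit X BX BY O.
Proof.
move=> [[C cC CX] tX] bX bY.
have [O [cO OX OB]] := split_circuit_ex bX bY cC CX.
exists O; split=> // O' cO' O'B; apply: contrapT => O'O.
have [BXX BXi _] := bX; have [BYX BYi _] := bY.
(* two circuits in BX ∪ BY differing on X would yield a circuit in BX *)
have same G H q : Ci G -> Ci H -> (forall x, G x -> BX x \/ BY x) ->
    (forall x, H x -> BX x \/ BY x) -> X q -> H q -> G q.
  move=> cG cH GB HB Xq Hq; apply: contrapT => nGq.
  have [K [cK _ KGH]] := tX _ _ _ cG cH (basis_cross bX bY cG GB)
    (basis_cross bX bY cH HB) Xq Hq nGq.
  apply: (BXi _ cK) => x /KGH [GHx Xx].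
  by have [//|/BYX[]//] : BX x \/ BY x by case: GHx => [/GB|/HB].
have [q O'q nOq] := circ_diff cO' cO O'O.
have [[x Ox Xx] _] := OX.
have O'x := same _ _ _ cO' cO O'B OB Xx Ox.
have [G [cG Gq GO]] := circ_elim cO' cO O'x Ox O'q nOq.
have GB y : G y -> BX y \/ BY y by case/GO => [[/O'B|/OB]].
have Gx := same _ _ _ cG cO GB OB Xx Ox.
by case: (GO _ Gx) => _; apply.
Qed.

(** Reducing [G] on the side of [X] gives a circuit inside [BX ∪ BY], which has to be [O], and adds
    nothing outside [X]. *)
Lemma split_trace X BX BY O G : split_circuit X BX BY O -> Ci G ->
  crosses G X -> (forall x, G x -> ~ X x -> BY x) ->
  forall x, ~ X x -> G x <-> O x.
Proof.
move=> [bX bY cO OB Ou] cG GX GB x nXx.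
have red z : G z -> ~ X z ->
    O z /\ forall y, O y -> ~ X y -> G y.
  move=> Gz nXz; have [G' [cG' G'X G'z G'B]] := reduce_cross bX cG GX Gz nXz.
  have G'O : G' = O.
    apply: Ou => // y /G'B [[Gy nXy]|]; last by left.
    by right; apply: GB.
  rewrite -G'O; split=> // y /G'B [[]//|By] nXy.
  by case: bX => /(_ _ By)[].
split=> [Gx|Ox]; first by have [] := red _ Gx nXx.
by have [_ [z Gz nXz]] := GX; have [_] := red _ Gz nXz; apply.
Qed.

(** Once [C] and [H] are reduced to [BY] outside [X], both have the trace of [O] there and share a
    point [y]. Eliminating [y] leaves a circuit inside [X], for outside [X] it would again have the
    whole trace of [O], including [y]. *)
Lemma split_tsep X BX BY O : split_circuit X BX BY O -> tsep X.
Proof.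
move=> sp; have [bX bY cO OB Ou] := sp.
split; first by exists O => //; exact: basis_cross OB.
move=> C H q cC cH CX HX Xq Hq nCq.
have [[c Cc Xc] _] := CX.
have [|C1 [cC1 C1X C1c C1B]] := reduce_cross bY cC (crossesC CX) Cc; first exact.
have [|H1 [cH1 H1X H1q H1B]] := reduce_cross bY cH (crossesC HX) Hq; first exact.
have {}C1X : crosses C1 X by move: (crossesC C1X); rewrite setCK.
have {}H1X : crosses H1 X by move: (crossesC H1X); rewrite setCK.
have C1Y : forall x, C1 x -> ~ X x -> BY x.
  by move=> x /C1B [[_ nn]|//] nXx; case: nn.
have H1Y : forall x, H1 x -> ~ X x -> BY x.
  by move=> x /H1B [[_ nn]|//] nXx; case: nn.
have [BYX _ _] := bY.
have C1C x : C1 x -> X x -> C x by case/C1B => [[]//|/BYX[]].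
have H1H x : H1 x -> X x -> H x by case/H1B => [[]//|/BYX[]].
have [_ [y Oy nXy]] := basis_cross bX bY cO OB.
have C1y := (split_trace sp cC1 C1X C1Y nXy).2 Oy.
have H1y := (split_trace sp cH1 H1X H1Y nXy).2 Oy.
have nC1q : ~ C1 q by move=> /C1C /(_ Xq).
have [K [cK Kq KCH]] := circ_elim cH1 cC1 H1y C1y H1q nC1q.
have Kin x : K x -> X x.
  move=> Kx; apply: contrapT => nXx.
  have KY : forall x, K x -> ~ X x -> BY x.
    by move=> z /KCH [[/H1Y|/C1Y]].
  have KX : crosses K X by split; [exists q | exists x].
  have := (split_trace sp cK KX KY nXy).2 Oy.
  by move=> /KCH[].
exists K; split=> // x Kx; split; last exact: Kin.
by case/KCH: (Kx) => [[/H1H|/C1C]] h _; [right | left]; apply/h/Kin.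
Qed.

(** The second clause of [tsep] looks at one side only; the symmetric [split_circuit] carries it
    over to the other. *)
Lemma tsepC X : tsep X -> tsep (~` X).
Proof.
move=> tX; have [BX bX] := basis_ex X; have [BY bY] := basis_ex (~` X).
have [O sp] := tsep_split tX bX bY.
exact: split_tsep (split_circuitC sp).
Qed.

Lemma basis_trace X B G H : tsep X -> basis X B -> Ci G -> Ci H ->
  crosses G X -> crosses H X -> (forall x, G x -> X x -> B x) ->
  (forall x, H x -> X x -> B x) -> forall x, X x -> G x <-> H x.
Proof.
move=> tX bX cG cH GX HX GB HB x Xx.
have [BY bY] := basis_ex (~` X).
have [O sp] := tsep_split tX bX bY.
have nnXx : ~ (~` X) x by exact.
have eqG : G x <-> O x.
  apply: (split_trace (split_circuitC sp) cG (crossesC GX)) nnXx.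
  by move=> y Gy /contrapT; exact: GB.
have eqH : H x <-> O x.
  apply: (split_trace (split_circuitC sp) cH (crossesC HX)) nnXx.
  by move=> y Hy /contrapT; exact: HB.
by rewrite eqG eqH.
Qed.

(** The trace of [C] on [X] extends to a basis of [X], that of [D] to a basis of the complement. The
    only circuit in the union of the two bases has both traces. *)
Lemma swap X C D : tsep X -> Ci C -> Ci D -> crosses C X -> crosses D X ->
  Ci [set x | C x /\ X x \/ D x /\ ~ X x].
Proof.
move=> tX cC cD CX DX.
have [||BX bX CB] := @basis_ext X (C `&` X).
- by move=> x [Cx Xx]; split=> //; exact: circ_sub Cx.
- move=> K cK KC; have KeC : K = C by apply: circ_eq => // x /KC[].
  by have [_ [y Cy]] := CX; apply; apply: (KC y _).2; rewrite KeC.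
have [||BY bY DB] := @basis_ext (~` X) (D `&` ~` X).
- by move=> x [Dx Xx]; split=> //; exact: circ_sub Dx.
- move=> K cK KD; have KeD : K = D by apply: circ_eq => // x /KD[].
  by have [[y Dy Xy] _] := DX; apply: (KD y _).2 Xy; rewrite KeD.
have [O sp] := tsep_split tX bX bY.
have [_ _ cO _ _] := sp.
suff -> : [set x | C x /\ X x \/ D x /\ ~ X x] = O by [].
have DO x : ~ X x -> D x <-> O x.
  by apply: (split_trace sp) => // y Dy nXy; apply: DB.
have CO x : X x -> C x <-> O x.
  move=> Xx; apply: (split_trace (split_circuitC sp) cC (crossesC CX)); last exact.
  by move=> y Cy /contrapT Xy; apply: CB.
apply/seteqP; split=> x /=.
  by move=> [[Cx Xx]|[Dx Xx]]; [apply/(CO x) | apply/(DO x)].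
by have [Xx|nXx] := EM (X x); [move=> /(CO _ Xx); left | move=> /(DO _ nXx); right].
Qed.

(** Giving [D] the trace of [C] on [X] yields a circuit inside [D], hence [D] itself. *)
Lemma trace_eq X C D : tsep X -> Ci C -> Ci D -> crosses C X -> crosses D X ->
  (forall x, C x -> X x -> D x) -> forall x, D x -> X x -> C x.
Proof.
move=> tX cC cD CX DX CD x Dx Xx.
suff CDD : [set x | C x /\ X x \/ D x /\ ~ X x] = D.
  by move: Dx; rewrite -CDD /= => -[[]//|[]].
apply: circ_eq => //; first exact: swap.
by move=> y [[]|[]] //; auto.
Qed.

End Circuits.

(** * Quotients by partitions into separated sets *)

Section Quotient.
Variables (T U : Type) (M : circuit_system T) (pi : T -> U).
Local Notation Ci := (circuits M).
Local Notation E := (ground M).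
Implicit Types (A B C D G H I K O Q S X Y Z : set T) (x y z p q : T).

Definition fib (i : U) : set T := [set x | pi x = i].

Definition nonfiber C := exists x y, [/\ C x, C y & pi x <> pi y].

Definition quotient : circuit_system U :=
  CircuitSystem (pi @` E) [set pi @` C | C in [set C | Ci C /\ nonfiber C]].

Hypothesis Mm : is_matroid M.
Hypothesis tpi : forall x, E x -> tsep M (fib (pi x)).

Lemma nonfiber_cross C x : nonfiber C -> C x -> crosses C (fib (pi x)).
Proof.
move=> [a [b [Ca Cb ab]]] Cx; split; first by exists x.
have [ax|ax] := EM (pi a = pi x); last by exists a.
by exists b => // bx; apply: ab; rewrite ax bx.
Qed.

(* The single set Q encodes the choice of one trace in every fibre. *)
Definition traces Q := forall x, E x -> exists K,
  [/\ Ci K, crosses K (fib (pi x)) & forall y, pi y = pi x -> Q y <-> K y].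

Definition lift C Q := [set x | Q x /\ exists2 y, C y & pi y = pi x].

(** The choice of traces now follows [H] wherever [H] goes. With it, a circuit whose fibres are all
    met by [H] has its lift inside [H]. *)
Definition update Q H :=
  [set y | (exists2 h, H h & pi h = pi y) /\ H y \/
           ~ (exists2 h, H h & pi h = pi y) /\ Q y].

Lemma traces_ex : exists Q, traces Q.
Proof.
have /choice[K Kp] : forall i, exists K, (exists2 x, E x & pi x = i) ->
    Ci K /\ crosses K (fib i).
  move=> i; have [[x Ex <-]|nx] := EM (exists2 x, E x & pi x = i); last by exists set0.
  by have [[K cK KX] _] := tpi Ex; exists K.
exists [set x | K (pi x) x] => x Ex; exists (K (pi x)).
have [|? ?] := Kp (pi x); first by exists x.
by split=> // y /= ->.
Qed.

Lemma traces_update Q H : traces Q -> Ci H -> nonfiber H -> traces (update Q H).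
Proof.
move=> tQ cH nH x Ex; have [[h Hh hx]|nh] := EM (exists2 h, H h & pi h = pi x).
- exists H; split=> //; first by rewrite -hx; exact: nonfiber_cross.
  move=> y yx; rewrite /update /= yx; split=> [[[]|[]]//|Hy]; last by left; split=> //; exists h.
  by case; exists h.
- have [K [cK KX KQ]] := tQ _ Ex; exists K; split=> // y yx.
  rewrite -KQ //= /update /= yx; split=> [[[]|[]]//|Qy]; last by right.
Qed.

(* In every fibre, extend the trace chosen by Q to a basis and eliminate from C all
   elements outside these bases simultaneously. *)
Lemma lift_sub Q C y0 : traces Q -> Ci C -> nonfiber C -> C y0 ->
  exists C', [/\ Ci C', nonfiber C', C' `<=` lift C Q,
    exists2 x, C' x & pi x = pi y0 &
    forall x y, C' x -> Q y -> pi y = pi x -> C' y].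
Proof.
move=> tQ cC nC Cy0.
have Ey0 := circ_sub Mm cC Cy0.
have [K [cK KX KQ]] := tQ _ Ey0.
set i0 := pi y0 in KX KQ.
have [[z Kz zi0] [k Kk ki0]] := KX.
(* In the fibre of [y0] the trace chosen by [Q] is put in beforehand and nothing is eliminated. So
   its point [z] is outside all eliminating circuits. *)
pose C1 := [set x | K x /\ fib i0 x \/ C x /\ ~ fib i0 x].
have cC1 : Ci C1 by apply: swap => //; [exact: tpi | exact: nonfiber_cross].
have /choice[B Bp] : forall i, exists B, (exists2 x, E x & pi x = i) ->
    basis M (fib i) B /\ forall y, pi y = i -> Q y -> B y.
  move=> i; have [[x Ex <-]|nx] := EM (exists2 x, E x & pi x = i); last by exists set0.
  have [K' [cK' K'X K'Q]] := tQ _ Ex.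
  have [||B bB QB] := @basis_ext _ _ Mm (fib (pi x)) (K' `&` fib (pi x)).
  - by move=> y [K'y]; split=> //; exact: circ_sub K'y.
  - move=> D cD DK; have DeK : D = K' by apply: (circ_eq Mm) => // y /DK[].
    by have [_ [y K'y]] := K'X; apply; rewrite -DeK in K'y; case: (DK _ K'y).
  by exists B => _; split=> // y yx /(K'Q _ yx) Ky; apply: QB.
have {}Bp x : E x -> basis M (fib (pi x)) (B (pi x)) /\
    forall y, pi y = pi x -> Q y -> B (pi x) y by move=> Ex; apply: Bp; exists x.
pose X := [set x | [/\ C x, pi x <> i0 & ~ B (pi x) x]].
have /choice[D Dp] : forall x, exists D, X x ->
    [/\ Ci D, D x & forall y, D y -> B (pi x) y \/ y = x].
  move=> x; have [[Cx xi nBx]|nX] := EM (X x); last by exists set0.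
  have Ex := circ_sub Mm cC Cx; have [[_ _ bB] _] := Bp _ Ex.
  by have [D ?] := bB _ erefl Ex nBx; exists D.
have Dfib x y : X x -> D x y -> pi y = pi x.
  move=> Xx Dxy; have [_ _ /(_ _ Dxy)[|->//]] := Dp _ Xx.
  by have [Cx _ _] := Xx; have [[BX _ _] _] := Bp _ (circ_sub Mm cC Cx); case/BX.
have [|||||C' [cC' C'z C's]] := circuits_C3 Mm (X := X) (C := C1) (D := D) _ _ _ _ (z := z).
- by move=> x [Cx xi _]; right.
- by [].
- by move=> x /Dp[].
- move=> x y Xx Xy; split=> [Dyx|->]; last by have [] := Dp _ Xy.
  have [_ _ /(_ _ Dyx) [|//]] := Dp _ Xy.
  by rewrite -(Dfib _ _ Xy Dyx); case: Xx.
- split; first by left.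
  by move=> [x Xx Dxz]; have [_ + _] := Xx; rewrite -(Dfib _ _ Xx Dxz).
have C'in x : C' x -> (exists2 y, C y & pi y = pi x) /\
    (pi x = i0 /\ K x \/ pi x <> i0 /\ B (pi x) x).
  move=> /C's [C1x nX]; have [xi|xi] := EM (pi x = i0).
    split; first by exists y0.
    left; split=> //; case: C1x => [[[]//|[]//]|[y Xy Dyx]].
    by have [_ + _] := Xy; rewrite -(Dfib _ _ Xy Dyx).
  case: C1x => [[[]//|[Cx _]]|[y Xy Dyx]].
    split; first by exists x.
    by right; split=> //; apply: contrapT => nB; apply: nX.
  have yx := Dfib _ _ Xy Dyx; have [Cy _ _] := Xy.
  split; first by exists y.
  right; split=> //; have [_ _ /(_ _ Dyx)[|xy]] := Dp _ Xy; first by rewrite yx.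
  by case: nX; rewrite xy.
(* Inside the fibre of [y0], [C'] would be contained in [K], hence equal to it, but [K] leaves the
   fibre. *)
have nC' : nonfiber C'.
  apply: contrapT => nn.
  have C'K : C' `<=` K.
    move=> x C'x; have [_ [[]//|[xi _]]] := C'in _ C'x.
    by case: nn; exists x, z; split=> //; rewrite zi0.
  have C'eK := circ_eq Mm cC' cK C'K.
  by apply: nn; exists z, k; rewrite C'eK; split=> //; rewrite zi0 => /esym.
have C'Q x : C' x -> forall y, pi y = pi x -> C' y <-> Q y.
  move=> C'x y yx; have C'X := nonfiber_cross nC' C'x.
  have Ex := circ_sub Mm cC' C'x.
  have [xi|xi] := EM (pi x = i0).
    rewrite KQ ?yx //; rewrite xi in C'X yx.
    have sub u : C' u -> pi u = i0 -> K u by move=> /C'in [_ [[]|[]]].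
    split=> [C'y|Ky]; first exact: sub.
    by apply: (trace_eq Mm (tpi Ey0) cC' cK C'X KX) => //.
  have [K' [cK' K'X K'Q]] := tQ _ Ex.
  rewrite K'Q //; have [bB QB] := Bp _ Ex.
  apply: (basis_trace Mm (tpi Ex) bB) => // u; last by move=> K'u ux; apply: QB => //; apply/K'Q.
  by move=> /C'in [_ [[ui _]|[_ Bu]]] ux; [case: xi; rewrite -ux | rewrite -[pi x]ux].
exists C'; split=> //.
- move=> x C'x; split; first by apply/(C'Q _ C'x).
  by have [] := C'in _ C'x.
- by exists z.
- by move=> x y C'x Qy yx; apply/(C'Q _ C'x).
Qed.

(** The circuit [C'] from [lift_sub] might miss some fibres of [C]. But lifting it back to the
    traces of [C] gives a circuit inside [C], hence [C] itself, so it meets them all. *)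
Lemma lift_circuit Q C : traces Q -> Ci C -> nonfiber C -> Ci (lift C Q).
Proof.
move=> tQ cC nC; have [y0 [_ [Cy0 _ _]]] := nC.
have [C' [cC' nC' C'l _ C'Q]] := lift_sub tQ cC nC Cy0.
have [a [_ [C'a _ _]]] := nC'.
have [C2 [cC2 nC2 C2l _ _]] :=
  lift_sub (traces_update tQ cC nC) cC' nC' C'a.
have C2C : C2 = C.
  apply: (circ_eq Mm) => // x /C2l [[[]//|[nx _]] [y C'y yx]].
  by case: nx; have [_ [c Cc cy]] := C'l _ C'y; exists c => //; rewrite cy.
suff -> : lift C Q = C' by [].
apply/seteqP; split=> // x [Qx [y Cy yx]].
move: Cy; rewrite -C2C => /C2l [_ [u C'u uy]].
by apply: (C'Q u) => //; rewrite uy yx.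
Qed.

(** With the traces of [H], the lift of [C] is a circuit inside [H], hence [H]. This is
    incomparability of circuits in the quotient. *)
Lemma shape_sub C H : Ci C -> Ci H -> nonfiber C -> nonfiber H ->
  (forall x, C x -> exists2 y, H y & pi y = pi x) ->
  forall y, H y -> exists2 x, C x & pi x = pi y.
Proof.
move=> cC cH nC nH CH y Hy; have [Q tQ] := traces_ex.
have cL := lift_circuit (traces_update tQ cH nH) cC nC.
have LH : lift C (update Q H) = H.
  apply: (circ_eq Mm) => // x [[[]//|[nh _]] [u Cu ux]].
  by case: nh; have [h Hh hu] := CH _ Cu; exists h => //; rewrite hu.
by move: Hy; rewrite -LH => -[].
Qed.

Lemma trace_in_fiber Q C x : traces Q -> Ci C -> C x -> C `<=` Q -> nonfiber C.
Proof.
move=> tQ cC Cx CQ; have [K [cK KX KQ]] := tQ _ (circ_sub Mm cC Cx).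
apply: contrapT => nn; have Cf y : C y -> pi y = pi x.
  by move=> Cy; apply: contrapT => yx; apply: nn; exists y, x.
have CK : C = K by apply: (circ_eq Mm) => // y Cy; apply/KQ; [exact: Cf | exact: CQ].
by have [_ [k Kk]] := KX; apply; apply: Cf; rewrite CK.
Qed.

Lemma trace_full Q C x y : traces Q -> Ci C -> C `<=` Q -> C x -> Q y ->
  pi y = pi x -> C y.
Proof.
move=> tQ cC CQ Cx Qy yx; have [K [cK KX KQ]] := tQ _ (circ_sub Mm cC Cx).
have nC := trace_in_fiber tQ cC Cx CQ.
apply: (trace_eq Mm (tpi (circ_sub Mm cC Cx)) cC cK (nonfiber_cross nC Cx) KX) => //.
- by move=> u Cu ux; apply/KQ => //; exact: CQ.
- by apply/KQ.
Qed.

(** The circuits of the quotient correspond to the circuits of [M] inside one fixed choice [Q] of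
    traces; the axioms are transferred from these. *)
Lemma quotient_matroid : is_matroid quotient.
Proof.
have [Q tQ] := traces_ex.
have Qx x : E x -> exists2 y, Q y & pi y = pi x.
  by move=> Ex; have [K [_ [[k Kk kx] _] KQ]] := tQ _ Ex; exists k => //; exact/KQ.
split.
- by move=> _ [C [cC _] <-] _ [x Cx <-]; exists x => //; exact: circ_sub Cx.
- move=> [C [cC _] C0]; have [x Cx] := circ_neq0 Mm cC.
  by have : (pi @` C) (pi x); [exists x | rewrite C0].
- move=> _ _ [C [cC nC] <-] [D [cD nD] <-] [CD]; apply => _ [y Dy <-].
  have [|x Cx xy] := shape_sub cC cD nC nD _ Dy; last by exists x.
  by move=> x Cx; have [|y' Dy' yx] := CD (pi x); [exists x | exists y'].
- move=> X' C' D' X'C' [C [cC nC] CC'] D'c X'D' z' [C'z' nD'z'].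
  pose L (F : set U) := [set x | Q x /\ F (pi x)].
  have cL (F : set U) : circuits quotient F -> Ci (L F).
    move=> [S [cS nS] SF]; have := lift_circuit tQ cS nS.
    congr (Ci _); apply/seteqP; split=> x [Qx']; rewrite -SF.
      by move=> [y Sy yx]; split=> //; exists y.
    by move=> [y Sy yx]; split=> //; exists y.
  have cC' : circuits quotient C' by exists C.
  have C'E i : C' i -> exists2 y, Q y & pi y = i.
    by rewrite -CC' => -[x /(circ_sub Mm cC) /Qx[y Qy yx] <-]; exists y.
  have [y0 [_ [Cy0 _ _]]] := nC.
  (* A point of [Q] represents each fibre: by [trace_full], eliminating the point eliminates the
     whole fibre. Outside [C'] the value [y0] is a dummy. *)
  have /choice[q qp] : forall i, exists y, C' i -> Q y /\ pi y = i.
    move=> i; have [/C'E[y]|] := EM (C' i); first by exists y.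
    by exists y0.
  have [||||K [cK Kz Ks]] := circuits_C3 Mm (X := q @` X') (C := L C')
     (D := fun x => L (D' (pi x))) _ (cL _ cC') _ _ (z := q z').
  + by move=> _ [i X'i <-]; have [|? qi] := qp i; [exact: X'C'|split=> //; rewrite qi; exact: X'C'].
  + move=> _ [i X'i <-]; apply: cL; have [|_ ->] := qp i; [exact: X'C'|exact: D'c].
  + move=> _ _ [i X'i <-] [j X'j <-]; have [|Qi qi] := qp i; first exact: X'C'.
    have [|Qj qj] := qp j; first exact: X'C'.
    rewrite /L /= qi qj; split=> [[_]|qij]; first by move/(X'D' i j X'i X'j) ->.
    by split=> //; apply/X'D' => //; rewrite -qi qij qj.
  + have [//|Qz qz] := qp z'; split; first by split=> //; rewrite qz.
    move=> [_ [i X'i <-] [_]]; have [|_ ->] := qp i; first exact: X'C'.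
    by rewrite qz => D'z; apply: nD'z'; exists i.
  have [//|Qz qz] := qp z'.
  have KQ : K `<=` Q by move=> x /Ks [[[]//|[? _ []]//]].
  exists (pi @` K); split.
  + by exists K => //; split=> //; exact: trace_in_fiber Kz KQ.
  + by exists (q z').
  + move=> _ [x Kx <-]; have [Kx1 Kx2] := Ks _ Kx; split.
      case: Kx1 => [[_ ?]|[_ [i X'i <-] [_ D'x]]]; first by left.
      by right; exists i => //; have [|_ <-] := qp i; first exact: X'C'.
    move=> X'x; have [|Qy qy] := qp (pi x); first exact: X'C'.
    suff /Ks[_] : K (q (pi x)) by apply; exists (pi x).
    exact: (trace_full tQ cK KQ Kx).
- move=> I' S' [I'E I'i] I'S' S'E.
  have [[x0 Ex0]|n0] := EM (exists x, E x); last first.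
    exists I'; split; first by split.
    move=> K' [[K'E _] I'K _] _; apply/seteqP; split=> // i /K'E [x Ex].
    by case: n0; exists x.
  have /choice[q qp] : forall i, exists y, (pi @` E) i -> Q y /\ pi y = i.
    move=> i; have [[x /Qx[y Qy <-] <-]|] := EM ((pi @` E) i); first by exists y.
    by exists x0.
  (* Over [S'], only the representatives of fibres outside [I'] are left out of [Q], so that
     independence depends on the representatives alone. *)
  pose I := [set x | [/\ Q x, S' (pi x), E x & q (pi x) = x -> I' (pi x)]].
  pose S := [set x | [/\ Q x, S' (pi x) & E x]].
  have QE x : Q x -> S' (pi x) -> E x.
    move=> Qx' /S'E [y Ey yx]; have [K [cK _ KQ]] := tQ _ Ey.
    by apply: (circ_sub Mm cK); apply/KQ.
  have full C x : Ci C -> C `<=` Q -> C x -> S' (pi x) -> C (q (pi x)).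
    move=> cC CQ Cx S'x; have [Qq qx] := qp _ (S'E _ S'x).
    exact: (trace_full tQ cC CQ Cx).
  have indI : indep M I.
    split=> [x []//|C cC CI].
    have CQ : C `<=` Q by move=> x /CI[].
    have [x Cx] := circ_neq0 Mm cC.
    apply: (I'i (pi @` C)).
      by exists C => //; split=> //; apply: trace_in_fiber Cx CQ.
    move=> _ [y Cy <-]; have [_ S'y _ _] := CI _ Cy.
    have Cq := full _ _ cC CQ Cy S'y.
    have [_ _ _] := CI _ Cq; have [_ ->] := qp _ (S'E _ S'y); exact.
  have [|x []//|J [[[JE Jind] IJ JS] Jmax]] := circuits_CM Mm (S := S) indI.
    by move=> x [].
  have JQ : J `<=` Q by move=> x /JS[].
  exists [set i | S' i /\ J (q i)]; split.
    split=> [|i I'i'|i []//]; last first.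
      have S'i := I'S' _ I'i'; have [Qq qi] := qp _ (S'E _ S'i).
      split=> //; apply: IJ; split=> //; rewrite ?qi //.
      by apply: QE; rewrite ?qi.
    split=> [i [/S'E//]|_ [C [cC nC] <-] CJ].
    apply: (Jind (lift C Q)); first exact: lift_circuit.
    move=> x [Qx' [y Cy yx]]; have [S'x Jq] : S' (pi x) /\ J (q (pi x)).
      by rewrite -yx; apply: CJ; exists y.
    have [qx|qx] := EM (q (pi x) = x); first by rewrite -qx.
    by apply: IJ; split=> //; exact: QE.
  move=> K' [[K'E K'i] I'K K'S] JK; apply/seteqP; split=> // i K'i'.
  have S'i := K'S _ K'i'; split=> //.
  have [Qq qi] := qp _ (S'E _ S'i).
  have Eq : E (q i) by apply: QE; rewrite ?qi.
  rewrite -(Jmax (q i |` J)); [by left| |by right]; split.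
  + split=> [x [->//|/JE//]|C cC CJ].
    have CQ : C `<=` Q by move=> x /CJ [->|/JQ].
    have [x Cx] := circ_neq0 Mm cC.
    apply: (K'i (pi @` C)).
      by exists C => //; split=> //; apply: trace_in_fiber Cx CQ.
    move=> _ [y Cy <-]; have S'y : S' (pi y).
      by have [->|/JS[]//] := CJ _ Cy; rewrite qi.
    have [/(congr1 pi)|Jq] := CJ _ (full _ _ cC CQ Cy S'y).
      by have [_ ->] := qp _ (S'E _ S'y); rewrite qi => ->.
    exact: JK.
  + by move=> x /IJ; right.
  + by move=> x [->|/JS//]; split=> //; rewrite qi.
Qed.

Lemma quotient_connected : connected_matroid M -> connected_matroid quotient.
Proof.
move=> Mc _ _ [x Ex <-] [y Ey <-] xy.
have [|C [cC Cx Cy]] := Mc x y Ex Ey; first by move=> xy'; apply: xy; rewrite xy'.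
exists (pi @` C); split; [|by exists x|by exists y].
by exists C => //; split=> //; exists x, y.
Qed.

Lemma tsep_quotient (X : set U) : tsep quotient X <-> tsep M (pi @^-1` X).
Proof.
have crossE C : crosses (pi @` C) X <-> crosses C (pi @^-1` X).
  split=> [[[_ [x Cx <-] Xx] [_ [y Cy <-] nXy]]|[[x Cx Xx] [y Cy Xy]]].
    by split; [exists x | exists y].
  by split; [exists (pi x) => //; exists x | exists (pi y) => //; exists y].
have crossN C : crosses C (pi @^-1` X) -> nonfiber C.
  by move=> [[x Cx Xx] [y Cy Xy]]; exists x, y; split=> // xy; apply: Xy; rewrite /= -xy.
split=> -[[C0 cC0 C0X] tX].
- have [C1 [cC1 nC1] C1C0] := cC0; split.
    by exists C1 => //; rewrite -crossE C1C0.
  move=> C H q cC cH CX HX Xq Hq nCq.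
  have nC := crossN _ CX; have nH := crossN _ HX.
  (* If [C] meets the fibre of [q], the exchange takes place inside that fibre, which is part of the
     preimage of [X]. *)
  have [[c Cc cq]|nCf] := EM (exists2 c, C c & pi c = pi q).
    have Eq := circ_sub Mm cH Hq.
    have CF : crosses C (fib (pi q)) by rewrite -cq; exact: nonfiber_cross.
    have [K [cK Kq KCH]] := (tpi Eq).2 _ _ _ cC cH CF (nonfiber_cross nH Hq) erefl Hq nCq.
    by exists K; split=> // x /KCH [? xq]; split=> //; rewrite /preimage /= xq.
  have [||||||_ [[K [cK nK] <-] Kq KCH]] := tX (pi @` C) (pi @` H) (pi q) _ _ _ _ Xq.
  + by exists C.
  + by exists H.
  + by rewrite crossE.
  + by rewrite crossE.
  + by exists q.
  + by move=> [c Cc cq]; apply: nCf; exists c.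
  have [Q tQ] := traces_ex.
  (* In every fibre that [C] or [H] meets, these traces come from [C] or [H], so the lift of [K]
     stays inside their union. *)
  have tQ' := traces_update (traces_update tQ cC nC) cH nH.
  have cL := lift_circuit tQ' cK nK.
  have [k Kk kq] := Kq.
  exists (lift K (update (update Q C) H)); split=> //.
    split; last by exists k.
    by left; split=> //; exists q.
  move=> x [Q'x [y Ky yx]]; have [|CHx Xx] := KCH (pi x); first by exists y.
  split=> //; case: Q'x => [[_ Hx]|[nHx]]; first by right.
  case=> [[_ Cx]|[nCx]]; first by left.
  by case: CHx => [[c Cc cx]|[h Hh hx]]; [case: nCx; exists c|case: nHx; exists h].
- split.
    exists (pi @` C0); last by rewrite crossE.
    by exists C0 => //; split=> //; exact: crossN.
  move=> _ _ q' [C [cC nC] <-] [H [cH nH] <-]; rewrite !crossE.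
  move=> CX HX Xq [q Hq qq'] nCq; rewrite -{}qq' in Xq nCq *.
  have [|K [cK Kq KCH]] := tX C H q cC cH CX HX Xq Hq.
    by move=> Cq; apply: nCq; exists q.
  exists (pi @` K); split; [|by exists q|].
    exists K => //; split=> //; apply: contrapT => nK.
    have KH : K `<=` H.
      move=> x Kx; have [[Cx|//] _] := KCH _ Kx.
      case: nCq; exists x => //; apply: contrapT => xq.
      by apply: nK; exists x, q.
    have KeH := circ_eq Mm cK cH KH.
    by apply: nK; rewrite KeH.
  move=> _ [x Kx <-]; have [CHx Xx] := KCH _ Kx.
  by split=> //; case: CHx => ?; [left | right]; exists x.
Qed.

End Quotient.

(** * Crossing separations *)

Section Corners.
Variables (T : Type) (M : circuit_system T).
Local Notation Ci := (circuits M).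
Local Notation E := (ground M).
Local Notation tsep := (tsep M).
Implicit Types (A B C D G H I K O Q S X Y Z : set T) (x y z p q : T).

Hypothesis Mm : is_matroid M.

(** Converse of [swap]. Let [D] be [C] inside [X] and [H] outside, and eliminate a point [y] outside
    [X] from [H] and [D]. If the result [K] left [X], the circuit made of [H] inside and [K] outside
    would lie in [H] but lack [y]. *)
Lemma swap_tsep X : (exists2 C, Ci C & crosses C X) ->
  (forall C D, Ci C -> Ci D -> crosses C X -> crosses D X ->
    Ci [set x | C x /\ X x \/ D x /\ ~ X x]) -> tsep X.
Proof.
move=> exX sX; split=> // C H q cC cH CX HX Xq Hq nCq.
have [_ [y Hy nXy]] := HX.
have cD := sX _ _ cC cH CX HX; set D := [set x | _] in cD.
have [||||K [cK Kq KHD]] := circ_elim Mm cH cD (x := y) (z := q) => //.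
- by right.
- by case=> [[]|[]].
exists K; split=> // x Kx.
have KX z : K z -> X z.
  move=> Kz; apply: contrapT => nXz.
  have KX : crosses K X by split; [exists q|exists z].
  have cL := sX _ _ cH cK HX KX.
  set L := [set x | _] in cL.
  have LH : L = H.
    apply: (circ_eq Mm) => // w [[]//|[/KHD [[//|[[]//|[]//]] _] _]].
  by have : L y; [rewrite LH | case=> [[]//|[/KHD []]]].
split; last exact: KX.
by have [[Hx|[[Cx _]|[Hx _]]] _] := KHD _ Kx; [right|left|right].
Qed.

Lemma tsep_meets X : tsep X -> (exists2 x, E x & X x) /\ (exists2 x, E x & ~ X x).
Proof.
move=> [[C cC [[x Cx Xx] [y Cy Xy]]] _].
by split; [exists x|exists y] => //; apply: (circ_sub Mm cC).
Qed.

Definition crossing X Y :=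
  [/\ exists x, [/\ E x, X x & Y x], exists x, [/\ E x, X x & ~ Y x],
      exists x, [/\ E x, ~ X x & Y x] & exists x, [/\ E x, ~ X x & ~ Y x]].

Lemma crossing_sym X Y : crossing X Y -> crossing Y X.
Proof.
move=> [[a [? ? ?]] [b [? ? ?]] [c [? ? ?]] [d [? ? ?]]].
by split; [exists a|exists c|exists b|exists d].
Qed.

Lemma crossingC X Y : crossing X Y -> crossing (~` X) Y.
Proof.
move=> [[a [? ? ?]] [b [? ? ?]] [c [? ? ?]] [d [? ? ?]]].
by split; [exists c|exists d|exists a; split=> //; apply|exists b; split=> //; apply].
Qed.

Hypothesis Mc : connected_matroid M.

Lemma join X x y : E x -> E y -> X x -> ~ X y -> exists C, [/\ Ci C, C x & C y].
Proof. by move=> Ex Ey Xx Xy; apply: Mc => // xy; apply: Xy; rewrite -xy. Qed.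

(** A patchwork with one piece in each corner; a swap along [X] or along [Y] exchanges two of the
    four pieces. Below, [R] says that it is a circuit, and [n1] to [n4] that a piece is nonempty. *)
Definition traced X Y (a b c d : set T) := [set x |
  [\/ [/\ X x, Y x & a x], [/\ X x, ~ Y x & b x], [/\ ~ X x, Y x & c x] |
      [/\ ~ X x, ~ Y x & d x]]].

Section Corner.
Variables X Y : set T.
Hypotheses (tX : tsep X) (tY : tsep Y).

Local Notation R a b c d := (Ci (traced X Y a b c d)).
Local Notation n1 a := (exists x, [/\ X x, Y x & a x]).
Local Notation n2 a := (exists x, [/\ X x, ~ Y x & a x]).
Local Notation n3 a := (exists x, [/\ ~ X x, Y x & a x]).
Local Notation n4 a := (exists x, [/\ ~ X x, ~ Y x & a x]).

Lemma traced_id C : Ci C -> R C C C C.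
Proof.
move=> cC; move: (cC); rewrite /traced; congr (Ci _).
apply/seteqP; split=> x; last by case=> -[].
have [Xx|Xx] := EM (X x); have [Yx|Yx] := EM (Y x) => Cx.
- exact: Or41.
- exact: Or42.
- exact: Or43.
- exact: Or44.
Qed.

Lemma traced_swapX a b c d a' b' c' d' : R a b c d -> R a' b' c' d' ->
  n1 a \/ n2 b -> n3 c \/ n4 d -> n1 a' \/ n2 b' -> n3 c' \/ n4 d' -> R a b c' d'.
Proof.
move=> r r' h1 h2 h3 h4; rewrite /traced.
suff -> : [set x |
  [\/ [/\ X x, Y x & a x], [/\ X x, ~ Y x & b x], [/\ ~ X x, Y x & c' x] |
      [/\ ~ X x, ~ Y x & d' x]]] = [set x |
   [set x |
  [\/ [/\ X x, Y x & a x], [/\ X x, ~ Y x & b x], [/\ ~ X x, Y x & c x] |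
      [/\ ~ X x, ~ Y x & d x]]] x /\ X x \/ [set x |
  [\/ [/\ X x, Y x & a' x], [/\ X x, ~ Y x & b' x], [/\ ~ X x, Y x & c' x] |
      [/\ ~ X x, ~ Y x & d' x]]] x /\ ~ X x].
  apply: (swap Mm tX r r'); split.
  - by case: h1 => -[x [? ? ?]]; exists x => //; [exact: Or41 | exact: Or42].
  - by case: h2 => -[x [? ? ?]]; exists x => //; [exact: Or43 | exact: Or44].
  - by case: h3 => -[x [? ? ?]]; exists x => //; [exact: Or41 | exact: Or42].
  - by case: h4 => -[x [? ? ?]]; exists x => //; [exact: Or43 | exact: Or44].
apply/seteqP; split=> x /=.
- case=> -[? ? ?]; [left|left|right|right]; split=> //;
    by [exact: Or41|exact: Or42|exact: Or43|exact: Or44].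
- by case=> -[[] [? ? ?] ?] //; [exact: Or41|exact: Or42|exact: Or43|exact: Or44].
Qed.

Lemma traced_swapY a b c d a' b' c' d' : R a b c d -> R a' b' c' d' ->
  n1 a \/ n3 c -> n2 b \/ n4 d -> n1 a' \/ n3 c' -> n2 b' \/ n4 d' -> R a b' c d'.
Proof.
move=> r r' h1 h2 h3 h4; rewrite /traced.
suff -> : [set x |
  [\/ [/\ X x, Y x & a x], [/\ X x, ~ Y x & b' x], [/\ ~ X x, Y x & c x] |
      [/\ ~ X x, ~ Y x & d' x]]] = [set x |
   [set x |
  [\/ [/\ X x, Y x & a x], [/\ X x, ~ Y x & b x], [/\ ~ X x, Y x & c x] |
      [/\ ~ X x, ~ Y x & d x]]] x /\ Y x \/ [set x |
  [\/ [/\ X x, Y x & a' x], [/\ X x, ~ Y x & b' x], [/\ ~ X x, Y x & c' x] |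
      [/\ ~ X x, ~ Y x & d' x]]] x /\ ~ Y x].
  apply: (swap Mm tY r r'); split.
  - by case: h1 => -[x [? ? ?]]; exists x => //; [exact: Or41 | exact: Or43].
  - by case: h2 => -[x [? ? ?]]; exists x => //; [exact: Or42 | exact: Or44].
  - by case: h3 => -[x [? ? ?]]; exists x => //; [exact: Or41 | exact: Or43].
  - by case: h4 => -[x [? ? ?]]; exists x => //; [exact: Or42 | exact: Or44].
apply/seteqP; split=> x /=.
- case=> -[? ? ?]; [left|right|left|right]; split=> //;
    by [exact: Or41|exact: Or42|exact: Or43|exact: Or44].
- by case=> -[[] [? ? ?] ?] //; [exact: Or41|exact: Or43|exact: Or42|exact: Or44].
Qed.

(** Two swaps leave only the first corner to [C]; their order depends on where else [C] goes.
    Meeting opposite corners, [G] crosses both [X] and [Y]. *)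
Lemma traced_corner1 C G : Ci C -> Ci G -> n1 C -> n2 C \/ n3 C \/ n4 C ->
  n1 G -> n4 G -> R C G G G.
Proof.
move=> /traced_id rC /traced_id rG C1 C234 G1 G4.
have [C34|nC34] := EM (n3 C \/ n4 C).
  have r : R C C G G by apply: (traced_swapX rC rG); auto.
  by apply: (traced_swapY r rG); auto.
have C2 : n2 C by case: C234 => // ?; case: nC34.
have r : R C G C G by apply: (traced_swapY rC rG); auto.
by apply: (traced_swapX r rG); auto.
Qed.

Lemma traced_corner2 C D G : Ci C -> Ci D -> Ci G -> n1 C -> n2 C \/ n3 C \/ n4 C ->
  n1 D -> n3 D -> n1 G -> n4 G -> R C D D D.
Proof.
move=> cC cD cG C1 C234 D1 D3 G1 G4.
have [D4|nD4] := EM (n4 D); first by apply: traced_corner1.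
have [rC rD rG] := And3 (traced_id cC) (traced_id cD) (traced_id cG).
have rCG : R C G G G by apply: traced_corner1.
have rCGDD : R C G D D by apply: (traced_swapX rCG rD); auto.
have rDDGG : R D D G G by apply: (traced_swapX rD rG); auto.
have [G2|nG2] := EM (n2 G).
  have [D2|nD2] := EM (n2 D); first by apply: (traced_swapY rCGDD rD); auto.
  have r : R C D D G by apply: (traced_swapY rCGDD rDDGG); auto.
  by apply: (traced_swapX r rD); auto.
have [D2|nD2] := EM (n2 D); last first.
  move: rCGDD; rewrite /traced; congr (Ci _); apply/seteqP.
  by split=> x [|||] [? ? ?]; [exact: Or41|case: nG2; exists x|exact: Or43|exact: Or44
    |exact: Or41|case: nD2; exists x|exact: Or43|exact: Or44].
have [G3|nG3] := EM (n3 G).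
  have r : R C D G D by apply: (traced_swapY rCG rD); auto.
  by apply: (traced_swapX r rD); auto.
(* [G] misses the second corner, so this circuit lies inside [traced X Y D D G G] and equals it; but
   [D] meets that corner. *)
have rDG : R D G G G by apply: traced_corner1; auto.
have sub := circ_eq Mm rDG rDDGG.
case: D2 => x [Xx Yx Dx]; exfalso; apply: (nG2); exists x; split=> //.
have : traced X Y D D G G x by exact: Or42.
rewrite -sub; first by case=> -[].
move=> z [|||] [? ? ?]; [exact: Or41|by case: nG2; exists z|exact: Or43|exact: Or44].
Qed.

End Corner.

(** By [swap_tsep] it is enough to graft the trace of [C] in [X ∩ Y] onto [D]. A circuit [G] through
    two opposite corners makes the necessary swaps possible. *)
Lemma corner X Y : tsep X -> tsep Y -> (exists x, [/\ E x, X x & Y x]) ->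
  (exists x, [/\ E x, ~ X x & ~ Y x]) -> tsep (X `&` Y).
Proof.
move=> tX tY [x [Ex Xx Yx]] [y [Ey Xy Yy]].
have [G [cG Gx Gy]] := join Ex Ey Xx Xy.
apply: swap_tsep.
  by exists G => //; split; [exists x | exists y => // -[]].
move=> C D cC cD [[c Cc [Xc Yc]] [c' Cc' c'XY]] [[d Dd [Xd Yd]] [d' Dd' d'XY]].
have C1 : exists x, [/\ X x, Y x & C x] by exists c.
have D1 : exists x, [/\ X x, Y x & D x] by exists d.
have G1 : exists x, [/\ X x, Y x & G x] by exists x.
have G4 : exists x, [/\ ~ X x, ~ Y x & G x] by exists y.
have case3 (F : set T) z : F z -> ~ (X `&` Y) z ->
    (exists x, [/\ X x, ~ Y x & F x]) \/ (exists x, [/\ ~ X x, Y x & F x]) \/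
    (exists x, [/\ ~ X x, ~ Y x & F x]).
  move=> Fz XYz; have [Xz|Xz] := EM (X z).
    by left; exists z; split=> // Yz; apply: XYz.
  by right; have [Yz|Yz] := EM (Y z); [left|right]; exists z.
have Cn := case3 _ _ Cc' c'XY.
suff : Ci (traced X Y C D D D).
  congr (Ci _); apply/seteqP; split=> z /=.
    by case=> -[? ? ?]; [left|right|right|right]; split=> // -[].
  case=> [[? []] ? ?|[Dz nz]]; first exact: Or41.
  have [Xz|Xz] := EM (X z); have [Yz|Yz] := EM (Y z).
  - by case: nz.
  - exact: Or42.
  - exact: Or43.
  - exact: Or44.
have [D4|nD4] := EM (exists x, [/\ ~ X x, ~ Y x & D x]).
  exact: traced_corner1.
have [D3|nD3] := EM (exists x, [/\ ~ X x, Y x & D x]).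
  exact: (traced_corner2 tX tY cC cD cG).
have D2 : exists x, [/\ X x, ~ Y x & D x].
  by case: (case3 _ _ Dd' d'XY) => [//|[//|//]].
suff : Ci (traced Y X C D D D).
  by congr (Ci _); apply/seteqP; split=> z [|||] [? ? ?];
    by [exact: Or41|exact: Or42|exact: Or43|exact: Or44].
apply: (traced_corner2 tY tX cC cD cG).
- by case: C1 => z []; exists z.
- by case: Cn => [|[]] [z []]; [right; left|left|right; right]; exists z.
- by case: D1 => z []; exists z.
- by case: D2 => z []; exists z.
- by case: G1 => z []; exists z.
- by case: G4 => z []; exists z.
Qed.

Lemma tsep_ext X : tsep X -> forall Y, (forall x, E x -> X x <-> Y x) -> tsep Y.
Proof.
move=> [[C cC CX] tX] Y XY.
have XYc D x : Ci D -> D x -> X x <-> Y x by move=> cD Dx; apply/XY/(circ_sub Mm cD).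
have cr D : Ci D -> crosses D X <-> crosses D Y.
  move=> cD; split=> -[[x Dx Xx] [y Dy Xy]]; split; [exists x|exists y|exists x|exists y] => //;
  by [apply/(XYc D) | move/(XYc D)].
split; first by exists C => //; apply/cr.
move=> D H q cD cH; rewrite -!cr // => DX HX Yq Hq nDq.
have [|K [cK Kq KDH]] := tX _ _ _ cD cH DX HX _ Hq nDq; first by apply/(XYc H).
exists K; split=> // x Kx; have [? ?] := KDH _ Kx.
by split=> //; apply/(XYc K).
Qed.

(** * The four corners as a quotient *)

Section Quadrants.
Variables X Y : set T.
Hypotheses (tX : tsep X) (tY : tsep Y) (XY : crossing X Y).

Definition quad x : Prop * Prop := (X x, Y x).

Lemma quadE x y : quad x = quad y <-> (X x <-> X y) /\ (Y x <-> Y y).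
Proof.
split; first by case=> -> ->.
by move=> [/propext Xxy /propext Yxy]; rewrite /quad Xxy Yxy.
Qed.

Lemma tsep_quad x : E x -> tsep (fib quad (quad x)).
Proof.
have [X1 X2 X3 X4] := XY; have [tX' tY'] := (tsepC Mm tX, tsepC Mm tY).
have [Xx|Xx] := EM (X x); have [Yx|Yx] := EM (Y x) => Ex.
- suff -> : fib quad (quad x) = X `&` Y by exact: corner.
  by apply/seteqP; split=> y; rewrite /fib /= quadE; tauto.
- suff -> : fib quad (quad x) = X `&` ~` Y.
    apply: corner => //; case: X3 => y [? ? ?]; exists y; split=> //; exact.
  by apply/seteqP; split=> y; rewrite /fib /setC /= quadE; tauto.
- suff -> : fib quad (quad x) = ~` X `&` Y.
    apply: corner => //; case: X2 => y [? ? ?]; exists y; split=> //; exact.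
  by apply/seteqP; split=> y; rewrite /fib /setC /= quadE; tauto.
- suff -> : fib quad (quad x) = ~` X `&` ~` Y.
    by apply: corner => //; case: X1 => y [? ? ?]; exists y; split=> //; apply.
  by apply/seteqP; split=> y; rewrite /fib /setC /= quadE; tauto.
Qed.

End Quadrants.

Definition full4 X Y C :=
  [/\ exists x, [/\ C x, X x & Y x], exists x, [/\ C x, X x & ~ Y x],
      exists x, [/\ C x, ~ X x & Y x] & exists x, [/\ C x, ~ X x & ~ Y x]].

(* The quotient on the four corners of X and Y is U_{3,4} in case ser4 and U_{1,4}
   in case par4; par3 speaks of the three corners meeting X `&` Y or adjacent to it. *)
Definition ser4 X Y := forall C, Ci C -> crosses C X \/ crosses C Y -> full4 X Y C.

Definition par3 X Y := forall C, Ci C ->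
  ~ [/\ exists x, [/\ C x, X x & Y x], exists x, [/\ C x, X x & ~ Y x]
      & exists x, [/\ C x, ~ X x & Y x]].

Definition par4 X Y :=
  [/\ par3 X Y, par3 X (~` Y), par3 (~` X) Y & par3 (~` X) (~` Y)].

Lemma quad_nonfiber X Y C : crosses C X \/ crosses C Y -> nonfiber (quad X Y) C.
Proof.
by case=> -[[x Cx ?] [y Cy ?]]; exists x, y; split=> //; move/quadE; tauto.
Qed.

(** Suppose [C] misses the fourth corner and let [G] join it to the first. Replacing a half of [G]
    by [C] gives circuits that miss it too and so have the shape of [C]. Hence [G] meets the second
    and third corner as well and properly exceeds [C] in the quotient. *)
Lemma ser_of_three X Y C : tsep X -> tsep Y -> crossing X Y -> Ci C ->
  (exists x, [/\ C x, X x & Y x]) -> (exists x, [/\ C x, X x & ~ Y x]) ->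
  (exists x, [/\ C x, ~ X x & Y x]) -> ser4 X Y.
Proof.
move=> tX tY XY cC [a [Ca Xa Ya]] [b [Cb Xb Yb]] [c [Cc Xc Yc]].
have CX : crosses C X by split; [exists a|exists c].
have CY : crosses C Y by split; [exists a|exists b].
have nC : nonfiber (quad X Y) C by apply: quad_nonfiber; left.
have tq x := @tsep_quad X Y tX tY XY x.
suff fC : full4 X Y C.
  move=> H cH HXY.
  have CH : forall y, C y -> exists2 x, H x & quad X Y x = quad X Y y.
    apply: (shape_sub Mm tq cH cC) => //; first exact: quad_nonfiber.
    have [[c1 [? ? ?]] [c2 [? ? ?]] [c3 [? ? ?]] [c4 [? ? ?]]] := fC.
    move=> x Hx; have [Xx|Xx] := EM (X x); have [Yx|Yx] := EM (Y x);
      [exists c1|exists c2|exists c3|exists c4] => //; apply/quadE; tauto.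
  have [[c1 [/CH [x1 H1 /quadE q1] ? ?]] [c2 [/CH [x2 H2 /quadE q2] ? ?]]
    [c3 [/CH [x3 H3 /quadE q3] ? ?]] [c4 [/CH [x4 H4 /quadE q4] ? ?]]] := fC.
  by split; [exists x1|exists x2|exists x3|exists x4]; split=> //; tauto.
split; [by exists a|by exists b|by exists c|].
apply: contrapT => C4.
have [_ _ _ [o [Eo Xo Yo]]] := XY.
have [G [cG Ga Go]] := join (circ_sub Mm cC Ca) Eo Xa Xo.
have GX : crosses G X by split; [exists a|exists o].
have GY : crosses G Y by split; [exists a|exists o].
have strict H : Ci H -> crosses H X \/ crosses H Y ->
    (forall x, H x -> ~ X x -> ~ Y x -> False) ->
    (exists x, [/\ H x, X x & ~ Y x]) /\ (exists x, [/\ H x, ~ X x & Y x]).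
  move=> cH HXY H4.
  have CH : forall y, C y -> exists2 x, H x & quad X Y x = quad X Y y.
    apply: (shape_sub Mm tq cH cC) => //; first exact: quad_nonfiber.
    move=> x Hx; have [Xx|Xx] := EM (X x); have [Yx|Yx] := EM (Y x);
      [exists a|exists b|exists c|case: (H4 x)] => //; apply/quadE; tauto.
  have [x2 H2 /quadE q2] := CH _ Cb; have [x3 H3 /quadE q3] := CH _ Cc.
  by split; [exists x2|exists x3]; split=> //; tauto.
have cH1 := swap Mm tX cG cC GX CX.
have [||[g2 [[[G2 _]|[_ nX]] X2 Y2]] _] := strict _ cH1.
- by left; split; [exists a; [left|]|exists c; [right|]].
- move=> x [[_ Xx] Xx'|[Cx _] Xx Yx]; first by case: Xx'.
  by apply: C4; exists x.
- 2: by case: nX.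
have cH2 := swap Mm tY cG cC GY CY.
have [||_ [g3 [[[G3 _]|[_ nY]] X3 Y3]]] := strict _ cH2.
- by right; split; [exists a; [left|]|exists b; [right|]].
- move=> x [[_ Yx] _ Yx'|[Cx _] Xx Yx]; first by case: Yx'.
  by apply: C4; exists x.
- 2: by case: nY.
have [||x Cx /quadE q] := shape_sub Mm tq cC cG nC _ _ Go.
- by apply: quad_nonfiber; left.
- move=> x Cx; have [Xx|Xx] := EM (X x); have [Yx|Yx] := EM (Y x);
    [exists a|exists g2|exists g3|case: C4; exists x] => //; apply/quadE; tauto.
by apply: C4; exists x; split=> //; tauto.
Qed.

Lemma full4Cl X Y C : full4 (~` X) Y C -> full4 X Y C.
Proof. by move=> [? ? [a [? /contrapT ? ?]] [b [? /contrapT ? ?]]]; split=> //; [exists a|exists b]. Qed.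

Lemma full4Cr X Y C : full4 X (~` Y) C -> full4 X Y C.
Proof. by move=> [? [a [? ? /contrapT ?]] ? [b [? ? /contrapT ?]]]; split=> //; [exists a|exists b]. Qed.

Lemma ser4Cl X Y : ser4 (~` X) Y -> ser4 X Y.
Proof.
move=> s C cC CXY; apply: full4Cl; apply: s => //.
by case: CXY => ?; [left; apply: crossesC|right].
Qed.

Lemma ser4Cr X Y : ser4 X (~` Y) -> ser4 X Y.
Proof.
move=> s C cC CXY; apply: full4Cr; apply: s => //.
by case: CXY => ?; [left|right; apply: crossesC].
Qed.

Lemma ser_or_par X Y : tsep X -> tsep Y -> crossing X Y -> ser4 X Y \/ par4 X Y.
Proof.
move=> tX tY XY; have [|nser] := EM (ser4 X Y); [by left|right].
have cl := @crossingC; have cr Z W : crossing Z W -> crossing Z (~` W).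
  by move=> /crossing_sym /cl /crossing_sym.
have [tX' tY'] := (tsepC Mm tX, tsepC Mm tY).
have XY' := cr _ _ XY; have X'Y := cl _ _ XY; have X'Y' := cr _ _ X'Y.
split=> C cC [C1 C2 C3]; apply: nser.
- exact: ser_of_three cC C1 C2 C3.
- by apply: ser4Cr; apply: (ser_of_three _ _ _ cC).
- by apply: ser4Cl; apply: (ser_of_three _ _ _ cC).
- by apply/ser4Cl/ser4Cr; apply: (ser_of_three _ _ _ cC).
Qed.

End Corners.

(** * Good separations *)

Lemma proper_ex T (X Y : set T) : X `<` Y -> X `<=` Y /\ exists2 x, Y x & ~ X x.
Proof.
move=> [XY nYX]; split=> //; apply: contrapT => n; apply: nYX => x Yx.
by apply: contrapT => nXx; apply: n; exists x.
Qed.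

Section Good.
Variables (T : Type) (M : circuit_system T).
Local Notation Ci := (circuits M).
Local Notation E := (ground M).
Local Notation tsep := (tsep M).
Local Notation crossing := (crossing M).
Local Notation ser4 := (ser4 M).
Local Notation par4 := (par4 M).
Implicit Types (A B C D G H I K O P Q S U V W X Y Z : set T) (x y z p q : T).

Hypothesis Mm : is_matroid M.
Hypothesis Mc : connected_matroid M.

Let join := join Mc.

(** [K] makes [A] and [B] parallel. Let [q] be in [A]. If [C] meets [A], the exchange takes place
    inside [A]; otherwise [K] helps to link the trace of [H] on [A] with that of [C] on [B]. *)
Lemma parU A B K : tsep A -> tsep B -> (forall x, A x -> ~ B x) ->
  Ci K -> (forall x, K x -> A x \/ B x) -> (exists2 x, K x & A x) ->
  (exists2 x, K x & B x) -> (exists2 x, E x & ~ A x /\ ~ B x) -> tsep (A `|` B).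
Proof.
move=> tA tB AB cK KAB KA KB [o Eo [nAo nBo]].
have half A' B' C H q : tsep A' -> tsep B' -> (forall x, A' x -> ~ B' x) ->
    (forall x, K x -> A' x \/ B' x) -> (exists2 x, K x & A' x) ->
    (exists2 x, K x & B' x) -> Ci C -> Ci H -> crosses C (A' `|` B') ->
    crosses H (A' `|` B') -> A' q -> H q -> ~ C q ->
    exists K', [/\ Ci K', K' q & forall x, K' x -> (C x \/ H x) /\ (A' `|` B') x].
  move=> tA' tB' AB' KAB' [a Ka Aa] [b Kb Bb] cC cH [C1 [c Cc nABc]] [_ [h Hh nABh]] Aq Hq nCq.
  have nAc : ~ A' c by move=> ?; apply: nABc; left.
  have nBc : ~ B' c by move=> ?; apply: nABc; right.
  have nAh : ~ A' h by move=> ?; apply: nABh; left.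
  have HA : crosses H A' by split; [exists q|exists h].
  have [[c1 Cc1 Ac1]|nCA] := EM (exists2 x, C x & A' x).
    have CA : crosses C A' by split; [exists c1|exists c].
    have [K' [cK' K'q K'CH]] := tA'.2 _ _ _ cC cH CA HA Aq Hq nCq.
    by exists K'; split=> // x /K'CH[? ?]; split=> //; left.
  have [c2 Cc2 Bc2] : exists2 x, C x & B' x.
    by case: C1 => x Cx [Ax|]; [case: nCA; exists x|exists x].
  have CB : crosses C B' by split; [exists c2|exists c].
  have nAb : ~ A' b by move/AB'.
  have cK1 : Ci [set x | H x /\ A' x \/ K x /\ ~ A' x].
    by apply: swap => //; split; [exists a|exists b].
  set K1 := [set x | _] in cK1.
  have K1B : crosses K1 B'.
    by split; [exists b => //; right|exists q; [left|exact: AB']].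
  exists [set x | C x /\ B' x \/ K1 x /\ ~ B' x]; split.
  - exact: swap.
  - by right; split; [left|exact: AB'].
  - move=> x [[Cx Bx]|[[[Hx Ax]|[Kx nAx]] nBx]].
    + by split; [left|right].
    + by split; [right|left].
    + by case: (KAB' _ Kx).
split.
  have [a Ka Aa] := KA; have [C [cC Ca Co]] := join (circ_sub Mm cK Ka) Eo Aa nAo.
  by exists C => //; split; [exists a; [|left]|exists o => // -[]].
move=> C H q cC cH CX HX [Aq|Bq] Hq nCq; first exact: half.
by rewrite setUC; apply: half; rewrite ?[B `|` A]setUC //;
  [move=> x Bx /AB|move=> x /KAB[]; [right|left]].
Qed.

(** In series: circuits crossing the union cross both sets, so the exchange takes place inside the
    one that contains [q]. *)
Lemma serU A B : tsep A -> tsep B ->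
  (forall C, Ci C -> crosses C A <-> crosses C B) ->
  (exists2 x, E x & ~ A x /\ ~ B x) -> tsep (A `|` B).
Proof.
move=> tA tB AB [o Eo [nAo nBo]]; split.
  have [[a Ea Aa] _] := tsep_meets Mm tA.
  have [C [cC Ca Co]] := join Ea Eo Aa nAo.
  by exists C => //; split; [exists a; [|left]|exists o => // -[]].
have cr C : Ci C -> crosses C (A `|` B) -> crosses C A /\ crosses C B.
  move=> cC [[x Cx ABx] [y Cy nABy]].
  have [nAy nBy] : ~ A y /\ ~ B y by split=> ?; apply: nABy; [left|right].
  have [CA|CB] : crosses C A \/ crosses C B.
    by case: ABx => ?; [left|right]; split; [exists x|exists y|exists x|exists y].
  - by split=> //; apply/AB.
  - by split=> //; apply/AB.
move=> C H q cC cH /(cr _ cC)[CA CB] /(cr _ cH)[HA HB] [Aq|Bq] Hq nCq.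
- have [K [cK Kq KCH]] := tA.2 _ _ _ cC cH CA HA Aq Hq nCq.
  by exists K; split=> // x /KCH[? ?]; split=> //; left.
- have [K [cK Kq KCH]] := tB.2 _ _ _ cC cH CB HB Bq Hq nCq.
  by exists K; split=> // x /KCH[? ?]; split=> //; right.
Qed.

(** Through [K] the traces of [H] on [A] and [B] combine to a circuit, which lies inside [H] and so
    is all of [H]. *)
Lemma par_no_three A B K H : tsep A -> tsep B -> (forall x, A x -> ~ B x) ->
  Ci K -> (forall x, K x -> A x \/ B x) -> (exists2 x, K x & A x) ->
  (exists2 x, K x & B x) -> Ci H -> (exists2 x, H x & A x) ->
  (exists2 x, H x & B x) -> forall x, H x -> A x \/ B x.
Proof.
move=> tA tB AB cK KAB [a Ka Aa] [b Kb Bb] cH [a' Ha Aa'] [b' Hb Bb'] o Ho.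
apply: contrapT => nABo.
have [nAo nBo] : ~ A o /\ ~ B o by split=> ?; apply: nABo; [left|right].
have BA x : B x -> ~ A x by move=> Bx /AB.
have cD : Ci [set x | H x /\ A x \/ K x /\ ~ A x].
  by apply: swap => //; split; [exists a'|exists o|exists a|exists b => //; exact: BA].
set D := [set x | _] in cD.
have cL : Ci [set x | H x /\ B x \/ D x /\ ~ B x].
  apply: swap => //; split; [by exists b'|by exists o| |].
    by exists b => //; right; split=> //; exact: BA.
  by exists a' => //; [left|exact: AB].
set L := [set x | _] in cL.
have LH : L = H.
  apply: (circ_eq Mm) => // x [[]//|[[[]//|[Kx nAx]] nBx]].
  by case: (KAB _ Kx).
have : L o by rewrite LH.
by case=> [[]//|[[[]//|[Ko nAo']] _]]; case: (KAB _ Ko).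
Qed.

(* The trivial separations, with a singleton on one side, are included: as parts of
   a node v they stand for the elements of R v. *)
Definition good X :=
  [/\ tsep X, X `<=` E & forall Y, tsep Y -> ~ crossing X Y].

Lemma good_nested X Y : good X -> tsep Y ->
  [\/ forall x, E x -> X x -> Y x, forall x, E x -> X x -> ~ Y x,
      forall x, E x -> Y x -> X x | forall x, E x -> X x \/ Y x].
Proof.
move=> [tX _ nX] tY; apply: contrapT => nn; apply: (nX _ tY).
split; apply: contrapT => n; apply: nn.
- by apply: Or42 => x Ex Xx Yx; apply: n; exists x.
- by apply: Or41 => x Ex Xx; apply: contrapT => Yx; apply: n; exists x.
- by apply: Or43 => x Ex Yx; apply: contrapT => Xx; apply: n; exists x.
- apply: Or44 => x Ex; have [|Xx] := EM (X x); first by left.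
  by right; apply: contrapT => Yx; apply: n; exists x.
Qed.

Lemma goodD X : good X -> good (E `\` X).
Proof.
move=> [tX XE nX]; split.
- apply: (tsep_ext Mm (tsepC Mm tX)) => x Ex; split=> [nXx|[]//].
  by split.
- by move=> x [].
- move=> Y tY [[a [Ea [_ ?] ?]] [b [Eb [_ ?] ?]] [c [Ec Xc ?]] [d [Ed Xd ?]]].
  apply: (nX _ tY); split; [exists c|exists d|exists a|exists b]; split=> //.
  + by apply: contrapT => ?; apply: Xc.
  + by apply: contrapT => ?; apply: Xd.
Qed.

Lemma setDKE X : X `<=` E -> E `\` (E `\` X) = X.
Proof.
move=> XE; apply/seteqP; split=> x.
  by move=> [Ex nX]; apply: contrapT => Xx; apply: nX.
by move=> Xx; split; [exact: XE|case].
Qed.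

(** * Increasing sequences of good sets *)

Section Chains.

Variable y : T.
Hypothesis Ey : E y.

(** The union of [X0] and the complement of [X2] crosses the good set [X1], so it is not separated.
    By [parU] this gives the first clause and by [serU] one of the other two; each of these yields
    the other by exchange with a circuit from [X0] to [y]. *)
Lemma good_step X0 X1 X2 : good X0 -> good X1 -> good X2 ->
  X0 `<` X1 -> X1 `<` X2 -> ~ X2 y ->
  [/\ forall C, Ci C -> (exists2 x, C x & X0 x) -> (exists2 x, C x & ~ X2 x) ->
        exists x, [/\ C x, X2 x & ~ X0 x],
      exists C, [/\ Ci C, forall x, C x -> ~ X0 x & crosses C X2] &
      exists C, [/\ Ci C, forall x, C x -> X2 x & crosses C X0]].
Proof.
move=> g0 g1 g2 /proper_ex[X01 [u1 Xu1 nXu1]] /proper_ex[X12 [u2 Xu2 nXu2]] nXy.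
have [[t0 E0 n0] [t1 E1 n1] [t2 E2 n2]] := And3 g0 g1 g2.
have [Eu1 Eu2] : E u1 /\ E u2 by split; [exact: E1|exact: E2].
have [[u0 Eu0 Xu0] _] := tsep_meets Mm t0.
have X02 x : X0 x -> X2 x by move=> /X01 /X12.
have noZ : ~ tsep (X0 `|` ~` X2).
  move=> /(tsepC Mm) tZ; apply: (n1 _ tZ); split.
  - by exists u1; split=> // -[//|]; apply; exact: X12.
  - by exists u0; split=> //; [exact: X01|apply; left].
  - by exists u2; split=> // -[/X01|].
  - by exists y; split=> //; [move=> /X12|apply; right].
have [o [Eo X0o X2o]] : exists o, [/\ E o, ~ X0 o & ~ (~` X2) o].
  by exists u1; split=> // /(_ (X12 _ Xu1)).
have notP : forall C, Ci C -> (exists2 x, C x & X0 x) -> (exists2 x, C x & ~ X2 x) ->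
    exists x, [/\ C x, X2 x & ~ X0 x].
  move=> C cC C0 C2; apply: contrapT => nC; apply: noZ.
  apply: (parU t0 (tsepC Mm t2) _ cC) => //.
  - by move=> x /X02 ?; apply.
  - move=> x Cx; have [|X0x] := EM (X0 x); [by left|right=> X2x].
    by apply: nC; exists x.
  - by exists o.
have [[a Ea X0a] _] := tsep_meets Mm t0.
have [O [cO Oa Oy]] : exists C, [/\ Ci C, C a & C y].
  by apply: (join Ea Ey (X02 _ X0a)).
have O0 : crosses O X0 by split; [exists a|exists y => // /X02].
have O2 : crosses O X2 by split; [exists a => //; exact: X02|exists y].
suff [[C [cC C0 C2]]|[C [cC C2 C0]]] :
    (exists C, [/\ Ci C, forall x, C x -> ~ X0 x & crosses C X2]) \/
    (exists C, [/\ Ci C, forall x, C x -> X2 x & crosses C X0]).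
- split=> //; first by exists C.
  have nCa : ~ C a by move=> /C0.
  have [K [cK Ka KCO]] := t2.2 _ _ _ cC cO C2 O2 (X02 _ X0a) Oa nCa.
  exists K; split=> //; first by move=> x /KCO[].
  split; first by exists a.
  apply: contrapT => nK; have KO : K `<=` O.
    move=> x Kx; have [[Cx|//] _] := KCO _ Kx; case: nK; exists x => //.
    exact: C0.
  have : K y by rewrite (circ_eq Mm cK cO KO).
  by move=> /KCO[].
- split=> //; last by exists C.
  have nCy : ~ C y by move=> /C2.
  have nX0y : ~ X0 y by move=> /X02.
  have [K [cK Ky KCO]] := (tsepC Mm t0).2 _ _ _ cC cO (crossesC C0) (crossesC O0) nX0y Oy nCy.
  exists K; split=> //; first by move=> x /KCO[].
  split; last by exists y.
  apply: contrapT => nK; have KO : K `<=` O.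
    move=> x Kx; have [[Cx|//] _] := KCO _ Kx; case: nK; exists x => //.
    exact: C2.
  have : K a by rewrite (circ_eq Mm cK cO KO).
  by move=> /KCO[].
apply: contrapT => nn; apply: noZ; apply: serU => //; first exact: tsepC.
  move=> C cC; split=> [C0|/crossesC]; last rewrite setCK => C2.
    apply: crossesC; split; first by case: C0 => -[x Cx /X02]; exists x.
    apply: contrapT => nC2; apply: nn; right; exists C; split=> // x Cx.
    by apply: contrapT => X2x; apply: nC2; exists x.
  split; last by case: C2 => _ [x Cx nX2]; exists x => // /X02.
  apply: contrapT => nC0; apply: nn; left; exists C; split=> // x Cx X0x.
  by apply: nC0; exists x.
by exists o.
Qed.

Section Sequence.
Variable X : nat -> set T.
Hypotheses (gX : forall n, good (X n)) (ltX : forall n, X n `<` X n.+1)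
  (nXy : forall n, ~ X n y).

Let leX m n : (m <= n)%N -> X m `<=` X n.
Proof.
move=> mn; rewrite -(subnKC mn); elim: (n - m)%N => [|k IH]; first by rewrite addn0.
by rewrite addnS => x /IH /(properW (ltX _)).
Qed.

(** Three double steps make a block: [K] consists of [Cu] up to [X k.+2], of [O] up to [X k.+4],
    where [a] is taken, and of [Cl] from there on. So it stays between [X k] and [X k.+4.+2] and
    agrees with [O] in the middle. *)
Let block k O : Ci O -> (exists2 x, O x & X k x) -> O y ->
  exists aK : T * set T, let: (a, K) := aK in
    [/\ O a, X k.+4 a, ~ X k.+2 a & [/\ Ci K, K a,
     forall x, K x -> X k.+4.+2 x /\ ~ X k x &
     forall x, K x -> X k.+4 x -> ~ X k.+2 x -> O x]].
Proof.
move=> cO [o Oo Xo] Oy.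
have [_ [Cu [cU U0 U2]] _] :=
  good_step (gX k) (gX k.+1) (gX k.+2) (ltX _) (ltX _) (@nXy _).
have [m _ _] :=
  good_step (gX k.+2) (gX k.+3) (gX k.+4) (ltX _) (ltX _) (@nXy _).
have [_ _ [Cl [cL L6 L4]]] :=
  good_step (gX k.+4) (gX k.+4.+1) (gX k.+4.+2) (ltX _) (ltX _) (@nXy _).
have o2 : X k.+2 o by apply: (leX (m := k)) => //; rewrite (leqW (leqnSn k)).
have [||a [Oa X4a nX2a]] := m O cO; [by exists o|by exists y; last exact: nXy|].
have le24 : X k.+2 `<=` X k.+4 by apply: leX; rewrite (leqW (leqnSn _)).
have le46 : X k.+4 `<=` X k.+4.+2 by apply: leX; rewrite (leqW (leqnSn _)).
have le02 : X k `<=` X k.+2 by apply: leX; rewrite (leqW (leqnSn _)).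
have cK1 : Ci [set x | Cu x /\ X k.+2 x \/ O x /\ ~ X k.+2 x].
  by apply: swap => //; [case: (gX k.+2)|split; [exists o|exists y]].
set K1 := [set x | _] in cK1.
have cK : Ci [set x | K1 x /\ X k.+4 x \/ Cl x /\ ~ X k.+4 x].
  apply: swap => //; first by case: (gX k.+4).
  split; last by exists y => //; right.
  by have [[u Uu X2u] _] := U2; exists u; [left|exact: le24].
exists (a, [set x | K1 x /\ X k.+4 x \/ Cl x /\ ~ X k.+4 x]).
split=> //; split=> //.
- by left; split=> //; right.
- move=> x [[[[Ux X2x]|[Ox nX2x]] X4x]|[Lx nX4x]].
  + by split; [exact: le46|exact: U0].
  + by split; [exact: le46|move=> /le02].
  + by split; [exact: L6|move=> /le02 /le24].
- by move=> x [[[[Ux X2x]|[Ox nX2x]] X4x]|[Lx nX4x]].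
Qed.

(* Otherwise the sequence contains infinitely many disjoint blocks, each with a
   circuit of its own through an element a of O; eliminating all the a from O at
   once leaves a circuit through y that can neither cross the blocks nor avoid
   them. *)
Lemma no_good_sequence : False.
Proof.
have [[t0 _ _] _] := (gX 0, gX 0).
have [[o Eo Xo] _] := tsep_meets Mm t0.
have [O [cO Oo Oy]] := join Eo Ey Xo (@nXy 0).
have Ox n : exists2 x, O x & X n x by exists o => //; apply: (leX (leq0n n)).
(* Blocks have length 6, so those starting at multiples of 6 are disjoint. *)
have /choice[aK aKp] := fun i => block (k := 6 * i) cO (Ox _) Oy.
pose a i := (aK i).1; pose K i := (aK i).2.
have {}aKp i : [/\ O (a i), X (6 * i).+4 (a i), ~ X (6 * i).+2 (a i) &
   [/\ Ci (K i), K i (a i),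
     forall x, K i x -> X (6 * i).+4.+2 x /\ ~ X (6 * i) x &
     forall x, K i x -> X (6 * i).+4 x -> ~ X (6 * i).+2 x -> O x]].
  by move: (aKp i); rewrite /a /K; case: (aK i).
have le6 i j : (i < j)%N -> ((6 * i).+4.+2 <= 6 * j)%N.
  by move=> ij; rewrite -[(6 * i).+4.+2]/(6 + 6 * i)%N -mulnS leq_mul2l.
have Kdisj i j x : K i x -> X (6 * j).+4.+2 x -> ~ X (6 * j) x -> i = j.
  move=> Kx Xjx nXjx; have [_ _ _ [_ _ /(_ _ Kx)[Xix nXix] _]] := aKp i.
  apply/eqP; case: ltngtP => // ij.
    by case: nXjx; apply: leX Xix; exact: le6.
  by case: nXix; apply: leX Xjx; exact: le6.
have Kx6 i x : K i x -> X (6 * i).+4.+2 x /\ ~ X (6 * i) x.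
  by move=> Kx; have [_ _ _ [_ _ /(_ _ Kx)]] := aKp i.
have Kinj i j : K i (a j) -> i = j.
  move=> Kij; have [_ _ _ [_ Kjj _ _]] := aKp j; have [? ?] := Kx6 _ _ Kjj.
  exact: Kdisj Kij _ _.
have ainj i j : a i = a j -> i = j.
  by move=> aij; apply: Kinj; rewrite -aij; have [_ _ _ []] := aKp i.
pose D x := [set u | exists2 i, x = a i & K i u].
have Da i : D (a i) = K i.
  by apply/seteqP; split=> u; [move=> [j /ainj ->]|exists i].
have [||||C' [cC' C'y C's]] := circuits_C3 Mm (X := range a) (C := O) (D := D)
  _ cO _ _ (z := y).
- by move=> _ [i _ <-]; have [] := aKp i.
- by move=> _ [i _ <-]; rewrite Da; have [_ _ _ []] := aKp i.
- move=> _ _ [i _ <-] [j _ <-]; rewrite Da; split=> [/Kinj ->//|->].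
  by have [_ _ _ []] := aKp j.
- by split=> // -[_ [i _ <-]]; rewrite Da => /Kx6[/nXy].
have {}C's x : C' x -> (O x \/ exists i, K i x) /\ forall i, x <> a i.
  move=> /C's [OK nx]; split; last by move=> i xa; apply: nx; exists i.
  by case: OK => [|[_ [i _ <-]]]; [left|rewrite Da; right; exists i].
(* If [C'] met no [X n], it would avoid all blocks and lie in [O]; it would then equal [O], which
   contains [o]. *)
have [[x0 [C'x0 [n Xx0]]]|nX] := EM (exists x, C' x /\ exists n, X n x); last first.
  have C'O : C' `<=` O.
    move=> x C'x; have [[//|[i /Kx6[Xx _]]] _] := C's _ C'x.
    by case: nX; exists x; split=> //; exists (6 * i).+4.+2.
  by apply: nX; exists o; rewrite (circ_eq Mm cC' cO C'O); split=> //; exists 0%N.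
have C'X m : (n <= m)%N -> crosses C' (X m).
  by move=> nm; split; [exists x0 => //; exact: leX Xx0|exists y].
have OX m : crosses O (X m) by split; [|exists y].
have n6 : (n <= 6 * n)%N by rewrite leq_pmull.
(* From [n] on, [C'] crosses every [X m], and block [n] does not start before [n]. Replacing [O] by
   [C'] in the middle of this block gives a circuit inside [O], hence [O]; but [C'] lacks [a n]. *)
have cD1 : Ci [set x | O x /\ X (6 * n).+2 x \/ C' x /\ ~ X (6 * n).+2 x].
  apply: swap => //; first by case: (gX (6 * n).+2).
  by apply: C'X; rewrite (leq_trans n6) // (leqW (leqnSn _)).
set D1 := [set x | _] in cD1.
have cD2 : Ci [set x | D1 x /\ X (6 * n).+4 x \/ O x /\ ~ X (6 * n).+4 x].
  apply: swap => //; first by case: (gX (6 * n).+4).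
  split; last by exists y => //; right.
  by exists o; [left; split=> //|]; apply: (leX (leq0n _)).
set D2 := [set x | _] in cD2.
have [Oan X4a nX2a [_ _ _ KO]] := aKp n.
have D2O : D2 = O.
  apply: (circ_eq Mm) => // x [[[[]//|[C'x X2x]] X4x]|[]//].
  have [[//|[i Kix]] _] := C's _ C'x.
  have i_n : i = n.
    apply: Kdisj Kix _ _.
      by apply: leX X4x; rewrite (leqW (leqnSn _)).
    by move=> X0x; apply: X2x; apply: leX X0x; rewrite (leqW (leqnSn _)).
  by apply: KO => //; rewrite -i_n.
have : D2 (a n) by rewrite D2O.
case=> [[[[]//|[/C's[_ na] _]] _]|[]//].
exact: na erefl.
Qed.

End Sequence.

(** A counterexample could be enlarged again and again, to a sequence that [no_good_sequence]
    excludes. *)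
Lemma good_ind (F : set T -> Prop) :
  (forall X, good X -> ~ X y ->
     (forall Z, good Z -> ~ Z y -> X `<` Z -> F Z) -> F X) ->
  forall X, good X -> ~ X y -> F X.
Proof.
move=> IH X gX nXy; apply: contrapT => nFX.
pose bad Z := [/\ good Z, ~ Z y & ~ F Z].
have /choice[f fp] : forall Z, exists Z', bad Z -> bad Z' /\ Z `<` Z'.
  move=> Z; have [[gZ nZy nFZ]|?] := EM (bad Z); last by exists Z.
  apply: contrapT => nZ'; apply: nFZ; apply: IH => // Z' gZ' nZ'y ZZ'.
  by apply: contrapT => nFZ'; apply: nZ'; exists Z'.
have bX n : bad (iter n f X) by elim: n => [//|n /fp[]].
apply: (@no_good_sequence (fun n => iter n f X)) => n.
- by case: (bX n).
- by have [] := fp _ (bX n).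
- by case: (bX n).
Qed.

Lemma good_max (F : set T -> Prop) X : good X -> ~ X y -> F X ->
  exists Z, [/\ good Z, ~ Z y, F Z &
    forall Z', good Z' -> ~ Z' y -> F Z' -> ~ Z `<` Z'].
Proof.
move=> gX nXy FX.
suff h Z : good Z -> ~ Z y -> F Z -> exists Z, [/\ good Z, ~ Z y, F Z &
    forall Z', good Z' -> ~ Z' y -> F Z' -> ~ Z `<` Z'] by exact: h FX.
move: Z; apply: good_ind => Z gZ nZy IH FZ.
apply: contrapT => n; apply: (n); exists Z; split=> // Z' gZ' nZ' FZ' ZZ'.
by apply: n; exact: IH FZ'.
Qed.

End Chains.
End Good.

(** * Types of partitions *)

(** [set0] is adjoined to [F] for the empty chain; because of [V0] it is maximal only if it belongs
    to [F]. *)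
Lemma Zorn_bigcup_ne T (F : set (set T)) (V0 : set T) : F V0 ->
  (forall G, G !=set0 -> G `<=` F -> total_on G subset -> F (\bigcup_(X in G) X)) ->
  exists A, F A /\ forall B, A `<` B -> ~ F B.
Proof.
move=> FV0 Fcup.
have [|A [PA Amax]] := @Zorn_bigcup T [set V | V = set0 \/ F V].
  move=> G GP Gtot; have [[X GX FX]|nX] := EM (exists2 X, G X & F X); last first.
    left; apply/seteqP; split=> // x [X GX Xx].
    by have [X0|FX] := GP _ GX; [rewrite X0 in Xx|case: nX; exists X].
  right; have -> : \bigcup_(X in G) X = \bigcup_(X in G `&` F) X.
    apply/seteqP; split=> x [Y]; last by move=> [GY _] Yx; exists Y.
    by move=> GY Yx; exists Y => //; split=> //; have [Y0|//] := GP _ GY; rewrite Y0 in Yx.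
  apply: Fcup; first by exists X.
    by move=> Y [].
  by move=> Y Z [GY _] [GZ _]; exact: Gtot.
exists A; split; last by move=> B /Amax nB FB; apply: nB; right.
have [A0|//] := PA; have [V00|nV0] := EM (V0 = set0); first by rewrite A0 -V00.
case: (Amax V0); last by right.
rewrite A0; split=> // V0s; apply: nV0; apply/seteqP; split=> //.
Qed.

Section Types.
Variables (T : Type) (M : circuit_system T).
Local Notation Ci := (circuits M).
Local Notation E := (ground M).
Local Notation tsep := (tsep M).
Local Notation crossing := (crossing M).
Local Notation ser4 := (ser4 M).
Local Notation par4 := (par4 M).
Local Notation good := (good M).
Implicit Types (A B C D G H I K O P Q S U V W X Y Z : set T) (x y z p q : T).
Implicit Types (s : set (set T)).

Hypothesis Mm : is_matroid M.
Hypothesis Mc : connected_matroid M.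

Let join := join Mc.

(** [q] and a point of [C] lie in a common member of the chain, and what is outside the union is
    outside this member; so its exchange serves for the union. *)
Lemma tsep_bigcup (F : set (set T)) : F !=set0 -> F `<=` tsep ->
  total_on F subset -> (exists2 x, E x & forall X, F X -> ~ X x) ->
  tsep (\bigcup_(X in F) X).
Proof.
move=> [X0 FX0] Ft Ftot [o Eo no]; split.
  have [[a Ea X0a] _] := tsep_meets Mm (Ft _ FX0).
  have [C [cC Ca Co]] := join Ea Eo X0a (no _ FX0).
  by exists C => //; split; [exists a => //; exists X0|exists o => // -[X /no]].
move=> C H q cC cH [[c Cc [X1 FX1 X1c]] [c' Cc' nc']] [_ [h Hh nh]] [X2 FX2 X2q] Hq nCq.
have [X [FX Xc Xq]] : exists X, [/\ F X, X c & X q].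
  by have [/(_ _ X1c)|/(_ _ X2q)] := Ftot _ _ FX1 FX2; [exists X2|exists X1].
have out x : ~ (\bigcup_(X in F) X) x -> ~ X x by move=> nx Xx; apply: nx; exists X.
have [||K [cK Kq KCH]] := (Ft _ FX).2 _ _ _ cC cH _ _ Xq Hq nCq.
- by split; [exists c|exists c' => //; exact: out].
- by split; [exists q|exists h => //; exact: out].
by exists K; split=> // x /KCH[? ?]; split=> //; exists X.
Qed.

(** Let [G1] be [G] on [U] and [G'] elsewhere. In series with [Z] it meets both sides of [Z] outside
    [W], where it is part of [G]. So [G] crosses [Z] and would have to meet [W]. *)
Lemma no_ser W U Z G G' : tsep W -> tsep Z -> tsep U ->
  (forall x, U x -> ~ W x) -> Ci G -> (forall x, G x -> ~ W x) -> crosses G U ->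
  Ci G' -> crosses G' W -> (forall x, G' x -> W x \/ U x) -> crossing W Z ->
  ~ ser4 W Z.
Proof.
move=> tW tZ tU UW cG GW GU cG' G'W G'WU WZ s.
have nGZ : ~ crosses G Z.
  by move=> GZ; have [|[a [Ga Wa _]]] := s _ cG; [right|case: (GW _ Ga)].
have [[w G'w Ww] [u G'u nWu]] := G'W.
have Uu : U u by case: (G'WU _ G'u).
have G'U : crosses G' U by split; [exists u|exists w => // /UW].
have cG1 := swap Mm tU cG cG' GU G'U.
set G1 := [set x | _] in cG1.
have [|_ _ [a [G1a nWa Za]] [b [G1b nWb nZb]]] := s _ cG1.
  left; split; first by exists w => //; right; split=> // /UW.
  by have [[v Gv Uv] _] := GU; exists v; [left|exact: GW].
have GG x : G1 x -> ~ W x -> G x by case=> [[]|[/G'WU[]]].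
by apply: nGZ; split; [exists a|exists b] => //; apply: GG.
Qed.

(** In the parallel case [H1] and [H2], which start in the same corner of [W], continue outside [W]
    in different single corners. Exchanging their traces on [U] gives a circuit in three corners. *)
Lemma no_par W U Z : tsep W -> tsep Z -> tsep U -> (forall x, U x -> ~ W x) ->
  (forall C, Ci C -> crosses C W ->
     (exists2 x, C x & U x) /\ (exists2 x, C x & ~ U x /\ ~ W x)) ->
  crossing W Z -> ~ par4 W Z.
Proof.
move=> tW tZ tU UW sU [[a [Ea Wa Za]] _ [b [Eb Wb Zb]] [c [Ec Wc Zc]]] [p1 p2 p3 p4].
have [H1 [cH1 H1a H1b]] := join Ea Eb Wa Wb.
have [H2 [cH2 H2a H2c]] := join Ea Ec Wa Wc.
have H1W : crosses H1 W by split; [exists a|exists b].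
have H2W : crosses H2 W by split; [exists a|exists c].
have H1Z x : H1 x -> ~ W x -> Z x.
  move=> H1x Wx; apply: contrapT => Zx.
  by apply: (p3 _ cH1); split; [exists b|exists x|exists a; split=> //; apply].
have H2Z x : H2 x -> ~ W x -> ~ Z x.
  move=> H2x Wx Zx.
  by apply: (p3 _ cH2); split; [exists x|exists c|exists a; split=> //; apply].
have [[u1 H1u1 Uu1] [d1 H1d1 [Ud1 Wd1]]] := sU _ cH1 H1W.
have [[u2 H2u2 Uu2] [d2 H2d2 [Ud2 Wd2]]] := sU _ cH2 H2W.
have cK : Ci [set x | H2 x /\ U x \/ H1 x /\ ~ U x].
  by apply: swap => //; split; [exists u2|exists d2|exists u1|exists d1].
apply: (p3 _ cK); split.
- by exists d1; split=> //; [right|exact: H1Z].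
- by exists u2; split; [left|exact: UW|apply: H2Z => //; exact: UW].
- by exists a; split=> //; right; split=> // /UW.
Qed.

Definition partition_of s :=
  [/\ forall P, s P -> tsep P /\ P `<=` E,
      forall x, E x -> exists2 P, s P & P x,
      forall P Q x, s P -> s Q -> P x -> Q x -> P = Q &
      exists P Q R, [/\ s P, s Q, s R & [/\ P <> Q, Q <> R & P <> R]]].

Definition nonwithin s C := forall P, s P -> ~ C `<=` P.

(** This and the next two types say within [M] that the quotient on the parts of [s] is a circuit, a
    cocircuit or, for [prime_type], 3-connected. *)
Definition circuit_type s := forall C, Ci C -> nonwithin s C ->
  forall P, s P -> exists2 x, C x & P x.

Definition cocircuit_type s := forall P Q, s P -> s Q -> P <> Q ->
  exists C, [/\ Ci C, forall x, C x -> P x \/ Q x, exists2 x, C x & P x &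
                exists2 x, C x & Q x].

Definition union_of s Z := forall P, s P -> P `<=` Z \/ forall x, P x -> ~ Z x.

Definition is_part s Z := exists2 P, s P & forall x, E x -> Z x <-> P x.

Definition prime_type s := forall Z, tsep Z -> union_of s Z ->
  is_part s Z \/ is_part s (~` Z).

Lemma union_ofC s Z : union_of s Z -> union_of s (~` Z).
Proof. by move=> u P /u [PZ|PZ]; [right=> x /PZ Zx; apply|left]. Qed.

Lemma part_nonempty s P : partition_of s -> s P -> exists2 x, E x & P x.
Proof. by move=> [st _ _ _] /st[tP _]; case: (tsep_meets Mm tP). Qed.

Lemma part_in_union s Z x P : union_of s Z -> s P -> P x -> Z x -> P `<=` Z.
Proof. by move=> /(_ P) u sP Px Zx; case: (u sP) => // /(_ _ Px). Qed.

(** * From a crossed union of parts to a single part *)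

Section MinimalPart.
Variables (s : set (set T)) (A Y P : set T).
Hypotheses (ps : partition_of s) (gs : s `<=` good)
  (sG : forall X, good X -> exists2 P, s P & X `<=` P \/ E `\` X `<=` P)
  (tA : tsep A) (tY : tsep Y) (AY : crossing A Y)
  (sP : s P) (PA : P `<=` A)
  (nA : forall P, s P -> ~ (forall x, E x -> ~ A x -> P x)).

Let outA : exists2 o, E o & ~ A o.
Proof. by have [_ [o]] := tsep_meets Mm tA; exists o. Qed.

Let ptP : exists2 x, E x & P x.
Proof. exact: part_nonempty ps sP. Qed.

(* V is the complement of a minimal set between P and A, found by Zorn's lemma;
   as P is good, only the separations Z containing P can cross it. *)
Let maximal_sub V : tsep V -> (forall x, ~ A x -> V x) ->
  (forall x, P x -> ~ V x) ->
  (forall Z, tsep Z -> (forall x, P x -> Z x) -> ~ crossing (~` V) Z) ->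
  forall x, E x -> ~ V x -> P x.
Proof.
move=> tV AV PV nV.
have gW : good (E `\` V).
  have tW : tsep (E `\` V).
    by apply: (tsep_ext Mm (tsepC Mm tV)) => x Ex; split=> [|[]].
  split; [exact: tW|by move=> x []|move=> Z tZ WZ].
  have WZ' : crossing (~` V) Z.
    have [[a [Ea [_ Wa] Za]] [b [Eb [_ Wb] Zb]] [c [Ec Wc Zc]] [d [Ed Wd Zd]]] := WZ.
    split; [by exists a|by exists b| |].
      by exists c; split=> // Vc; apply: Wc.
    by exists d; split=> // Vd; apply: Wd.
  have Zout Z' : (exists x, [/\ E x, ~ (~` V) x & Z' x]) ->
      ~ (forall x, E x -> Z' x -> P x).
    by move=> [x [Ex Wx Z'x]] /(_ _ Ex Z'x) /PV /Wx.
  have [_ _ q3 q4] := WZ'.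
  have [PZ|PZ|ZP|ZP] := good_nested (gs sP) tZ.
  - by apply: (nV _ tZ) => // x Px; apply: PZ => //; case: ps => /(_ _ sP)[_ PE] *; exact: PE.
  - apply: (nV _ (tsepC Mm tZ)).
      by move=> x Px; apply: PZ => //; case: ps => /(_ _ sP)[_ PE] *; exact: PE.
    by apply: crossing_sym; apply: crossingC; exact: crossing_sym.
  - exact: Zout q3 ZP.
  - by apply: (Zout _ q4) => x Ex nZ; case: (ZP _ Ex).
(* The good set [E \ V] or its complement lies in a part; [nA] forbids the latter, and the part is
   [P] because it contains [P]. *)
have [P' sP' [WP'|WP']] := sG gW; last first.
  have [] := nA sP'; move=> x Ex nAx; apply: WP'; split=> // -[_]; apply.
  exact: AV.
have [x Ex Px] := ptP.
have PP' : P = P'.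
  by case: ps => _ _ disj _; apply: (disj _ _ x) => //; apply: WP'; split=> //; exact: PV.
by move=> z Ez nVz; rewrite PP'; apply: WP'.
Qed.

(** [V] grows from the complement of [A] to that of [P]. The last condition in [F] keeps [~V]
    parallel to the outside of [A]: a circuit meeting both stays in [~V] inside [A]. *)
Lemma par_minimal : par4 A Y -> forall C, Ci C -> (exists2 x, C x & P x) ->
  (exists2 x, C x & ~ A x) -> forall x, C x -> A x -> P x.
Proof.
move=> pAY; have [p1 p2 p3 p4] := pAY.
pose F := [set V | [/\ tsep V, forall x, ~ A x -> V x, forall x, P x -> ~ V x &
  forall C, Ci C -> (exists2 x, C x & ~ V x) -> (exists x, [/\ C x, A x & V x]) ->
    (exists2 x, C x & ~ A x) -> False]].
have [o Eo Ao] := outA; have [e Ee Pe] := ptP.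
have [||V [[tV AV PV cV] Vmax]] := @Zorn_bigcup_ne T F (~` A).
- split=> //; first exact: tsepC.
    by move=> x /PA ? ; apply.
  by move=> C _ _ [x []].
- move=> G [X0 GX0] GF Gtot; split.
  + apply: tsep_bigcup => //; [by exists X0|by move=> X /GF[]|].
    by exists e => // X /GF[_ _ /(_ _ Pe)].
  + by move=> x Ax; exists X0 => //; have [_ + _ _] := GF _ GX0; exact.
  + by move=> x Px [X /GF[_ _ /(_ _ Px)]].
  + move=> C cC [x Cx nx] [y [Cy Ay [X GX Xy]]] Co.
    have [_ _ _ /(_ _ cC)] := GF _ GX; apply=> //; last by exists y.
    by exists x => // Xx; apply: nx; exists X.
have VP : forall x, E x -> ~ V x -> P x.
  apply: maximal_sub => // Z tZ PZ WZ.
  have tW := tsepC Mm tV.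
  have [s4|[q1 q2 q3 q4]] := ser_or_par Mm Mc tW tZ WZ.
    (* A series crossing is refuted by [no_ser]. If [V] meets [A], the outside of [A] serves as [U];
       otherwise [V] is still the initial set and the parallel crossing with [Y] supplies [U]. *)
    have [[y [Ey Ay Vy]]|nAV] := EM (exists y, [/\ E y, A y & V y]).
      have nP C : Ci C -> (exists2 x, C x & P x) -> (exists2 x, C x & ~ A x) ->
          forall x, C x -> V x -> ~ A x.
        move=> cC [x Cx Px] oC z Cz Vz Az; apply: (cV _ cC) => //; last by exists z.
        by exists x => //; exact: PV.
      have [G [cG Gy Go]] := join Ey Eo Ay Ao.
      have GV x : G x -> V x.
        move=> Gx; apply: contrapT => Vx; apply: (cV _ cG); [by exists x|by exists y|by exists o].
      have [G' [cG' G'e G'o]] := join Ee Eo (PA Pe) Ao.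
      apply: (no_ser tW tZ (tsepC Mm tA) _ cG _ _ cG' _ _ WZ s4).
      - by move=> x /AV Vx; apply.
      - by move=> x /GV Vx; apply.
      - by split; [exists o|exists y => //; apply].
      - by split; [exists e => //; exact: PV|exists o => //; apply; exact: AV].
      - move=> x G'x; have [Vx|] := EM (V x); last by left.
        by right; apply: (nP _ cG') => //; [exists e|exists o].
    have [[a [Ea Aa Ya]] _ [b [Eb Ab Yb]] [c [Ec Ac Yc]]] := AY.
    have AW x : E x -> A x -> ~ V x by move=> Ex Ax Vx; apply: nAV; exists x.
    have [G [cG Gb Gc]] := join Eb Ec Yb Yc.
    have GA x : G x -> ~ A x.
      move=> Gx Ax; have [Yx|Yx] := EM (Y x).
        by apply: (p3 _ cG); split; [exists b|exists c|exists x; split=> //; apply].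
      apply: (p4 _ cG); split; [exists c|exists b|exists x] => //; split=> //; by apply.
    have [G' [cG' G'a G'b]] := join Ea Eb Aa Ab.
    have G'Y x : G' x -> ~ A x -> Y x.
      move=> G'x Ax; apply: contrapT => Yx.
      by apply: (p3 _ cG'); split; [exists b|exists x|exists a; split=> //; apply].
    have tU : tsep (~` A `&` Y) by apply: corner => //; [exact: tsepC|exists b|case: AY => _ [z [? ? ?]] _ _; exists z; split=> //; apply].
    apply: (no_ser tW tZ tU _ cG _ _ cG' _ _ WZ s4).
    - by move=> x [/AV Vx _]; apply.
    - by move=> x /GA /AV Vx; apply.
    - by split; [exists b|exists c => // -[]].
    - by split; [exists a => //; exact: AW|exists b => //; apply; exact: AV].
    - move=> x G'x; have [Ax|Ax] := EM (A x); last by right; split=> //; exact: G'Y.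
      by left; apply: AW => //; exact: (circ_sub Mm cG').
  have [[a [Ea Wa Za]] [b [Eb Wb Zb]] _ [d [Ed Wd Zd]]] := WZ.
  (* After a parallel crossing the corner [~V ∩ Z], which still contains [P], could replace [~V],
     against maximality. *)
  apply: (Vmax (V `|` ~` Z)).
    by split=> [x|/(_ b) n]; [left|apply: Wb; apply: n; right].
  split.
  - suff -> : V `|` ~` Z = ~` (~` V `&` Z).
      by apply/(tsepC Mm)/corner => //; [exists a|exists d].
    by rewrite setCI setCK.
  - by move=> x /AV; left.
  - by move=> x Px [|]; [exact: PV|apply; exact: PZ].
  - move=> C cC [x Cx VZx] [y [Cy Ay VZy]] [z Cz Az].
    have Vx : ~ V x by move=> ?; apply: VZx; left.
    have Zx : Z x by apply: contrapT => ?; apply: VZx; right.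
    have Vy : ~ V y by move=> Vy; apply: (cV _ cC); [exists x|exists y|exists z].
    have Zy : ~ Z y by case: VZy.
    have Vz := AV _ Az.
    have [Zz|Zz] := EM (Z z).
      by apply: (q1 _ cC); split; [exists x|exists y|exists z; split=> //; apply].
    apply: (q2 _ cC); split; [by exists y|exists x; split=> //; by apply|].
    by exists z; split=> //; apply.
move=> C cC [p Cp Pp] [q Cq Aq] x Cx Ax.
apply: VP; first exact: (circ_sub Mm cC).
move=> Vx; apply: (cV _ cC); [|by exists x|by exists q].
by exists p => //; exact: PV.
Qed.

(** The condition in [F] now is the series one: circuits crossing [V] leave [A]. The two outcomes of
    a crossing change roles, the parallel one being refuted by [no_par]. *)
Lemma ser_minimal : ser4 A Y -> forall C, Ci C ->
  (crosses C A -> exists2 x, C x & P x) /\ (crosses C P -> exists2 x, C x & ~ A x).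
Proof.
move=> sAY.
pose F := [set V | [/\ tsep V, forall x, ~ A x -> V x, forall x, P x -> ~ V x &
  forall C, Ci C -> crosses C V -> exists2 x, C x & ~ A x]].
have [o Eo Ao] := outA; have [e Ee Pe] := ptP.
have [||V [[tV AV PV cV] Vmax]] := @Zorn_bigcup_ne T F (~` A).
- split=> //; first exact: tsepC.
    by move=> x /PA ? ; apply.
  by move=> C _ [].
- move=> G [X0 GX0] GF Gtot; split.
  + apply: tsep_bigcup => //; [by exists X0|by move=> X /GF[]|].
    by exists e => // X /GF[_ _ /(_ _ Pe)].
  + by move=> x Ax; exists X0 => //; have [_ + _ _] := GF _ GX0; exact.
  + by move=> x Px [X /GF[_ _ /(_ _ Px)]].
  + move=> C cC [[x Cx [X GX Xx]] [y Cy ny]].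
    have [_ _ _ /(_ _ cC)] := GF _ GX; apply; split; first by exists x.
    by exists y => // Xy; apply: ny; exists X.
have VP : forall x, E x -> ~ V x -> P x.
  apply: maximal_sub => // Z tZ PZ WZ.
  have tW := tsepC Mm tV.
  have [[a [Ea Wa Za]] [b [Eb Wb Zb]] _ [d [Ed Wd Zd]]] := WZ.
  have [s4|p4] := ser_or_par Mm Mc tW tZ WZ.
    apply: (Vmax (V `|` ~` Z)).
      by split=> [x|/(_ b) n]; [left|apply: Wb; apply: n; right].
    split.
    - suff -> : V `|` ~` Z = ~` (~` V `&` Z).
        by apply/(tsepC Mm)/corner => //; [exists a|exists d].
      by rewrite setCI setCK.
    - by move=> x /AV; left.
    - by move=> x Px [|]; [exact: PV|apply; exact: PZ].
    - move=> C cC [[x Cx VZx] [y Cy VZy]].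
      have Vy : ~ V y by move=> ?; apply: VZy; left.
      have Zy : Z y by apply: contrapT => ?; apply: VZy; right.
      have [|[z1 [C1 W1 _]] _ [z2 [C2 W2 _]] _] := s4 _ cC.
        case: VZx => [Vx|Zx]; [left|right]; last by split; [exists y|exists x].
        by split; [exists y|exists x => //; apply].
      by apply: cV => //; split; [exists z2 => //; exact: contrapT|exists z1].
  have [[y [Ey Ay Vy]]|nAV] := EM (exists y, [/\ E y, A y & V y]).
    apply: (no_par tW tZ (tsepC Mm tA) _ _ WZ p4).
      by move=> x /AV Vx; apply.
    move=> C cC CW; have CV : crosses C V by move: (crossesC CW); rewrite setCK.
    have [z Cz Az] := cV _ cC CV; split; first by exists z.
    apply: contrapT => nAV.
    have {}nAV x : C x -> A x -> ~ V x.
      by move=> Cx Ax Vx; apply: nAV; exists x => //; split; apply.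
    have [_ [w Cw Vw]] := CV.
    have Aw : A w by apply: contrapT => /AV.
    have [L [cL Ly Lo]] := join Ey Eo Ay Ao.
    have nCy : ~ C y by move=> /nAV; apply.
    have CA : crosses C A by split; [exists w|exists z].
    have LA : crosses L A by split; [exists y|exists o].
    have [K [cK Ky KCL]] := tA.2 _ _ _ cC cL CA LA Ay Ly nCy.
    have KL : K `<=` L.
      move=> x Kx; have [[Cx|//] Ax] := KCL _ Kx.
      have [|k Kk Ak] := cV _ cK; last by case: Ak; have [] := KCL _ Kk.
      by split; [exists y|exists x => //; exact: nAV].
    have : K o by rewrite (circ_eq Mm cK cL KL).
    by move=> /KCL[].
  have AW x : E x -> A x -> ~ V x by move=> Ex Ax Vx; apply: nAV; exists x.
  have tU : tsep (~` A `&` Y).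
    case: AY => _ [z [? ? ?]] [t [? ? ?]] _.
    by apply: corner => //; [exact: tsepC|exists t|exists z; split=> //; apply].
  apply: (no_par tW tZ tU _ _ WZ p4).
    by move=> x [/AV Vx _]; apply.
  move=> C cC [[x Cx Wx] [y Cy Wy]].
  have [|_ _ [c [? ? ?]] [c' [? ? ?]]] := sAY _ cC.
    left; split; [exists x|exists y] => //.
      by apply: contrapT => /AV.
    by move=> Ay; apply: Wy; apply: AW => //; exact: (circ_sub Mm cC).
  split; first by exists c.
  exists c' => //; split; first by move=> [].
  by apply; exact: AV.
move=> C cC; split; last first.
  move=> [[x Cx Px] [y Cy Py]]; apply: (cV _ cC).
  split; last by exists x => //; exact: PV.
  exists y => //; apply: contrapT => Vy; apply: Py; apply: VP => //.
  exact: (circ_sub Mm cC).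
(* If [C] missed [P], exchange with a circuit [H] from [P] to [o] would give a circuit inside [A].
   By the condition on [V] it uses nothing of [C] outside [H], so it equals [H], which contains
   [o]. *)
move=> [[x Cx Ax] [y Cy Ay]]; apply: contrapT => nCP.
have [H [cH He Ho]] := join Ee Eo (PA Pe) Ao.
have nCe : ~ C e by move=> ?; apply: nCP; exists e.
have CA : crosses C A by split; [exists x|exists y].
have HA : crosses H A by split; [exists e; [|exact: PA]|exists o].
have [K [cK Ke KCH]] := tA.2 _ _ _ cC cH CA HA (PA Pe) He nCe.
have KH : K `<=` H.
  move=> z Kz; have [[Cz|//] Az] := KCH _ Kz.
  have [Vz|Vz] := EM (V z); last by case: nCP; exists z => //; apply: VP => //; exact: (circ_sub Mm cC).
  have [|k Kk Ak] := cV _ cK; last by case: Ak; have [] := KCH _ Kk.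
  by split; [exists z|exists e => //; exact: PV].
have : K o by rewrite (circ_eq Mm cK cH KH).
by move=> /KCH[].
Qed.

End MinimalPart.
End Types.

Lemma not_setC T (A : set T) x : A x -> ~ (~` A) x.
Proof. by move=> Ax; apply. Qed.

Section PartTypes.
Variables (T : Type) (M : circuit_system T).
Local Notation Ci := (circuits M).
Local Notation E := (ground M).
Local Notation tsep := (tsep M).
Local Notation crossing := (crossing M).
Local Notation ser4 := (ser4 M).
Local Notation par4 := (par4 M).
Local Notation good := (good M).
Local Notation partition_of := (partition_of M).
Local Notation circuit_type := (circuit_type M).
Local Notation cocircuit_type := (cocircuit_type M).
Local Notation prime_type := (prime_type M).
Implicit Types (A B C D G H I K O P Q S U V W X Y Z : set T) (x y z p q : T).
Implicit Types (s t : set (set T)).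

Hypothesis Mm : is_matroid M.
Hypothesis Mc : connected_matroid M.

Let join := join Mc.

Lemma par4_three X Y C x y z : par4 X Y -> Ci C -> C x -> C y -> C z ->
  quad X Y x <> quad X Y y -> quad X Y x <> quad X Y z ->
  quad X Y y <> quad X Y z -> False.
Proof.
move=> [p1 p2 p3 p4] cC Cx Cy Cz; rewrite !quadE.
have q1 u v w : C u -> C v -> C w -> X u -> Y u -> X v -> ~ Y v -> ~ X w -> Y w -> False.
  by move=> *; apply: (p1 _ cC); split; [exists u|exists v|exists w].
have q2 u v w : C u -> C v -> C w -> X u -> ~ Y u -> X v -> Y v -> ~ X w -> ~ Y w -> False.
  by move=> *; apply: (p2 _ cC); split; [exists u|exists v|exists w]; split=> //; exact: not_setC.
have q3 u v w : C u -> C v -> C w -> ~ X u -> Y u -> ~ X v -> ~ Y v -> X w -> Y w -> False.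
  by move=> *; apply: (p3 _ cC); split; [exists u|exists v|exists w]; split=> //; exact: not_setC.
have q4 u v w : C u -> C v -> C w -> ~ X u -> ~ Y u -> ~ X v -> Y v -> X w -> ~ Y w -> False.
  by move=> *; apply: (p4 _ cC); split; [exists u|exists v|exists w]; split=> //; exact: not_setC.
(* In each of the 64 cases two points share a corner, or the corner missed by all three selects one
   of [q1] to [q4]. *)
have [Xx|Xx] := EM (X x); have [Yx|Yx] := EM (Y x);
have [Xy|Xy] := EM (X y); have [Yy|Yy] := EM (Y y);
have [Xz|Xz] := EM (X z); have [Yz|Yz] := EM (Y z) => n1 n2 n3;
first [by case: n1 | by case: n2 | by case: n3
 | by apply: (q1 x y z) | by apply: (q1 x z y) | by apply: (q1 y x z)
 | by apply: (q1 y z x) | by apply: (q1 z x y) | by apply: (q1 z y x)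
 | by apply: (q2 x y z) | by apply: (q2 x z y) | by apply: (q2 y x z)
 | by apply: (q2 y z x) | by apply: (q2 z x y) | by apply: (q2 z y x)
 | by apply: (q3 x y z) | by apply: (q3 x z y) | by apply: (q3 y x z)
 | by apply: (q3 y z x) | by apply: (q3 z x y) | by apply: (q3 z y x)
 | by apply: (q4 x y z) | by apply: (q4 x z y) | by apply: (q4 y x z)
 | by apply: (q4 y z x) | by apply: (q4 z x y) | by apply: (q4 z y x)].
Qed.

Lemma three_quads X Y x y z : (forall w, X w -> ~ Y w) ->
  quad X Y x <> quad X Y y -> quad X Y x <> quad X Y z -> quad X Y y <> quad X Y z ->
  [/\ exists2 u, [\/ u = x, u = y | u = z] & X u,
      exists2 u, [\/ u = x, u = y | u = z] & Y u &
      exists2 u, [\/ u = x, u = y | u = z] & ~ X u /\ ~ Y u].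
Proof.
move=> XY; have := (XY x, XY y, XY z); rewrite !quadE => -[[dx dy] dz] nxy nxz nyz.
have [Ox Oy Oz] : [/\ [\/ x = x, x = y | x = z], [\/ y = x, y = y | y = z] &
    [\/ z = x, z = y | z = z]] by split; [exact: Or31|exact: Or32|exact: Or33].
split; apply: contrapT => n.
- have [nx [ny nz]] : ~ X x /\ ~ X y /\ ~ X z.
    by split; [|split] => ?; apply: n; [exists x|exists y|exists z].
  clear n Ox Oy Oz XY dx dy dz.
  have [Yx|Yx] := EM (Y x); have [Yy|Yy] := EM (Y y); have [Yz|Yz] := EM (Y z);
  tauto.
- have [nx [ny nz]] : ~ Y x /\ ~ Y y /\ ~ Y z.
    by split; [|split] => ?; apply: n; [exists x|exists y|exists z].
  clear n Ox Oy Oz XY dx dy dz.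
  have [Yx|Yx] := EM (X x); have [Yy|Yy] := EM (X y); have [Yz|Yz] := EM (X z);
  tauto.
- have nn u : [\/ u = x, u = y | u = z] -> X u \/ Y u.
    move=> uxyz; apply: contrapT => XYu; apply: n; exists u => //.
    by split=> ?; apply: XYu; [left|right].
  have := nn _ Ox; have := nn _ Oy; have := nn _ Oz.
  clear n nn Ox Oy Oz XY.
  have [Yx|Yx] := EM (X x); have [Yy|Yy] := EM (X y); have [Yz|Yz] := EM (X z);
  tauto.
Qed.

Section Partition.
Variable s : set (set T).
Hypothesis ps : partition_of s.

Let disj P Q x : s P -> s Q -> P x -> Q x -> P = Q.
Proof. by case: ps => _ _ d _; exact: d. Qed.

Let subE P x : s P -> P x -> E x.
Proof. by case: ps => /(_ P) h _ _ _ sP Px; case: (h sP) => _; apply. Qed.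

Let pt P : s P -> exists2 x, E x & P x.
Proof. exact: (part_nonempty Mm ps). Qed.

Let partE x : E x -> exists2 P, s P & P x.
Proof. by case: ps => _ h _ _; exact: h. Qed.

Let stsep P : s P -> tsep P.
Proof. by case: ps => h _ _ _ /h[]. Qed.

Lemma nonwithin_two C P x y : s P -> C x -> C y -> P x -> ~ P y -> nonwithin s C.
Proof. by move=> sP Cx Cy Px Py Q sQ CQ; apply: Py; rewrite (disj sP sQ Px (CQ _ Cx)); exact: CQ. Qed.

Lemma third_part P Q : s P -> s Q -> exists S, [/\ s S, S <> P & S <> Q].
Proof.
move=> sP sQ; have [_ _ _ [A [B [C [sA sB sC [AB BC AC]]]]]] := ps.
have [AP|nAP] := EM (A = P); have [AQ|nAQ] := EM (A = Q).
- have [BQ|nBQ] := EM (B = Q); first by case: AB; rewrite BQ.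
  by exists B; split=> // BP; apply: AB; rewrite BP.
- have [BQ|nBQ] := EM (B = Q).
    by exists C; split=> // ?; [apply: AC|apply: BC]; congruence.
  by exists B; split=> // BP; apply: AB; congruence.
- have [BP|nBP] := EM (B = P).
    by exists C; split=> // ?; [apply: BC|apply: AC]; congruence.
  by exists B; split=> // BQ; apply: AB; congruence.
- by exists A.
Qed.

Lemma node_trichotomy : s `<=` good ->
  (forall X, good X -> exists2 P, s P & X `<=` P \/ E `\` X `<=` P) ->
  prime_type s \/ circuit_type s \/ cocircuit_type s.
Proof.
move=> gs sG; have [|/existsNP[Z /not_implyP[tZ /not_implyP[uZ nZ]]]] := EM (prime_type s).
  by left.
right.
have [nZ1 nZ2] : ~ is_part M s Z /\ ~ is_part M s (~` Z).
  by split=> ?; apply: nZ; [left|right].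
have nA A : tsep A -> union_of s A -> ~ is_part M s A ->
    forall P, s P -> ~ (forall x, E x -> A x -> P x).
  move=> tA uA npA P sP AP; apply: npA; exists P => // x Ex; split; first exact: AP.
  have [[a Ea Aa] _] := tsep_meets Mm tA.
  by move: x {Ex}; apply: (part_in_union uA sP (AP _ Ea Aa) Aa).
have nAZ := nA _ tZ uZ nZ1.
have nAZ' := nA _ (tsepC Mm tZ) (union_ofC uZ) nZ2.
(* If nothing crossed [Z], it would be good, and then it or its complement would lie in a part. *)
have [Y tY ZY] : exists2 Y, tsep Y & crossing Z Y.
  apply: contrapT => nY.
  have gZ : good (Z `&` E).
    have tZE : tsep (Z `&` E) by apply: (tsep_ext Mm tZ) => x Ex; split=> [|[]].
    split=> // Y tY [[a [Ea [Za _] Ya]] [b [Eb [Zb _] Yb]] [c [Ec Zc Yc]] [d [Ed Zd Yd]]].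
    apply: nY; exists Y => //; split; [by exists a|by exists b| |].
      by exists c; split=> // ?; apply: Zc.
    by exists d; split=> // ?; apply: Zd.
  have [P sP [ZP|ZP]] := sG _ gZ.
    by apply: (nAZ _ sP) => x Ex Zx; apply: ZP.
  by apply: (nAZ' _ sP) => x Ex Zx; apply: ZP; split=> // -[].
have [sr|pr] := ser_or_par Mm Mc tZ tY ZY.
- left; have sr' : ser4 (~` Z) Y by apply: ser4Cl; rewrite setCK.
  have step A P : tsep A -> crossing A Y -> union_of s A -> s P -> P `<=` A ->
      (forall P, s P -> ~ (forall x, E x -> ~ A x -> P x)) -> ser4 A Y ->
      forall C, Ci C -> (crosses C A -> exists2 x, C x & P x) /\
                        (crosses C P -> exists2 x, C x & ~ A x).
    by move=> *; apply: (ser_minimal Mm Mc ps gs sG _ tY); eauto.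
  have cZ P C : s P -> Ci C -> (crosses C Z -> exists2 x, C x & P x).
    move=> sP cC CZ; have [PZ|PZ] := uZ _ sP.
      by apply: (step Z P tZ ZY uZ sP PZ _ sr C cC).1.
    apply: (step _ P (tsepC Mm tZ) (crossingC ZY) (union_ofC uZ) sP PZ _ sr' C cC).1.
      by move=> Q sQ ZQ; apply: (nAZ _ sQ) => x Ex Zx; apply: ZQ => //; apply.
    exact: crossesC.
  move=> C cC nC P sP; apply: cZ => //.
  have [x Cx] := circ_neq0 Mm cC; have [Q sQ Qx] := partE (circ_sub Mm cC Cx).
  have [y Cy Qy] : exists2 y, C y & ~ Q y.
    apply: contrapT => n; apply: (nC _ sQ) => y Cy.
    by apply: contrapT => Qy; apply: n; exists y.
  have CQ : crosses C Q by split; [exists x|exists y].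
  have [QZ|QZ] := uZ _ sQ.
    have [//|z Cz Zz] := (step Z Q tZ ZY uZ sQ QZ _ sr C cC).2 CQ.
    by split; [exists x => //; exact: QZ|exists z].
  have [|z Cz Zz] := (step _ Q (tsepC Mm tZ) (crossingC ZY) (union_ofC uZ) sQ QZ _ sr' C cC).2 CQ.
    by move=> Q' sQ' ZQ; apply: (nAZ _ sQ') => u Eu Zu; apply: ZQ => //; apply.
  by split; [exists z => //; exact: contrapT|exists x => //; exact: QZ].
- right; have pr' : par4 (~` Z) Y by case: pr => *; split=> //; rewrite setCK.
  have step A P : tsep A -> crossing A Y -> union_of s A -> s P -> P `<=` A ->
      (forall P, s P -> ~ (forall x, E x -> ~ A x -> P x)) -> par4 A Y ->
      forall C, Ci C -> (exists2 x, C x & P x) -> (exists2 x, C x & ~ A x) ->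
      forall x, C x -> A x -> P x.
    by move=> *; apply: (par_minimal Mm Mc ps gs sG _ tY); eauto.
  have one P : s P -> forall C, Ci C -> crosses C Z -> (exists2 x, C x & P x) ->
      forall x y, C x -> C y -> P y -> (Z x <-> Z y) -> P x.
    move=> sP C cC [[z Cz Zz] [z' Cz' Zz']] CP x y Cx Cy Py Zxy.
    have [PZ|PZ] := uZ _ sP.
      apply: (step Z P tZ ZY uZ sP PZ nAZ' pr C cC CP _ x Cx); first by exists z'.
      by apply/Zxy; exact: PZ.
    apply: (step _ P (tsepC Mm tZ) (crossingC ZY) (union_ofC uZ) sP PZ _ pr' C cC CP _ x Cx).
    - by move=> Q sQ ZQ; apply: (nAZ _ sQ) => u Eu Zu; apply: ZQ => //; apply.
    - by exists z => //; apply.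
    - by move=> /Zxy; exact: PZ.
  (* For parts on different sides of [Z], any circuit joining them stays in [P] on one side and in
     [Q] on the other. *)
  have across P Q : s P -> s Q -> P `<=` Z -> (forall x, Q x -> ~ Z x) ->
      exists C, [/\ Ci C, forall x, C x -> P x \/ Q x, exists2 x, C x & P x &
                    exists2 x, C x & Q x].
    move=> sP sQ PZ QZ; have [p Ep Pp] := pt sP; have [q Eq Qq] := pt sQ.
    have [C [cC Cp Cq]] := join Ep Eq (PZ _ Pp) (QZ _ Qq).
    have CZ : crosses C Z by split; [exists p => //; exact: PZ|exists q => //; exact: QZ].
    exists C; split=> //; [|by exists p|by exists q].
    have [CP CQ] : (exists2 x, C x & P x) /\ (exists2 x, C x & Q x) by split; [exists p|exists q].
    move=> x Cx; have [Zx|Zx] := EM (Z x).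
      by left; apply: (one P sP C cC CZ CP x p) => //; have := PZ _ Pp.
    by right; apply: (one Q sQ C cC CZ CQ x q) => //; have := QZ _ Qq.
  (* P and Q lie on the same side: eliminate the trace in a part R of the other *)
  have same P Q R : s P -> s Q -> s R -> P <> Q -> P <> R -> Q <> R ->
      (exists C, [/\ Ci C, forall x, C x -> P x \/ R x, exists2 x, C x & P x &
                    exists2 x, C x & R x]) ->
      (exists C, [/\ Ci C, forall x, C x -> Q x \/ R x, exists2 x, C x & Q x &
                    exists2 x, C x & R x]) ->
      exists C, [/\ Ci C, forall x, C x -> P x \/ Q x, exists2 x, C x & P x &
                    exists2 x, C x & Q x].
    move=> sP sQ sR PQ PR QR [C [cC CPR [p Cp Pp] [r Cr Rr]]] [H [cH HQR [q Hq Qq] [r' Hr Rr']]].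
    have tR := tsepC Mm (stsep sR).
    have pR : ~ R p by move=> Rp; apply: PR; apply: disj Pp Rp.
    have qR : ~ R q by move=> Rq; apply: QR; apply: disj Qq Rq.
    have CR : crosses C (~` R) by split; [exists p|exists r => //; apply].
    have HR : crosses H (~` R) by split; [exists q|exists r' => //; apply].
    have nCq : ~ C q by move=> /CPR[Pq|//]; apply: PQ; apply: disj Pq Qq.
    have [K [cK Kq KCH]] := tR.2 _ _ _ cC cH CR HR qR Hq nCq.
    have KPQ x : K x -> P x \/ Q x.
      by move=> /KCH[[/CPR[]|/HQR[]]] //; [left|right].
    exists K; split=> //; last by exists q.
    apply: contrapT => nP; have KH : K `<=` H.
      move=> x Kx; have [[Cx|//] nRx] := KCH _ Kx; have [Px|//] := CPR _ Cx.
      by case: nP; exists x.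
    have : K r' by rewrite (circ_eq Mm cK cH KH).
    by move=> /KCH[_]; apply.
  have sym P Q : (exists C, [/\ Ci C, forall x, C x -> P x \/ Q x, exists2 x, C x & P x &
                    exists2 x, C x & Q x]) ->
      (exists C, [/\ Ci C, forall x, C x -> Q x \/ P x, exists2 x, C x & Q x &
                    exists2 x, C x & P x]).
    by move=> [C [cC CPQ ? ?]]; exists C; split=> // x /CPQ[]; [right|left].
  have [[a Ea Za] [b Eb Zb]] := tsep_meets Mm tZ.
  have [A sA Aa] := partE Ea; have [B sB Bb] := partE Eb.
  have AZ := part_in_union uZ sA Aa Za.
  have BZ : forall x, B x -> ~ Z x by apply: (part_in_union (union_ofC uZ) sB Bb Zb).
  have sep P Q : s P -> s Q -> P `<=` Z -> (forall x, Q x -> ~ Z x) -> P <> Q.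
    by move=> sP sQ PZ QZ PQ; have [x _ Px] := pt sP; apply: (QZ x); [rewrite -PQ|exact: PZ].
  move=> P Q sP sQ PQ.
  have [PZ|PZ] := uZ _ sP; have [QZ|QZ] := uZ _ sQ.
  - by apply: (same P Q B) => //; [exact: sep|exact: sep|exact: across|exact: across].
  - exact: across.
  - by apply: sym; exact: across.
  - apply: (same P Q A) => //; [| |by apply: sym; exact: across|by apply: sym; exact: across].
      by apply: nesym; exact: sep.
    by apply: nesym; exact: sep.
Qed.

(** * Partitions with a crossed part *)

Section Crossed.
Variables P Z : set T.
Hypotheses (sP : s P) (tZ : tsep Z) (PZ : crossing P Z).

Let union_rest : (forall S, s S -> S <> P -> ~ crossing S Z) ->
  union_of s (~` P `&` Z) /\ union_of s (~` P `&` ~` Z).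
Proof.
move=> nS; have [[a [Ea Pa Za]] [b [Eb Pb Zb]] _ _] := PZ.
have side Q : s Q -> Q = P \/ (forall x, Q x -> ~ P x) /\ (Q `<=` Z \/ forall x, Q x -> ~ Z x).
  move=> sQ; have [->|QP] := EM (Q = P); [by left|right].
  have QnP x : Q x -> ~ P x by move=> Qx Px; apply: QP; exact: disj Qx Px.
  split=> //; apply: contrapT => n; apply: (nS _ sQ QP); split.
  - apply: contrapT => m; apply: n; right=> x Qx Zx; apply: m; exists x.
    by split=> //; exact: subE Qx.
  - apply: contrapT => m; apply: n; left=> x Qx; apply: contrapT => Zx; apply: m; exists x.
    by split=> //; exact: subE Qx.
  - by exists a; split=> // /QnP.
  - by exists b; split=> // /QnP.
split=> Q /side[->|[QP [QZ|QZ]]].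
- by right=> x Px [].
- by left=> x Qx; split; [exact: QP|exact: QZ].
- by right=> x /QZ Zx [].
- by right=> x Px [].
- by right=> x /QZ Zx [_]; apply.
- by left=> x Qx; split; [exact: QP|exact: QZ].
Qed.

(** For prime type the corners outside [P] have to be single parts, as their complements exceed [P].
    So [s] consists of [P] and these two corners. *)
Let quad_part : (forall S, s S -> S <> P -> ~ crossing S Z) -> prime_type s ->
  forall Q x y, s Q -> Q x -> E y -> quad P Z x = quad P Z y -> Q y.
Proof.
move=> nS pr Q x y sQ Qx Ey /quadE[Pxy Zxy].
have [u1 u2] := union_rest nS.
have [q1 q2 [c [Ec Pc Zc]] [d [Ed Pd Zd]]] := PZ.
have [[a [Ea Pa _]] _ _ _] := PZ.
have tP' := tsepC Mm (stsep sP); have tZ' := tsepC Mm tZ.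
have nP x' : P x' -> ~ (~` P) x' by move=> ?; apply.
have part1 W : tsep (~` P `&` W) -> union_of s (~` P `&` W) ->
    (exists x, [/\ E x, ~ P x & ~ W x]) -> is_part M s (~` P `&` W).
  move=> tW uW [e [Ee Pe We]]; have [//|[R sR Re]] := pr _ tW uW.
  have RP : R = P by apply: (disj (x := a)) => //; apply/(Re _ Ea) => -[].
  by case: Pe; rewrite -RP; apply/(Re _ Ee) => -[].
have [R1 sR1 R1e] : is_part M s (~` P `&` Z).
  apply: part1 => //; last by exists d.
  by apply: corner => //; [exists c|case: q2 => z [? ? ?]; exists z; split=> //; exact: nP].
have [R2 sR2 R2e] : is_part M s (~` P `&` ~` Z).
  apply: part1 => //; last by exists c; split=> //; apply.
  apply: corner => //; first by exists d.
  by case: q1 => z [? ? ?]; exists z; split=> //; exact: not_setC.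
have Ex := subE sQ Qx.
have [Px|Px] := EM (P x).
  by rewrite (disj sQ sP Qx Px); apply/Pxy.
have Py : ~ P y by move=> /Pxy.
have [Zx|Zx] := EM (Z x).
  have R1x : R1 x by apply/(R1e _ Ex).
  by rewrite (disj sQ sR1 Qx R1x); apply/(R1e _ Ey); split=> //; apply/Zxy.
have R2x : R2 x by apply/(R2e _ Ex).
by rewrite (disj sQ sR2 Qx R2x); apply/(R2e _ Ey); split=> // /Zxy.
Qed.

(** A union of two parts is not a part, so its complement is one, and [s] has exactly three
    parts. *)
Let two_parts S : S <> P -> s S -> tsep (P `|` S) -> prime_type s ->
  forall Q x y, s Q -> Q x -> E y -> quad P S x = quad P S y -> Q y.
Proof.
move=> SP sS tPS pr Q x y sQ Qx Ey /quadE[Pxy Sxy].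
have [p Ep Pp] := pt sP; have [r Er Sr] := pt sS.
have uPS : union_of s (P `|` S).
  move=> R sR; have [->|RP] := EM (R = P); first by left=> ? ?; left.
  have [->|RS] := EM (R = S); first by left=> ? ?; right.
  right=> z Rz [Pz|Sz]; first by apply: RP; apply: disj Rz Pz.
  by apply: RS; apply: disj Rz Sz.
have [[R sR Re]|[R sR Re]] := pr _ tPS uPS.
  have RP : R = P by apply: (disj (x := p)) => //; apply/(Re _ Ep); left.
  by case: SP; rewrite -RP; apply: (disj (x := r)) => //; apply/(Re _ Er); right.
have Ex := subE sQ Qx.
have [Px|Px] := EM (P x); first by rewrite (disj sQ sP Qx Px); apply/Pxy.
have [Sx|Sx] := EM (S x); first by rewrite (disj sQ sS Qx Sx); apply/Sxy.
have Rx : R x by apply/(Re _ Ex) => -[].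
by rewrite (disj sQ sR Qx Rx); apply/(Re _ Ey) => -[/Pxy|/Sxy].
Qed.

Let join_parts Q R : s Q -> s R -> Q <> R ->
  exists C x y, [/\ Ci C, C x & C y] /\ [/\ Q x, R y, ~ R x & ~ Q y].
Proof.
move=> sQ sR QR; have [x Ex Qx] := pt sQ; have [y Ey Ry] := pt sR.
have Rx : ~ R x by move=> Rx; apply: QR; apply: disj Qx Rx.
have Qy : ~ Q y by move=> Qy; apply: QR; apply: disj Qy Ry.
by have [C [cC Cx Cy]] := join Ex Ey Qx Qy; exists C, x, y.
Qed.

(** If [S] and [Z] crossed in series, a circuit between the two corners in [P] would also meet [S],
    hence three corners of [P] and [Z]. *)
Let par_both S : s S -> S <> P -> crossing S Z -> par4 P Z -> par4 S Z.
Proof.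
move=> sS SP SZ pPZ.
have [s4|//] := ser_or_par Mm Mc (stsep sS) tZ SZ.
have [[a [Ea Pa Za]] [b [Eb Pb Zb]] _ _] := PZ.
have [C [cC Ca Cb]] := join Ea Eb Za Zb.
have [|[x [Cx Sx _]] _ _ _] := s4 _ cC; first by right; split; [exists a|exists b].
have Px : ~ P x by move=> Px; apply: SP; apply: disj Sx Px.
by case: (par4_three pPZ cC Ca Cb Cx); rewrite quadE => -[Pq Zq]; tauto.
Qed.

Let ser_both S : s S -> S <> P -> crossing S Z -> ser4 P Z -> ser4 S Z.
Proof.
move=> sS SP SZ s4.
have [//|pSZ] := ser_or_par Mm Mc (stsep sS) tZ SZ.
have [[a [Ea Sa Za]] [b [Eb Sb Zb]] _ _] := SZ.
have [C [cC Ca Cb]] := join Ea Eb Za Zb.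
have [|[x [Cx Px _]] _ _ _] := s4 _ cC; first by right; split; [exists a|exists b].
have Sx : ~ S x by move=> Sx; apply: SP; apply: disj Sx Px.
by case: (par4_three pSZ cC Ca Cb Cx); rewrite quadE => -[Pq Zq]; tauto.
Qed.

(** If [Z] crosses no other part, prime type leaves only [P] and two corners as parts, and circuit
    type would give a circuit in three corners. If [Z] crosses [S] too, then [P] and [S] are
    parallel, and prime type again leaves three parts. *)
Lemma crossed_par : par4 P Z ->
  prime_type s \/ circuit_type s \/ cocircuit_type s -> cocircuit_type s.
Proof.
move=> pPZ; have [[a [Ea Pa Za]] [b [Eb Pb Zb]] [c [Ec Pc Zc]] [d [Ed Pd Zd]]] := PZ.
have [nS|/existsNP[S /not_implyP[sS /not_implyP[SP /contrapT SZ]]]] :=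
    EM (forall S, s S -> S <> P -> ~ crossing S Z).
  move=> [pr|[ct|//]].
    move=> Q R sQ sR QR.
    have [C [x [y [[cC Cx Cy] [Qx Ry Rx Qy]]]]] := join_parts sQ sR QR.
    exists C; split=> //; [|by exists x|by exists y].
    move=> z Cz; apply: contrapT => nz.
    have Ez := circ_sub Mm cC Cz; have Ey := circ_sub Mm cC Cy.
    apply: (par4_three pPZ cC Cx Cy Cz) => q.
    - by apply: Qy; apply: (quad_part nS pr sQ Qx).
    - by apply: nz; left; apply: (quad_part nS pr sQ Qx).
    - by apply: nz; right; apply: (quad_part nS pr sR Ry).
  have [C [cC Ca Cc]] := join Ea Ec Pa Pc.
  have [Q sQ Qd] := partE Ed.
  have [_ u2] := union_rest nS.
  have QPZ := part_in_union u2 sQ Qd (conj Pd Zd).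
  have [z Cz Qz] := ct _ cC (nonwithin_two sP Ca Cc Pa Pc) _ sQ.
  have [Pz Zz] : ~ P z /\ ~ Z z := QPZ _ Qz.
  by case: (par4_three pPZ cC Ca Cc Cz); rewrite quadE => -[Pq Zq]; tauto.
have pSZ := par_both sS SP SZ pPZ.
have PS x : P x -> ~ S x by move=> Px Sx; apply: SP; apply: disj Sx Px.
have [[u [Eu Su Zu]] _ _ _] := SZ.
have Pu : ~ P u by move=> /PS.
have [H [cH Hb Hu]] := join Eb Eu Pb Pu.
have Sb := PS _ Pb.
(* A point of [H] outside both would give three corners: of [S] and [Z] if it is in [Z], of [P] and
   [Z] if not. *)
have HPS x : H x -> P x \/ S x.
  move=> Hx; apply: contrapT => nPS.
  have [Px Sx] : ~ P x /\ ~ S x by split=> ?; apply: nPS; [left|right].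
  have [Zx|Zx] := EM (Z x).
    by case: (par4_three pSZ cH Hb Hu Hx); rewrite quadE => -[Pq Zq]; tauto.
  by case: (par4_three pPZ cH Hb Hu Hx); rewrite quadE => -[Pq Zq]; tauto.
have HP : exists2 x, H x & P x by exists b.
have HS : exists2 x, H x & S x by exists u.
have [Q [sQ QP QS]] := third_part sP sS.
have [q Eq Qq] := pt sQ.
have [Pq Sq] : ~ P q /\ ~ S q.
  by split=> ?; [apply: QP|apply: QS]; apply: disj Qq _.
move=> [pr|[ct|//]]; last first.
  have [x Hx Qx] := ct _ cH (nonwithin_two sP Hb Hu Pb Pu) _ sQ.
  by have [Px|Sx] := HPS _ Hx; [case: QP|case: QS]; apply: disj Qx _.
have tPS : tsep (P `|` S).
  by apply: (parU Mm Mc (stsep sP) (stsep sS) PS cH) => //; exists q.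
move=> Q1 Q2 s1 s2 Q12.
have [C [x [y [[cC Cx Cy] [Qx Qy nQx nQy]]]]] := join_parts s1 s2 Q12.
exists C; split=> //; [|by exists x|by exists y].
move=> z Cz; apply: contrapT => nz.
have same := two_parts SP sS tPS pr.
have qxy : quad P S x <> quad P S y.
  by move=> /(same _ _ _ s1 Qx (circ_sub Mm cC Cy)).
have qxz : quad P S x <> quad P S z.
  by move=> /(same _ _ _ s1 Qx (circ_sub Mm cC Cz)) ?; apply: nz; left.
have qyz : quad P S y <> quad P S z.
  by move=> /(same _ _ _ s2 Qy (circ_sub Mm cC Cz)) ?; apply: nz; right.
have [[u1 ux Pu1] [u2 uy Su2] [u3 uz [Pu3 Su3]]] := three_quads PS qxy qxz qyz.
have inC w : [\/ w = x, w = y | w = z] -> C w by case=> ->.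
have [||P3|S3] // := par_no_three Mm (stsep sP) (stsep sS) PS cH HPS HP HS cC _ _ (inC _ uz).
- by exists u1 => //; exact: inC.
- by exists u2 => //; exact: inC.
Qed.

Lemma crossed_ser : ser4 P Z ->
  prime_type s \/ circuit_type s \/ cocircuit_type s -> circuit_type s.
Proof.
move=> sPZ; have [[a [Ea Pa Za]] [b [Eb Pb Zb]] [c [Ec Pc Zc]] [d [Ed Pd Zd]]] := PZ.
have nonP Q : s Q -> Q <> P -> forall x, Q x -> ~ P x.
  by move=> sQ QP x Qx Px; apply: QP; apply: disj Qx Px.
have [nS|/existsNP[S /not_implyP[sS /not_implyP[SP /contrapT SZ]]]] :=
    EM (forall S, s S -> S <> P -> ~ crossing S Z).
  move=> [pr|[//|ct]]; last first.
    have [Q sQ Qc] := partE Ec.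
    have [u1 _] := union_rest nS.
    have QPZ := part_in_union u1 sQ Qc (conj Pc Zc).
    have PQ : P <> Q by move=> PQ; rewrite PQ in Pc.
    have [C [cC CPQ [x Cx Px] [y Cy Qy]]] := ct _ _ sP sQ PQ.
    have [|_ _ _ [z [Cz Pz Zz]]] := sPZ _ cC.
      by left; split; [exists x|exists y => //; have [] := QPZ _ Qy].
    by have [//|/QPZ[]] := CPQ _ Cz.
  move=> C cC nC Q sQ.
  have [[x1 [C1 P1 Z1]] [x2 [C2 P2 Z2]] [x3 [C3 P3 Z3]] [x4 [C4 P4 Z4]]] : full4 P Z C.
    apply: sPZ => //; apply: contrapT => n.
    have [x Cx] := circ_neq0 Mm cC; have [R sR Rx] := partE (circ_sub Mm cC Cx).
    apply: (nC _ sR) => y Cy; apply: (quad_part nS pr sR Rx (circ_sub Mm cC Cy)).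
    apply/quadE; split; split=> h; apply: contrapT => h'; apply: n;
      by [left; split; [exists x|exists y] | left; split; [exists y|exists x]
         |right; split; [exists x|exists y] | right; split; [exists y|exists x]].
  have [QP|QP] := EM (Q = P); first by rewrite QP; exists x1.
  have [q Eq Qq] := pt sQ; have Pq := nonP _ sQ QP _ Qq.
  have h x : C x -> quad P Z q = quad P Z x -> exists2 x, C x & Q x.
    by move=> Cx qx; exists x => //; apply: (quad_part nS pr sQ Qq (circ_sub Mm cC Cx)).
  by have [Zq|Zq] := EM (Z q); [apply: (h x3)|apply: (h x4)] => //; apply/quadE; tauto.
have sSZ := ser_both sS SP SZ sPZ.
have PS x : P x -> ~ S x by move=> Px Sx; apply: SP; apply: disj Sx Px.
have toZ X C : full4 X Z C -> crosses C Z.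
  by move=> [[x [? ? ?]] [y [? ? ?]] _ _]; split; [exists x|exists y].
have cr C : Ci C -> crosses C P <-> crosses C S.
  move=> cC; split=> CX.
    have [|[x [Cx Sx _]] _ [y [Cy Sy _]] _] := sSZ _ cC.
      by right; apply: (toZ P); apply: sPZ => //; left.
    by split; [exists x|exists y].
  have [|[x [Cx Sx _]] _ [y [Cy Sy _]] _] := sPZ _ cC.
    by right; apply: (toZ S); apply: sSZ => //; left.
  by split; [exists x|exists y].
have [Q [sQ QP QS]] := third_part sP sS.
have [q Eq Qq] := pt sQ.
have [Pq Sq] : ~ P q /\ ~ S q.
  by split=> ?; [apply: QP|apply: QS]; apply: disj Qq _.
move=> [pr|[//|ct]]; last first.
  have [C [cC CPQ [x Cx Px] [y Cy Qy]]] := ct _ _ sP sQ (nesym QP).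
  have [|[z Cz Sz] _] := (cr _ cC).1.
    by split; [exists x|exists y => //; exact: nonP Qy].
  by have [/PS//|Qz] := CPQ _ Cz; case: QS; apply: disj Qz Sz.
have tPS : tsep (P `|` S).
  by apply: (serU Mm Mc (stsep sP) (stsep sS)) => //; exists q.
have same := two_parts SP sS tPS pr.
move=> C cC nC R sR.
have CP : crosses C P.
  suff [//|CS] : crosses C P \/ crosses C S by apply/cr.
  apply: contrapT => n.
  have [x Cx] := circ_neq0 Mm cC; have [Q' sQ' Qx] := partE (circ_sub Mm cC Cx).
  apply: (nC _ sQ') => y Cy; apply: (same _ _ _ sQ' Qx (circ_sub Mm cC Cy)).
  apply/quadE; split; split=> h; apply: contrapT => h'; apply: n;
    by [left; split; [exists x|exists y] | left; split; [exists y|exists x]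
       |right; split; [exists x|exists y] | right; split; [exists y|exists x]].
have [[x Cx Px] [x' Cx' Px']] := CP.
have [[y Cy Sy] _] := (cr _ cC).1 CP.
(* Inside [P ∪ S], [C] would make [P] and [S] parallel as well, and a circuit from [P] to [q], which
   has to meet [S], could not exist. *)
have [z [Cz Pz Sz]] : exists z, [/\ C z, ~ P z & ~ S z].
  apply: contrapT => n.
  have CPS w : C w -> P w \/ S w.
    move=> Cw; apply: contrapT => m; apply: n; exists w.
    by split=> // ?; apply: m; [left|right].
  have [H [cH Ha Hq]] := join Ea Eq Pa Pq.
  have [|[w Hw Sw] _] := (cr _ cH).1; first by split; [exists a|exists q].
  have [] := @par_no_three _ _ Mm _ _ _ _ (stsep sP) (stsep sS) PS cC CPS _ _ cH _ _ _ Hq => //.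
  - by exists x.
  - by exists y.
  - by exists a.
  - by exists w.
have [RP|RP] := EM (R = P); first by rewrite RP; exists x.
have [RS|RS] := EM (R = S); first by rewrite RS; exists y.
have [r Er Rr] := pt sR.
have [Pr Sr] : ~ P r /\ ~ S r.
  by split=> ?; [apply: RP|apply: RS]; apply: disj Rr _.
exists z => //; apply: (same _ _ _ sR Rr (circ_sub Mm cC Cz)).
by apply/quadE; tauto.
Qed.

End Crossed.
End Partition.

(** * Adjacent partitions of the same type *)

Section Adjacent.
Variables (s t : set (set T)) (P P' : set T).
Hypotheses (ps : partition_of s) (pt : partition_of t) (sP : s P) (tP' : t P')
  (PP' : P' = E `\` P).

Let inP Q : t Q -> Q <> P' -> Q `<=` P.
Proof.
case: pt => tt _ d _ tQ QP' x Qx; apply: contrapT => Px; apply: QP'.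
apply: (d _ _ x) => //; rewrite PP'; split=> //.
by have [_ QE] := tt _ tQ; exact: QE.
Qed.

Let outP Q : s Q -> Q <> P -> forall x, Q x -> E x /\ ~ P x.
Proof.
case: ps => tt _ d _ sQ QP x Qx; split; last by move=> Px; apply: QP; apply: (d _ _ x).
by have [_ QE] := tt _ sQ; exact: QE.
Qed.

(** A third part of either partition supplies the points outside [Q ∪ S], on both sides of [P]. *)
Let cross_exists Q S : t Q -> Q <> P' -> s S -> S <> P -> tsep (Q `|` S) ->
  exists2 Z, tsep Z & crossing P Z.
Proof.
move=> tQ QP' sS SP tZ; exists (Q `|` S) => //.
have [Q2 [tQ2 Q2P' Q2Q]] := third_part pt tP' tQ.
have [S2 [sS2 S2P S2S]] := third_part ps sP sS.
have [q Eq Qq] := part_nonempty Mm pt tQ; have [r Er Sr] := part_nonempty Mm ps sS.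
have [q2 Eq2 Qq2] := part_nonempty Mm pt tQ2; have [r2 Er2 Sr2] := part_nonempty Mm ps sS2.
have [_ _ ds _] := ps; have [_ _ dt _] := pt.
split.
- by exists q; split=> //; [exact: inP Qq|left].
- exists q2; split=> //; first exact: inP Qq2.
  move=> [Qq2'|Sq2]; first by apply: Q2Q; apply: dt Qq2 Qq2'.
  by have [_] := outP sS SP Sq2; apply; exact: inP Qq2.
- by exists r; split=> //; [case: (outP sS SP Sr)|right].
- exists r2; split=> //; first by case: (outP sS2 S2P Sr2).
  move=> [Qr2|Sr2']; last by apply: S2S; apply: ds Sr2 Sr2'.
  by have [_] := outP sS2 S2P Sr2; apply; exact: inP Qr2.
Qed.

(** [Q] and [S] are in series: a circuit crossing [Q] meets [P'], so it crosses [P] and has to meet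
    [S]; likewise in the other direction. *)
Lemma adjacent_circuit : circuit_type s -> circuit_type t ->
  exists2 Z, tsep Z & crossing P Z.
Proof.
move=> cs ct; have [Q [tQ QP' _]] := third_part pt tP' tP'.
have [S [sS SP _]] := third_part ps sP sP.
apply: (cross_exists tQ QP' sS SP).
have [_ _ ds _] := ps; have [_ _ dt _] := pt.
have [tsS tsQ] : tsep S /\ tsep Q.
  by case: ps => /(_ _ sS)[]; case: pt => /(_ _ tQ)[].
have [S2 [sS2 S2P S2S]] := third_part ps sP sS.
have [r2 Er2 Sr2] := part_nonempty Mm ps sS2.
have P'x x : P' x -> ~ P x by rewrite PP' => -[].
apply: (serU Mm Mc tsQ tsS); last first.
  exists r2 => //; split; last by move=> Sr; apply: S2S; apply: ds Sr2 Sr.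
  by move=> Qr; have [_] := outP sS2 S2P Sr2; apply; exact: inP Qr.
have fromP C : Ci C -> crosses C P -> nonwithin s C /\ nonwithin t C.
  move=> cC [[x Cx Px] [y Cy Py]]; split.
    exact: nonwithin_two ps _ _ _ _ sP Cx Cy Px Py.
  have P'y : P' y by rewrite PP'; split=> //; exact: (circ_sub Mm cC).
  by apply: (nonwithin_two pt tP' Cy Cx P'y) => /P'x.
move=> C cC; split=> -[[x Cx Xx] [y Cy Xy]].
- have nt := nonwithin_two pt tQ Cx Cy Xx Xy.
  have [z Cz P'z] := ct _ cC nt _ tP'.
  have CP : crosses C P by split; [exists x => //; exact: inP Xx|exists z => //; exact: P'x].
  have [u Cu Su] := cs _ cC (fromP _ cC CP).1 _ sS.
  split; first by exists u.
  by exists x => // Sx; have [_] := outP sS SP Sx; apply; exact: inP Xx.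
- have ns := nonwithin_two ps sS Cx Cy Xx Xy.
  have [z Cz Pz] := cs _ cC ns _ sP.
  have CP : crosses C P by split; [exists z|exists x => //; case: (outP sS SP Xx)].
  have [u Cu Qu] := ct _ cC (fromP _ cC CP).2 _ tQ.
  split; first by exists u.
  by exists x => // Qx; have [_] := outP sS SP Xx; apply; exact: inP Qx.
Qed.

(** A circuit in [Q ∪ P'] and one in [S ∪ P] are swapped along [P] to a circuit in [Q ∪ S], which
    makes these two parallel. *)
Lemma adjacent_cocircuit : cocircuit_type s -> cocircuit_type t ->
  exists2 Z, tsep Z & crossing P Z.
Proof.
move=> cs ct; have [Q [tQ QP' _]] := third_part pt tP' tP'.
have [S [sS SP _]] := third_part ps sP sP.
apply: (cross_exists tQ QP' sS SP).
have [_ _ ds _] := ps; have [_ _ dt _] := pt.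
have [tsS tsQ tsP] : [/\ tsep S, tsep Q & tsep P].
  by case: ps => h; case: pt => /(_ _ tQ)[] *; split=> //; [case: (h _ sS)|case: (h _ sP)].
have [S2 [sS2 S2P S2S]] := third_part ps sP sS.
have [r2 Er2 Sr2] := part_nonempty Mm ps sS2.
have P'x x : P' x -> ~ P x by rewrite PP' => -[].
have [C [cC CQ [x Cx Qx] [y Cy P'y]]] := ct _ _ tQ tP' QP'.
have [D [cD DS [u Du Su] [v Dv Pv]]] := cs _ _ sS sP SP.
have CP : crosses C P by split; [exists x => //; exact: inP Qx|exists y => //; exact: P'x].
have DP : crosses D P by split; [exists v|exists u => //; case: (outP sS SP Su)].
have cK := swap Mm tsP cC cD CP DP.
apply: (parU Mm Mc tsQ tsS _ cK).
- by move=> z Qz Sz; have [_] := outP sS SP Sz; apply; exact: inP Qz.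
- move=> z [[Cz Pz]|[Dz Pz]].
    by left; have [//|/P'x] := CQ _ Cz.
  by right; have [|] := DS _ Dz.
- by exists x => //; left; split=> //; exact: inP Qx.
- by exists u => //; right; split=> //; case: (outP sS SP Su).
exists r2 => //; split; last by move=> Sr; apply: S2S; apply: ds Sr2 Sr.
by move=> Qr; have [_] := outP sS2 S2P Sr2; apply; exact: inP Qr.
Qed.

End Adjacent.
End PartTypes.

(** * Separations and types of quotients *)

Lemma card_ge_inj T (X : set T) n (f : nat -> T) :
  (forall i, (i < n)%N -> X (f i)) ->
  (forall i j, (i < n)%N -> (j < n)%N -> f i = f j -> i = j) -> `I_n #<= X.
Proof.
move=> fX finj; apply: (card_le_trans (B := f @` `I_n)).
  have : f @` `I_n #= `I_n.
    by apply: inj_card_eq => i j; rewrite !inE => ? ?; exact: finj.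
  by move=> /card_esym /card_eqPle[].
by apply: subset_card_le => _ [i ? <-]; exact: fX.
Qed.

Lemma card_ge_ex T (X : set T) n : `I_n.+1 #<= X -> exists f : nat -> T,
  (forall i, (i <= n)%N -> X (f i)) /\
  (forall i j, (i <= n)%N -> (j <= n)%N -> f i = f j -> i = j).
Proof.
move=> /card_leP[g].
have lt i : (minn i n < n.+1)%N by rewrite ltnS geq_minr.
pose h i : `I_n.+1 := SigSub (mem_set (lt i : `I_n.+1 (minn i n))).
exists (fun i => val (g (h i))); split=> [i le_in|i j le_in le_jn /val_inj].
  by apply: set_mem; exact: valP.
have ginj : injective g by move=> x y; apply: (@inj _ _ _ g); rewrite inE.
by move=> /ginj /(congr1 val) /=; rewrite (minn_idPl le_in) (minn_idPl le_jn).
Qed.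

Lemma card_ge1P T (X : set T) : `I_1 #<= X <-> exists x, X x.
Proof.
split=> [/card_ge_ex[f [fX _]]|[x Xx]]; first by exists (f 0%N); exact: fX.
by apply: (@card_ge_inj _ _ _ (fun=> x)) => // -[|//] [].
Qed.

Lemma card_ge2P T (X : set T) : `I_2 #<= X <-> exists x y, [/\ X x, X y & x <> y].
Proof.
split=> [/card_ge_ex[f [fX finj]]|[x [y [Xx Xy xy]]]].
  exists (f 0%N), (f 1%N); split; [exact: fX|exact: fX|].
  by move=> /(finj 0%N 1%N isT isT).
apply: (@card_ge_inj _ _ _ (fun i => if i is 0 then x else y)).
  by case=> [|[|]].
by case=> [|[|]] // [|[|]] // _ _ /esym.
Qed.

Lemma card_ge3P T (X : set T) :
  `I_3 #<= X <-> exists x y z, [/\ X x, X y, X z & [/\ x <> y, y <> z & x <> z]].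
Proof.
split=> [/card_ge_ex[f [fX finj]]|[x [y [z [Xx Xy Xz [xy yz xz]]]]]].
  exists (f 0%N), (f 1%N), (f 2%N); split; [exact: fX|exact: fX|exact: fX|].
  split; [by move=> /(finj 0%N 1%N isT isT)|by move=> /(finj 1%N 2%N isT isT)|].
  by move=> /(finj 0%N 2%N isT isT).
apply: (@card_ge_inj _ _ _ (fun i => if i is 0 then x else if i is 1 then y else z)).
  by case=> [|[|[|]]].
by case=> [|[|[|]]] // [|[|[|]]] // _ _ => // /esym.
Qed.

Lemma card_eq1P T (F : set T) : F #= `I_1 <-> exists f, F = [set f].
Proof.
split=> [F1|[f ->]]; last exact: card_set1.
have [F1' F1''] := (card_eqPle _ _).1 F1; have [f Ff] := (card_ge1P F).1 F1''.
exists f; apply/seteqP; split=> [x Fx|_ ->//].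
apply: contrapT => xf; have : `I_2 #<= F by apply/card_ge2P; exists x, f.
by move=> /card_le_trans /(_ F1'); rewrite card_le_II.
Qed.

Section Separations.
Variables (T : Type) (M : circuit_system T).
Local Notation Ci := (circuits M).
Local Notation E := (ground M).
Implicit Types (A B C D G H I K O P Q S U V W X Y Z : set T) (x y z p q : T).

Hypothesis Mm : is_matroid M.

(** The element of [F] lies in every circuit inside [BX ∪ BY]; eliminating it from two of these
    would leave a circuit in a base. Conversely, any element of the unique circuit can serve as
    [F]. *)
Lemma connectivity1P X Y : bipartition E X Y -> connectivity M X Y 1 <-> tsep M X.
Proof.
move=> [XYE XY0].
have XE : X `<=` E by rewrite -XYE => x; left.
have YE : Y `<=` E by rewrite -XYE => x; right.
have dXY x : X x -> Y x -> False.
  by move=> Xx Yx; have : (X `&` Y) x by []; rewrite XY0.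
have YX x : E x -> Y x <-> ~ X x.
  rewrite -XYE => XYx; split=> [Yx Xx|nXx]; first exact: dXY Xx Yx.
  by case: XYx.
have bY B : basis M Y B <-> basis M (~` X) B.
  split=> -[BY Bi Bx]; split=> // x.
  - by move=> /BY[h Ex]; split=> //; apply/YX.
  - by move=> nXx Ex; apply: Bx => //; apply/YX.
  - by move=> /BY[h Ex]; split=> //; apply/YX.
  - by move=> Yx Ex; apply: Bx => //; apply/YX.
split.
- move=> [BX [BY [F [/(base_restriction _ XE) bX /(base_restriction _ YE) /bY bY' FB]]]].
  move=> + /card_eq1P[f Ff]; rewrite {}Ff in FB *.
  move=> /(base_ground Mm)[BE Bi Bs].
  have BfE : BX f \/ BY f by exact: FB.
  have Ef : E f by case: bX bY' => h _ _ [h' _ _]; case: BfE => [/h[]|/h'[]].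
  have [|O [cO Of OB]] := Bs f I Ef; first by case=> _; apply.
  have OBB x : O x -> BX x \/ BY x by move=> /OB[[]//|->].
  have allf C : Ci C -> (forall x, C x -> BX x \/ BY x) -> C f.
    move=> cC CB; apply: contrapT => nCf; apply: (Bi _ cC) => x Cx.
    by split; [exact: CB|move=> xf; apply: nCf; rewrite -xf].
  apply: (split_tsep Mm (BX := BX) (BY := BY) (O := O)); split=> // O' cO' O'B.
  apply: contrapT => O'O; have [q O'q nOq] := circ_diff Mm cO' cO O'O.
  have [K [cK Kq KO]] := circ_elim Mm cO' cO (allf _ cO' O'B) Of O'q nOq.
  have [|] := KO f; last by [].
  by apply: allf => // x /KO[[/O'B|/OBB]].
- move=> tX; have [BX bX] := basis_ex Mm X; have [BY bY'] := basis_ex Mm (~` X).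
  have [O sp] := tsep_split Mm tX bX bY'; have [_ _ cO OB Ou] := sp.
  have [f Of] := circ_neq0 Mm cO.
  exists BX, BY, [set f]; split.
  + exact/(base_restriction BX XE).
  + by apply/(base_restriction BY YE)/bY.
  + by move=> _ ->; exact: OB.
  + apply/(base_ground Mm); split.
    * move=> x [[Bx|Bx] _]; split=> //; first by case: bX => h _ _; case: (h _ Bx).
      by case: bY' => h _ _; case: (h _ Bx).
    * move=> C cC CB; have CO : C = O by apply: Ou => // x /CB[].
      by have [|_] := CB f; [rewrite CO|apply].
    * move=> x _ Ex nBx; have [->|xf] := EM (x = f).
        exists O; split=> // y Oy; have [->|yf] := EM (y = f); first by right.
        by left; split=> //; exact: OB.
      have {}nBx : ~ (BX x \/ BY x) by move=> Bx; apply: nBx; split.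
      have nOx : ~ O x by move=> /OB.
      have [D [cD Dx DB]] : exists D, [/\ Ci D, D x &
          forall y, D y -> (BX y \/ BY y) \/ y = x].
        have [Xx|Xx] := EM (X x).
          case: bX => _ _ /(_ x Xx Ex)[|D [cD Dx DB]]; first by move=> ?; apply: nBx; left.
          by exists D; split=> // y /DB[]; [left; left|right].
        case: bY' => _ _ /(_ x Xx Ex)[|D [cD Dx DB]]; first by move=> ?; apply: nBx; right.
        by exists D; split=> // y /DB[]; [left; right|right].
      have [Df|nDf] := EM (D f).
        have [K [cK Kx KDO]] := circ_elim Mm cD cO Df Of Dx nOx.
        exists K; split=> // y /KDO[[/DB[By|->]|/OB By] yf]; [by left|by right|by left].
      exists D; split=> // y Dy; have [By|->] := DB _ Dy; last by right.
      by left; split=> // yf; apply: nDf; rewrite -yf.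
  + by apply/card_eq1P; exists f.
Qed.

Lemma separation2P X Y : separation M 2 X Y <->
  [/\ bipartition E X Y, tsep M X, exists x y, [/\ X x, X y & x <> y] &
      exists x y, [/\ Y x, Y y & x <> y]].
Proof.
split.
  move=> [bXY [_ [[<-] c1 /card_ge2P X2 /card_ge2P Y2]]].
  by split=> //; apply/(connectivity1P bXY).
move=> [bXY tX /card_ge2P X2 /card_ge2P Y2]; split=> //; exists 1%N.
by split=> //; apply/(connectivity1P bXY).
Qed.

Hypothesis Mc : connected_matroid M.

Lemma no_separation1 X Y : ~ separation M 1 X Y.
Proof.
move=> [[XYE XY0] [_ [[<-] [BX [BY [F [bX bY FB bM F0]]]] /card_ge1P[x Xx] /card_ge1P[y Yy]]]].
have F00 : F = set0 by apply/eqP; rewrite -(@card_eq0 _ nat) -II0.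
have XE : X `<=` E by rewrite -XYE => z; left.
have YE : Y `<=` E by rewrite -XYE => z; right.
have YX z : Y z -> ~ X z.
  by move=> Yz Xz; have : (X `&` Y) z by []; rewrite XY0.
have {}bX := (base_restriction BX XE).1 bX.
have {}bY : basis M (~` X) BY.
  have [BYY BYi BYs] := (base_restriction BY YE).1 bY; split=> //.
    by move=> z /BYY[/YX].
  by move=> z Xz Ez; apply: BYs => //; move: Ez; rewrite -XYE => -[].
have [C [cC Cx Cy]] := join Mc (XE _ Xx) (YE _ Yy) Xx (YX _ Yy).
have CX : crosses C X by split; [exists x|exists y => //; exact: YX].
have [O [cO _ OB]] := split_circuit_ex Mm bX bY cC CX.
move: bM; rewrite F00 setD0 => /(base_ground Mm)[_ Bi _].
exact: (Bi _ cO).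
Qed.

Lemma n_connected3P : n_connected 3 M <-> forall X Y, bipartition E X Y ->
  tsep M X -> (exists x y, [/\ X x, X y & x <> y]) ->
  (exists x y, [/\ Y x, Y y & x <> y]) -> False.
Proof.
split=> [n3 X Y bXY tX X2 Y2|h [|[|[|l]]] X Y // _].
- by apply: (n3 2%N X Y) => //; apply/separation2P.
(* A separation has order [k+1], so 0 does not occur. *)
- by case=> _ [k []].
- exact: no_separation1.
- by move=> /separation2P[]; exact: h.
Qed.

Lemma tsep_set1 x y : E x -> E y -> x <> y -> tsep M [set x].
Proof.
move=> Ex Ey xy; have [C [cC Cx Cy]] := Mc Ex Ey xy; split.
  by exists C => //; split; [exists x|exists y => // /esym].
by move=> D H q _ _ [[z Dz zx] _] _ qx _ []; rewrite qx -zx.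
Qed.

Lemma is_circuitP x y : E x -> E y -> x <> y -> is_circuit M <->
  forall C, Ci C -> C = E.
Proof.
move=> Ex Ey xy; split=> [cE C cC|h].
  by apply: (circ_eq Mm) => // z; exact: circ_sub.
by have [C [cC _ _]] := Mc Ex Ey xy; rewrite /is_circuit -(h _ cC).
Qed.

(** If [E] is minimal among the sets meeting all bases, some base avoids [E \ z] and can only be
    [{z}]. So all singletons are bases and any two elements are parallel. *)
Lemma is_cocircuitP x y : E x -> E y -> x <> y -> is_cocircuit M <->
  forall x y, E x -> E y -> x <> y -> Ci [set x; y].
Proof.
move=> Ex Ey xy.
have noloop z : ~ Ci [set z].
  move=> cz; have [u [Eu uz]] : exists u, E u /\ u <> z.
    by have [xz|] := EM (x = z); [exists y; split=> // yz; apply: xy; rewrite xz|exists x].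
  have Ez : E z by apply: (circ_sub Mm cz).
  have [C [cC Cu Cz]] := Mc Eu Ez uz.
  have zC : [set z] = C by apply: (circ_eq Mm) => // _ ->.
  by apply: uz; move: Cu; rewrite -zC => ->.
split.
- move=> [[_ nE] mE] a b Ea Eb ab.
  have base1 z : E z -> base M [set z].
    move=> Ez; have [B bB EzB] : exists2 B, base M B & E `\ z `<=` E `\` B.
      apply: contrapT => nB; have : E `\ z = E.
        apply: mE; last by move=> u [].
        split; first by move=> u [].
        by move=> B bB EB; apply: nB; exists B.
      by move=> Ezz; move: (Ez); rewrite -{1}Ezz => -[_]; apply.
    suff -> : [set z] = B by [].
    have Bz u : B u -> u = z.
      move=> Bu; apply: contrapT => uz; have [[BE _] _] := bB.
      by have [|_] := EzB u; [split=> //; exact: BE|apply].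
    apply/seteqP; split=> [_ ->|u /Bz//].
    apply: contrapT => nBz; apply: (nE _ bB) => u Eu; split=> // Bu.
    by apply: nBz; rewrite -(Bz _ Bu).
  have [_ _ /(_ b I Eb)[|D [cD Db Dab]]] := (base_ground Mm _).1 (base1 _ Ea).
    by move=> /esym.
  suff <- : D = [set a; b] by [].
  apply/seteqP; split=> [u /Dab//|u [|] -> //].
  apply: contrapT => nDa; apply: (noloop b); suff <- : D = [set b] by [].
  by apply/seteqP; split=> [v Dv|_ ->//]; have [va|//] := Dab _ Dv; case: nDa; rewrite -[a]va.
- move=> par.
  have base1 z : E z -> base M [set z].
    move=> Ez; apply/(base_ground Mm); split=> [_ ->//|C cC Cz|u _ Eu uz].
      apply: (noloop z); suff <- : C = [set z] by [].
      apply/seteqP; split=> // _ ->; have [u Cu] := circ_neq0 Mm cC.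
      by rewrite -(Cz _ Cu).
    by exists [set z; u]; split; [apply: par => // /esym|right|].
  split; first split=> // B bB EB.
    have [_ Bi Bs] := (base_ground Mm _).1 bB.
    have [//|D [cD Dx DB]] := Bs x I Ex; first by move=> Bx; have [_] := EB _ Ex.
    apply: (noloop x); suff <- : D = [set x] by [].
    apply/seteqP; split=> [u Du|_ ->//]; have [Bu|//] := DB _ Du.
    by have [_] := EB _ (circ_sub Mm cD Du).
  move=> B [BE nB] _; apply/seteqP; split=> // z Ez; apply: contrapT => Bz.
  apply: (nB _ (base1 _ Ez)) => u Bu; split; first exact: BE.
  by move=> uz; apply: Bz; rewrite -uz.
Qed.

End Separations.

(** * Types of partitions and of their quotients *)

Section QuotientTypes.
Variables (T U : Type) (M : circuit_system T) (pi : T -> U).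
Local Notation Ci := (circuits M).
Local Notation E := (ground M).
Local Notation N := (quotient M pi).
Implicit Types (A B C D G H I K O P Q S V W X Y Z : set T) (x y z p q : T).

Definition fibers : set (set T) :=
  [set P | exists2 x, E x & P = fib pi (pi x) `&` E].

Hypothesis Mm : is_matroid M.
Hypothesis Mc : connected_matroid M.
Hypothesis tpi : forall x, E x -> tsep M (fib pi (pi x)).

Let Nm : is_matroid N. Proof. exact: quotient_matroid. Qed.
Let Nc : connected_matroid N. Proof. exact: quotient_connected. Qed.

Lemma fibersE x : E x -> fibers (fib pi (pi x) `&` E).
Proof. by exists x. Qed.

Lemma fibers_disj P Q x : fibers P -> fibers Q -> P x -> Q x -> P = Q.
Proof. by move=> [y Ey ->] [z Ez ->] [xy _] [xz _]; rewrite -xy xz. Qed.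

Lemma nonwithin_fibers C : Ci C -> nonwithin fibers C <-> nonfiber pi C.
Proof.
move=> cC; split=> [nC|[x [y [Cx Cy xy]]] _ [z Ez ->] Cz]; last first.
  by apply: xy; have [-> _] := Cz _ Cx; have [-> _] := Cz _ Cy.
have [x Cx] := circ_neq0 Mm cC; apply: contrapT => n.
apply: (nC _ (fibersE (circ_sub Mm cC Cx))) => y Cy; split; last exact: (circ_sub Mm cC Cy).
by apply: contrapT => yx; apply: n; exists y, x.
Qed.

Lemma card3_quotient : `I_3 #<= ground N <->
  exists P Q R, [/\ fibers P, fibers Q, fibers R & [/\ P <> Q, Q <> R & P <> R]].
Proof.
have FE x y : E x -> (fib pi (pi x) `&` E = fib pi (pi y) `&` E -> pi x = pi y).
  move=> Ex h; have : (fib pi (pi x) `&` E) x by [].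
  by rewrite h => -[].
split=> [/card_ge3P|].
  move=> [_ [_ [_ [[x Ex <-] [y Ey <-] [z Ez <-] [xy yz xz]]]]].
  exists (fib pi (pi x) `&` E), (fib pi (pi y) `&` E), (fib pi (pi z) `&` E).
  by split; [exact: fibersE|exact: fibersE|exact: fibersE|split=> /FE; auto].
move=> [_ [_ [_ [[x Ex ->] [y Ey ->] [z Ez ->] [xy yz xz]]]]].
apply/card_ge3P; exists (pi x), (pi y), (pi z).
split; [by exists x|by exists y|by exists z|].
by split=> h; [apply: xy|apply: yz|apply: xz]; rewrite h.
Qed.

Hypothesis N3 : `I_3 #<= ground N.

Let two : exists x y, [/\ E x, E y & pi x <> pi y].
Proof.
by have [_ [_ [_ [[x Ex <-] [y Ey <-] _ [xy _ _]]]]] := (card_ge3P _).1 N3; exists x, y.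
Qed.

Lemma fibers_partition : partition_of M fibers.
Proof.
split.
- move=> _ [x Ex ->]; split; last by move=> y [].
  by apply: (tsep_ext Mm (tpi Ex)) => y Ey; split=> [|[]].
- by move=> x Ex; exists (fib pi (pi x) `&` E) => //; exact: fibersE.
- exact: fibers_disj.
- exact/card3_quotient.
Qed.

Lemma quotient_circuit : is_circuit N <-> circuit_type M fibers.
Proof.
have [a [b [Ea Eb ab]]] := two.
have Na : ground N (pi a) by exists a.
have Nb : ground N (pi b) by exists b.
rewrite (is_circuitP Nm Nc Na Nb ab); split=> h.
- move=> C cC /(nonwithin_fibers cC) nC _ [x Ex ->].
  have : (pi @` C) (pi x) by rewrite (h (pi @` C)); [exists x|exists C].
  by move=> [y Cy yx]; exists y => //; split=> //; exact: (circ_sub Mm cC).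
- move=> _ [C [cC nC] <-]; apply/seteqP; split=> _ [x Cx <-].
    by exists x => //; exact: (circ_sub Mm cC).
  have [y Cy [yx _]] := h _ cC ((nonwithin_fibers cC).2 nC) _ (fibersE Cx).
  by exists y.
Qed.

Lemma quotient_cocircuit : is_cocircuit N <-> cocircuit_type M fibers.
Proof.
have [a [b [Ea Eb ab]]] := two.
have Na : ground N (pi a) by exists a.
have Nb : ground N (pi b) by exists b.
rewrite (is_cocircuitP Nm Nc Na Nb ab); split=> h.
- move=> _ _ [x Ex ->] [y Ey ->] PQ.
  have xy : pi x <> pi y by move=> xy; apply: PQ; rewrite xy.
  have [|||C [cC nC] Cxy] := h (pi x) (pi y) => //; [by exists x|by exists y|].
  have [[x' Cx' xx'] [y' Cy' yy']] : (pi @` C) (pi x) /\ (pi @` C) (pi y).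
    by rewrite Cxy; split; [left|right].
  exists C; split=> //.
  + move=> z Cz; have Ez := circ_sub Mm cC Cz.
    have : (pi @` C) (pi z) by exists z.
    by rewrite Cxy => -[zx|zy]; [left|right].
  + by exists x' => //; split=> //; exact: (circ_sub Mm cC).
  + by exists y' => //; split=> //; exact: (circ_sub Mm cC).
- move=> _ _ [x Ex <-] [y Ey <-] xy.
  have [|C [cC Cxy [x' Cx' [xx' _]] [y' Cy' [yy' _]]]] := h _ _ (fibersE Ex) (fibersE Ey).
    move=> PQ; apply: xy; have : (fib pi (pi x) `&` E) x by [].
    by rewrite PQ => -[].
  exists C; first by split=> //; exists x', y'; split=> //; rewrite xx' yy'.
  apply/seteqP; split=> [_ [z Cz <-]|_ [->|->]]; [|by exists x'|by exists y'].
  by have [[]|[]] := Cxy _ Cz; [left|right].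
Qed.

Lemma quotient_prime : n_connected 3 N <-> prime_type M fibers.
Proof.
rewrite (n_connected3P Nm Nc); split=> h.
- move=> Z tZ uZ; pose X := pi @` (Z `&` E).
  have ZX x : E x -> Z x <-> (pi @^-1` X) x.
    move=> Ex; split=> [Zx|[y [Zy Ey] yx]]; first by exists x.
    apply: (part_in_union uZ (fibersE Ey) (x := y)) => //.
  have tX : tsep N X by apply/tsep_quotient => //; exact: (tsep_ext Mm tZ).
  have XN : bipartition (ground N) X (ground N `\` X).
    split; last by apply/seteqP; split=> // i [Xi []].
    apply/seteqP; split=> i; first by case=> [[x [_ Ex] <-]|[]//]; exists x.
    by move=> Ni; have [Xi|Xi] := EM (X i); [left|right].
  have one A : A `<=` E -> (exists x, A x) -> ~ (exists i j, [/\ (pi @` A) i, (pi @` A) j & i <> j]) ->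
      (forall x y, A x -> E y -> pi y = pi x -> A y) -> exists2 P, fibers P & A = P.
    move=> AE [a Aa] n cl; exists (fib pi (pi a) `&` E); first by apply: fibersE; exact: AE.
    apply/seteqP; split=> [x Ax|x [xa Ex]]; last exact: (cl a).
    split; last exact: AE.
    by apply: contrapT => xa; apply: n; exists (pi x), (pi a); split.
  have [[z1 Ez1 Z1] [z2 Ez2 Z2]] := tsep_meets Mm tZ.
  have [X2|nX2] := EM (exists i j, [/\ X i, X j & i <> j]).
    have [Y2|nY2] := EM (exists i j, [/\ (ground N `\` X) i, (ground N `\` X) j & i <> j]).
      by case: (h _ _ XN tX X2 Y2).
    right; have [||||P fP ZP] := one (E `\` Z).
    + by move=> x [].
    + by exists z2.
    + move=> [_ [_ [[x [Ex Zx] <-] [y [Ey Zy] <-] xy]]]; apply: nY2.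
      exists (pi x), (pi y); split=> //; split.
      * by exists x.
      * by move=> /(ZX _ Ex).
      * by exists y.
      * by move=> /(ZX _ Ey).
    + move=> x y [Ex Zx] Ey yx; split=> // /(ZX _ Ey); rewrite /preimage /= yx.
      by move=> /(ZX _ Ex).
    by exists P => // x Ex; rewrite -ZP; split=> [|[]].
  left; have [||||P fP ZP] := one (Z `&` E).
  + by move=> x [].
  + by exists z1.
  + exact: nX2.
  + move=> x y [Zx Ex] Ey yx; split=> //; apply/(ZX _ Ey); rewrite /preimage /= yx.
    exact/(ZX _ Ex).
  by exists P => // x Ex; rewrite -ZP; split=> [|[]].
- move=> X Y [XYN XY0] /(tsep_quotient Mm tpi) tX [i [j [Xi Xj ij]]] [k [l [Yk Yl kl]]].
  have inE i' : X i' \/ Y i' -> exists2 x, E x & pi x = i'.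
    by move=> XYi; have : (X `|` Y) i' by []; rewrite XYN.
  have YX i' : Y i' -> ~ X i'.
    by move=> Yi Xi'; have : (X `&` Y) i' by []; rewrite XY0.
  have uX : union_of fibers (pi @^-1` X).
    move=> _ [x Ex ->]; have [Xx|Xx] := EM (X (pi x)); [left|right] => y [yx _].
      by rewrite /preimage /= yx.
    by rewrite /preimage /= yx.
  have one (W : set U) (i' j' : U) : W i' -> W j' -> (exists2 x, E x & pi x = i') ->
      (exists2 x, E x & pi x = j') -> is_part M fibers (pi @^-1` W) -> i' = j'.
    move=> Wi Wj [x Ex xi] [y Ey yj] [_ [z Ez ->] zW].
    have [|xz _] := (zW _ Ex).1; first by rewrite /preimage /= xi.
    have [|yz _] := (zW _ Ey).1; first by rewrite /preimage /= yj.
    by rewrite -xi -yj xz yz.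
  have [pX|pX] := h _ tX uX.
    by apply: ij; apply: (one X) => //; apply: inE; left.
  apply: kl; apply: (one (~` X)) => //; [exact: YX|exact: YX| |]; apply: inE; by right.
Qed.

End QuotientTypes.

(** * Trees and torsos *)

Section Reachability.
Variable V : eqType.
Implicit Types (e : rel V) (u v w : V).

Lemma reach_refl e v : reachable e v v.
Proof. by exists [::]. Qed.

Lemma reach_step e v a b : reachable e v a -> e a b -> reachable e v b.
Proof.
by move=> [p [pp <-]] eab; exists (rcons p b); rewrite rcons_path pp eab last_rcons.
Qed.

Lemma reach_ind e v (F : V -> Prop) : F v ->
  (forall a b, reachable e v a -> F a -> e a b -> F b) ->
  forall u, reachable e v u -> F u.
Proof.
move=> Fv step u [p [pp <-]]; elim/last_ind: p pp => [//|p b IH].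
rewrite rcons_path last_rcons => /andP[pp eb].
by apply: (step (last v p)) => //; [exists p|exact: IH].
Qed.

Lemma reach_cons e a b u : e a b -> reachable e b u -> reachable e a u.
Proof. by move=> eab [p [pp <-]]; exists (b :: p); rewrite /= eab pp. Qed.

Lemma reach_trans e a b c : reachable e a b -> reachable e b c -> reachable e a c.
Proof. by move=> ab; move: c; apply: reach_ind => // x y _ ax; exact: reach_step. Qed.

Lemma reach_sym e a b : symmetric e -> reachable e a b -> reachable e b a.
Proof.
move=> sym; move: b; apply: reach_ind; first exact: reach_refl.
by move=> x y _ xa exy; apply: reach_cons xa; rewrite sym.
Qed.

Lemma delete_edge_sym e v w : symmetric e -> symmetric (delete_edge e v w).
Proof.
move=> sym a b; rewrite /delete_edge /= sym [(b == v) && _]andbC [(b == w) && _]andbC.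
by rewrite orbC.
Qed.

Lemma delete_edgeC e v w : delete_edge e v w = delete_edge e w v.
Proof.
apply/funext => a; apply/funext => b.
by rewrite /delete_edge /= orbC.
Qed.

Lemma delete_edge_off e v w a b : e a b -> a <> v -> b <> v -> delete_edge e v w a b.
Proof.
by move=> eab /eqP/negPf av /eqP/negPf bv; rewrite /delete_edge /= eab av bv andbF.
Qed.

Lemma path_avoid e v w a p : path e a p -> v \notin a :: p ->
  reachable (delete_edge e v w) a (last a p).
Proof.
move=> pp vp; exists p; split=> //.
have pv : all (predC1 v) (a :: p).
  by apply/allP => x xp /=; apply: contraNneq vp => <-.
apply: (sub_in_path (P := predC1 v) (e := e)) pp => //.
by move=> x y /eqP xv /eqP yv exy; exact: delete_edge_off.
Qed.

Lemma reach_two_ends e v w u : reachable e v u ->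
  reachable (delete_edge e v w) v u \/ reachable (delete_edge e v w) w u.
Proof.
move: u; apply: reach_ind; first by left; exact: reach_refl.
move=> a b _ Ha eab.
have [/orP[/andP[_ /eqP ->]|/andP[_ /eqP ->]]|nab] :=
    boolP ((a == v) && (b == w) || (a == w) && (b == v)).
- by right; exact: reach_refl.
- by left; exact: reach_refl.
have dab : delete_edge e v w a b by rewrite /delete_edge /= eab nab.
by case: Ha => Ha; [left|right]; exact: reach_step Ha dab.
Qed.

(** The rest of the cycle bypasses its first edge; distinctness of at least three vertices ensures
    that it does not use this edge. *)
Lemma reach_cycle e (c : seq V) : (2 < size c)%N -> ucycle e c ->
  exists v w, e v w /\ reachable (delete_edge e v w) w v.
Proof.
case: c => [|x [|y [|z p]]] // _ /andP[].
rewrite [cycle _ _]/= rcons_path => /and4P[exy eyz pz ex].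
rewrite 2!cons_uniq !inE !negb_or => /andP[/and3P[xy xz xp] /andP[/andP[yz yp] _]].
exists x, y; split=> //; apply: (@reach_step _ _ (last y (z :: p))).
  apply: path_avoid; first by rewrite /= eyz pz.
  by rewrite !inE !negb_or xy xz xp.
rewrite /delete_edge /= ex eqxx (negPf xy) andbF andbT /=.
have : last z p \in z :: p := mem_last z p.
by apply: contraTneq => ->; rewrite inE negb_or yz yp.
Qed.

Section Trees.
Variable e : rel V.
Hypothesis te : is_tree e.

Lemma tree_neq v w : e v w -> v <> w.
Proof. by move=> evw vw; move: evw; rewrite vw (tree_irrefl te). Qed.

Lemma tree_bridge v w : e v w -> ~ reachable (delete_edge e v w) w v.
Proof.
move=> evw [p [pp lp]]; case/shortenP: pp lp => p' pp' up' _ lp'.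
apply: (tree_acyclic te (c := w :: p')).
- case: p' pp' up' lp' => [|x [|y p']] //=.
    by move=> _ _ wv; have := tree_neq evw; rewrite wv.
  by move=> /andP[/andP[_ +] _] _ xv; rewrite xv !eqxx orbT.
- apply/andP; split=> //; rewrite /= rcons_path lp' evw andbT.
  by apply: sub_path pp' => a b /andP[].
Qed.

Lemma tree_branch v u : u <> v ->
  exists w, e v w /\ reachable (delete_edge e v w) w u.
Proof.
move=> uv; have [p [pp lp]] := tree_connected te v u.
case/shortenP: pp lp => -[|w p'] pp' up' _ lp'; first by case: uv.
exists w; move: pp' => /= /andP[evw pp']; split=> //.
by rewrite -lp' /=; apply: path_avoid => //; case/andP: up'.
Qed.

(** Walks from [w'] to [u] avoid [v]. Reversed, they lead from [u] to [w'] without the edge [vw],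
    and the edge from [w'] to [v] would complete a bypass of it. *)
Lemma tree_branch_uniq v w w' u : e v w -> e v w' ->
  reachable (delete_edge e v w) w u -> reachable (delete_edge e v w') w' u -> w = w'.
Proof.
move=> evw evw' wu w'u; apply: contrapT => ww'.
suff h : reachable (delete_edge e v w) w u -> reachable (delete_edge e v w) w w'.
  apply: (tree_bridge evw); apply: (reach_step (h wu)).
  rewrite /delete_edge /= (tree_sym te) evw' /=.
  by move/eqP/negPf: (nesym ww') => ->; move/tree_neq/nesym/eqP/negPf: evw' => ->.
move: u w'u {wu}; apply: reach_ind => // a b w'a IH /andP[eab _] wb.
have [av|av] := EM (a = v); first by case: (tree_bridge evw'); rewrite -{2}av.
have [bv|bv] := EM (b = v); first by case: (tree_bridge evw); rewrite -{2}bv.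
apply: IH; apply: (reach_step wb).
by apply: delete_edge_off => //; rewrite (tree_sym te).
Qed.

(** [w] is the first step towards [v'] and [u] the first step back. Without the edge [vw], walks
    from [v] never reach [v'], so they stay on the side of [u]. *)
Lemma tree_first_edges v v' : v <> v' -> exists w u, [/\ e v w, e v' u &
  forall t, reachable (delete_edge e v w) v t -> reachable (delete_edge e v' u) u t].
Proof.
move=> vv'; have [w [evw wv']] := tree_branch (nesym vv').
have [u [eu uv]] := tree_branch vv'.
exists w, u; split=> //; apply: reach_ind => // a b va ua eab'; have /andP[eab _] := eab'.
have bridge x : reachable (delete_edge e v w) v x -> x <> v'.
  move=> vx xv'; apply: (tree_bridge evw); apply: (reach_trans wv').
  by rewrite -xv'; apply: reach_sym vx; apply/delete_edge_sym/(tree_sym te).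
apply: (reach_step ua); apply: delete_edge_off => //; first exact: bridge.
by move=> bv'; apply: (bridge b) => //; exact: reach_step va eab'.
Qed.

End Trees.
End Reachability.

(** * Torsos as quotients *)

Section Stars.
Variables (T : Type) (M : circuit_system T).
Local Notation Ci := (circuits M).
Local Notation E := (ground M).
Variables (V : eqType) (e : rel V) (R : V -> set T).
Local Notation side := (side e R).
Implicit Types (A B C D P Q S X Y Z : set T) (x y z : T) (u v w : V).

Hypothesis Mm : is_matroid M.
Hypothesis Mc : connected_matroid M.
Hypothesis M3 : `I_3 #<= E.

Definition parts v : set (set T) :=
  [set P | (exists2 x, R v x & P = [set x]) \/ (exists2 w, e v w & P = side v w)].

(** All that the analysis of one torso requires of the tree around [v]. *)
Record star v : Prop := Star {
  star_irrefl : ~ e v v;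
  star_node : R v `<=` E;
  star_side : forall w, e v w ->
    [/\ tsep M (side v w), side v w `<=` E & exists x y, [/\ side v w x, side v w y & x <> y]];
  star_cover : forall x, E x -> R v x \/ exists2 w, e v w & side v w x;
  star_disj : forall w x, e v w -> R v x -> ~ side v w x;
  star_uniq : forall w w' x, e v w -> e v w' -> side v w x -> side v w' x -> w = w' }.

Lemma other_element x : exists2 y, E y & x <> y.
Proof.
have [a [b [_ [Ea Eb _ [ab _ _]]]]] := (card_ge3P _).1 M3.
have [xa|] := EM (x = a); last by exists a.
by exists b => //; rewrite xa.
Qed.

Lemma tsep_singleton x : E x -> tsep M [set x].
Proof. by move=> Ex; have [y Ey xy] := other_element x; exact: tsep_set1 Ex Ey xy. Qed.

Section Star.
Variable v : V.
Hypothesis sv : star v.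

(* For x behind the edge vw the set on the right is [set v; w]; written in this
   way it requires no choice of w. *)
Definition torso_map x : T + set V :=
  if `[< R v x >] then inl x else inr [set u | u = v \/ e v u /\ side v u x].

Lemma torso_map_node x : R v x -> torso_map x = inl x.
Proof. by move=> Rx; rewrite /torso_map asboolT. Qed.

Lemma torso_map_side w x : e v w -> side v w x -> torso_map x = inr [set v; w].
Proof.
move=> evw Sx; rewrite /torso_map asboolF; last by move=> /(star_disj sv evw).
congr inr; apply/seteqP; split=> u /=.
  by move=> [->|[evu Su]]; [left|right; apply: (star_uniq sv evu evw Su Sx)].
by move=> [->|->]; [left|right].
Qed.

Lemma torso_map_nodeP x y : R v x -> torso_map y = torso_map x <-> y = x.
Proof.
move=> Rx; split=> [|-> //]; rewrite (torso_map_node Rx) /torso_map.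
by case: ifP => // _ [].
Qed.

Lemma torso_map_sideP w x y : e v w -> side v w x ->
  torso_map y = torso_map x <-> side v w y.
Proof.
move=> evw Sx; rewrite (torso_map_side evw Sx); split; last exact: torso_map_side.
rewrite /torso_map; case: ifP => // _ [vw].
have [wv|[]//] : [set u | u = v \/ e v u /\ side v u y] w by rewrite vw; right.
by case: (star_irrefl sv); rewrite -{2}wv.
Qed.

Lemma fib_node x : R v x -> fib torso_map (torso_map x) = [set x].
Proof. by move=> Rx; apply/seteqP; split=> y; rewrite /fib /= torso_map_nodeP. Qed.

Lemma fib_side w x : e v w -> side v w x -> fib torso_map (torso_map x) = side v w.
Proof.
by move=> evw Sx; apply/seteqP; split=> y; rewrite /fib /= (torso_map_sideP _ evw).
Qed.

Lemma tsep_torso_map x : E x -> tsep M (fib torso_map (torso_map x)).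
Proof.
move=> Ex; have [Rx|[w evw Sx]] := star_cover sv Ex.
  by rewrite fib_node //; exact: tsep_singleton.
by rewrite (fib_side evw Sx); case: (star_side sv evw).
Qed.

Lemma fibers_parts : fibers M torso_map = parts v.
Proof.
have setIE A : A `<=` E -> A `&` E = A by move=> /setIidPl.
apply/seteqP; split=> P.
- move=> [x Ex ->]; have [Rx|[w evw Sx]] := star_cover sv Ex.
    by left; exists x => //; rewrite fib_node // setIE // => _ ->.
  by right; exists w => //; rewrite (fib_side evw Sx) setIE //; case: (star_side sv evw).
- move=> [[x Rx ->]|[w evw ->]].
    have Ex := star_node sv Rx.
    by exists x => //; rewrite fib_node // setIE // => _ ->.
  have [_ SE [x [y [Sx _ _]]]] := star_side sv evw.
  by exists x; [exact: SE|rewrite (fib_side evw Sx) setIE].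
Qed.

Lemma torso_quotient : torso M e R v = quotient M torso_map.
Proof.
rewrite /torso /quotient; congr CircuitSystem.
- apply/seteqP; split=> i.
  + move=> [[x Rx <-]|[_ [w evw <-] <-]].
      by exists x; [exact: (star_node sv)|exact: torso_map_node].
    have [_ SE [x [y [Sx _ _]]]] := star_side sv evw.
    by exists x; [exact: SE|exact: torso_map_side].
  + move=> [x Ex <-]; have [Rx|[w evw Sx]] := star_cover sv Ex.
      by left; exists x => //; rewrite torso_map_node.
    by right; exists [set v; w]; [exists w|rewrite (torso_map_side evw Sx)].
- have img C : Ci C -> [set inl x | x in C `&` R v] `|`
      [set inr [set v; w] | w in [set w | e v w /\ C `&` side v w !=set0]] =
      torso_map @` C.
    move=> cC; apply/seteqP; split=> i.
    + move=> [[x [Cx Rx] <-]|[w [evw [x [Cx Sx]]] <-]].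
        by exists x => //; exact: torso_map_node.
      by exists x => //; exact: torso_map_side.
    + move=> [x Cx <-]; have [Rx|[w evw Sx]] := star_cover sv (circ_sub Mm cC Cx).
        by left; exists x => //; rewrite torso_map_node.
      by right; exists w; [split=> //; exists x|rewrite (torso_map_side evw Sx)].
  have nonf C : Ci C -> (forall w, e v w -> ~ C `<=` side v w) <-> nonfiber torso_map C.
    move=> cC; split=> [nS|[x [y [Cx Cy xy]]] w evw CS]; last first.
      by apply: xy; rewrite !(torso_map_side evw) //; exact: CS.
    have [x Cx] := circ_neq0 Mm cC; apply: contrapT => n.
    have allx y : C y -> torso_map y = torso_map x.
      by move=> Cy; apply: contrapT => yx; apply: n; exists y, x.
    have [Rx|[w evw Sx]] := star_cover sv (circ_sub Mm cC Cx); last first.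
      by apply: (nS _ evw) => y /allx; rewrite (torso_map_sideP _ evw).
    (* The torso discards only circuits inside a side. No circuit lies inside [{x}], as a circuit
       crossing [{x}] would properly contain it. *)
    have [[D cD [[y Dy yx] [z Dz zx]]] _] := tsep_singleton (circ_sub Mm cC Cx).
    have CD : C = D by apply: (circ_eq Mm) => // u /allx /(torso_map_nodeP _ Rx) ->; rewrite -yx.
    by apply: zx; apply/(torso_map_nodeP _ Rx)/allx; rewrite CD.
  apply/seteqP; split=> _ [C [cC nC] <-].
    by exists C; [split=> //; apply/nonf|rewrite img].
  by exists C; [split=> //; apply/nonf|rewrite img].
Qed.

Lemma torso_matroid : is_matroid (torso M e R v).
Proof. by rewrite torso_quotient; exact: (quotient_matroid Mm tsep_torso_map). Qed.

Lemma torso_ge3 : `I_3 #<= ground (torso M e R v) <->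
  exists P Q S, [/\ parts v P, parts v Q, parts v S & [/\ P <> Q, Q <> S & P <> S]].
Proof. by rewrite torso_quotient card3_quotient // fibers_parts. Qed.

Hypothesis N3 : `I_3 #<= ground (torso M e R v).

Lemma parts_partition : partition_of M (parts v).
Proof.
move: N3; rewrite torso_quotient -fibers_parts.
exact: (fibers_partition Mm tsep_torso_map).
Qed.

Lemma torso_circuit : is_circuit (torso M e R v) <-> circuit_type M (parts v).
Proof.
move: N3; rewrite torso_quotient -fibers_parts => N3'.
exact: (quotient_circuit Mm Mc tsep_torso_map).
Qed.

Lemma torso_cocircuit : is_cocircuit (torso M e R v) <-> cocircuit_type M (parts v).
Proof.
move: N3; rewrite torso_quotient -fibers_parts => N3'.
exact: (quotient_cocircuit Mm Mc tsep_torso_map).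
Qed.

Lemma torso_prime : n_connected 3 (torso M e R v) <-> prime_type M (parts v).
Proof.
move: N3; rewrite torso_quotient -fibers_parts => N3'.
exact: (quotient_prime Mm Mc tsep_torso_map).
Qed.

End Star.

Section TreeStars.
Hypothesis te : is_tree e.
Hypothesis RE : \bigcup_v R v = E.
Hypothesis Rdisj : trivIset setT R.
Hypothesis adh : uniform_adhesion M e R 2.

Lemma element_node_ex x : E x -> exists v, R v x.
Proof. by rewrite -RE => -[v _ Rx]; exists v. Qed.

Lemma node_sub v : R v `<=` E.
Proof. by move=> x Rx; rewrite -RE; exists v. Qed.

Lemma element_node v w x : R v x -> R w x -> v = w.
Proof. by move=> Rv Rw; apply: Rdisj => //; exists x. Qed.

Lemma side_sub v w : side v w `<=` E.
Proof. by move=> x [u _]; exact: node_sub. Qed.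

Lemma sideC v w x : e v w -> E x -> side v w x <-> ~ side w v x.
Proof.
move=> evw; have /(separation2P Mm)[[SE S0] _ _ _] := adh evw.
rewrite -SE => SSx; split=> [S1 S2|n]; last by case: SSx.
by have : (side w v `&` side v w) x by []; rewrite S0.
Qed.

Lemma tree_star v : star v.
Proof.
split.
- by rewrite (tree_irrefl te).
- exact: node_sub.
- move=> w evw; have evw' : e w v by rewrite (tree_sym te).
  have /(separation2P Mm)[_ tS S2 _] := adh evw'.
  by split=> //; exact: side_sub.
- move=> x /element_node_ex[u Ru]; have [<-|uv] := EM (u = v); [by left|right].
  by have [w [evw wu]] := tree_branch te uv; exists w => //; exists u.
- move=> w x evw Rv [u wu Ru]; apply: (tree_bridge te evw).
  by move: wu; rewrite -(element_node Rv Ru).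
- move=> w w' x evw evw' [u wu Ru] [u' w'u Ru'].
  by apply: (tree_branch_uniq te evw evw' wu); rewrite (element_node Ru Ru').
Qed.

End TreeStars.
End Stars.

(** * The tree of good separations *)

Section Nodes.
Variables (T : Type) (M : circuit_system T).
Local Notation Ci := (circuits M).
Local Notation E := (ground M).
Local Notation tsep := (tsep M).
Local Notation good := (good M).
Implicit Types (A B C D P Q S X Y Z : set T) (x y z : T) (s t : set (set T)).

Hypothesis Mm : is_matroid M.
Hypothesis Mc : connected_matroid M.
Hypothesis M3 : `I_3 #<= E.

Record node s : Prop := Node {
  node_part : partition_of M s;
  node_good : s `<=` good;
  node_split : forall X, good X -> exists2 P, s P & X `<=` P \/ E `\` X `<=` P }.

Lemma good_pt X : good X -> exists2 x, E x & X x.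
Proof. by move=> [tX _ _]; case: (tsep_meets Mm tX). Qed.

Lemma good_npt X : good X -> exists2 x, E x & ~ X x.
Proof. by move=> [tX _ _]; case: (tsep_meets Mm tX). Qed.

Lemma good_sub X : good X -> X `<=` E.
Proof. by case. Qed.

Lemma good_set1 x : E x -> good [set x].
Proof.
move=> Ex; split; first exact: tsep_singleton.
  by move=> _ ->.
by move=> Y _ [[a [_ -> Ya]] [b [_ -> nYb]] _ _].
Qed.

Lemma node_disj s P Q x : node s -> s P -> s Q -> P x -> Q x -> P = Q.
Proof. by move=> [[_ _ d _] _ _]; exact: d. Qed.

Lemma node_third s P Q : node s -> s P -> s Q ->
  exists S, [/\ s S, S <> P & S <> Q].
Proof. by move=> ns; exact: (third_part (node_part ns)). Qed.

Lemma node_outside s P Q : node s -> s P -> s Q ->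
  exists x, [/\ E x, ~ P x & ~ Q x].
Proof.
move=> ns sP sQ; have [S [sS SP SQ]] := node_third ns sP sQ.
have [x Ex Sx] := good_pt (node_good ns sS); exists x; split=> // Hx.
  by apply: SP; exact: node_disj ns sS sP Sx Hx.
by apply: SQ; exact: node_disj ns sS sQ Sx Hx.
Qed.

Lemma node_subset s P Q : node s -> s P -> s Q -> P `<=` Q -> P = Q.
Proof.
move=> ns sP sQ PQ; have [x _ Px] := good_pt (node_good ns sP).
by apply: node_disj ns sP sQ Px (PQ _ Px).
Qed.

(** Another part [Q] of [s] lies in a part [P'] of [t] other than [P], since its complement contains
    [P] properly and does not fit into a part of [t]. Likewise [P'] lies in a part of [s], which can
    only be [Q]. *)
Lemma node_uniq s t P : node s -> node t -> s P -> t P -> s = t.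
Proof.
suff h : forall s t, node s -> node t -> s P -> t P -> s `<=` t.
  by move=> ns nt sP tP; apply/seteqP; split; apply: h.
move=> {}s {}t ns nt sP tP Q sQ.
have [QP|QP] := EM (Q = P); first by rewrite QP.
have notPQ Y : E `\` Q `<=` Y -> P `<=` Y.
  move=> QY x Px; apply: QY; split; first exact: (good_sub (node_good ns sP)).
  by move=> Qx; apply: QP; exact: node_disj ns sQ sP Qx Px.
have [P' tP' [QP'|QP']] := node_split nt (node_good ns sQ); last first.
  have PP' := node_subset nt tP tP' (notPQ _ QP').
  have [x [Ex Px Qx]] := node_outside ns sP sQ.
  by case: Px; rewrite PP'; apply: QP'.
have P'P : P' <> P.
  move=> P'P; apply: QP; apply: (node_subset ns) => //.
  by rewrite -P'P.
have [Q' sQ' [PQ'|PQ']] := node_split ns (node_good nt tP').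
  by have QQ' := node_subset ns sQ sQ' (subset_trans QP' PQ'); rewrite (_ : Q = P') //;
    apply/seteqP; split=> //; rewrite QQ'.
have [x [Ex Px P'x]] := node_outside nt tP tP'.
have PQ'sub : P `<=` Q'.
  move=> z Pz; apply: PQ'; split; first exact: (good_sub (node_good ns sP)).
  by move=> P'z; apply: P'P; exact: node_disj nt tP' tP P'z Pz.
have PeQ' := node_subset ns sP sQ' PQ'sub.
by case: Px; rewrite PeQ'; apply: PQ'.
Qed.

(** The other parts are the maximal good sets properly inside [E \ X]. [good_max] with a point of
    [X] provides them, nestedness makes them disjoint, and singletons, proper because of the two
    points outside [X], ensure that they cover. None is all of [E \ X], so there are at least
    two. *)
Lemma node_ex X : good X -> (exists x y, [/\ E x, E y, x <> y & ~ X x /\ ~ X y]) ->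
  exists2 s, node s & s X.
Proof.
move=> gX [a [b [Ea Eb ab [Xa Xb]]]].
have [x0 Ex0 Xx0] := good_pt gX.
pose inside Q := [/\ good Q, Q `<=` E `\` X & Q <> E `\` X].
pose part Q := inside Q /\ forall Z, inside Z -> Q `<=` Z -> Z = Q.
have ext Q : inside Q -> exists2 P, part P & Q `<=` P.
  move=> iQ; have [gQ QX QX'] := iQ.
  have [||P [gP _ [QP iP] Pmax]] :=
      @good_max _ _ Mm Mc x0 Ex0 (fun Z => Q `<=` Z /\ inside Z) Q gQ.
  - by move=> /QX[].
  - by split.
  exists P => //; split=> // Z iZ PZ; have [gZ ZX _] := iZ.
  apply: contrapT => ZP; apply: (Pmax Z gZ).
  - by move=> /ZX[].
  - by split=> //; exact: subset_trans PZ.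
  - by split=> // ZP'; apply: ZP; apply/seteqP.
have point z : E z -> ~ X z -> exists2 P, part P & P z.
  move=> Ez Xz; have [|P pP zP] := ext [set z]; last by exists P => //; exact: zP.
  split; [exact: good_set1|by move=> _ ->|] => zX.
  have inz w : E w -> ~ X w -> w = z.
    by move=> Ew Xw; have : (E `\` X) w by []; rewrite -zX.
  by apply: ab; rewrite (inz a) // (inz b).
have [P pP Pa] := point _ Ea Xa.
have [c [Ec Xc Pc]] : exists c, [/\ E c, ~ X c & ~ P c].
  apply: contrapT => n; case: pP => -[_ PX PX'] _; apply: PX'; apply/seteqP.
  by split=> // x [Ex Xx]; apply: contrapT => Px; apply: n; exists x.
have [Q pQ Qc] := point _ Ec Xc.
have pdisj A B z : part A -> part B -> A z -> B z -> A = B.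
  move=> [iA mA] [iB mB] Az Bz; have [gA AX _] := iA; have [gB BX _] := iB.
  have [tB _ _] := gB.
  have [AB|AB|BA|AB] := good_nested gA tB.
  - by apply/esym/mA => // w Aw; apply: AB => //; exact: good_sub gA _ _.
  - by case: (AB z) => //; exact: good_sub gA _ _.
  - by apply: mB => // w Bw; apply: BA => //; exact: good_sub gB _ _.
  - by case: (AB _ Ex0) => [/AX[]|/BX[]].
have pX A : part A -> A `<=` E `\` X by move=> [[]].
exists [set A | A = X \/ part A]; last by left.
split.
- split.
  + by move=> A [->|[[gA _ _] _]]; [case: gX|case: gA].
  + move=> x Ex; have [Xx|Xx] := EM (X x); first by exists X => //; left.
    by have [A pA Ax] := point _ Ex Xx; exists A => //; right.
  + move=> A B z [->|pA] [->|pB] Az Bz //; last exact: pdisj pA pB Az Bz.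
      by case: (pX _ pB _ Bz).
    by case: (pX _ pA _ Az).
  + exists X, P, Q; split; [by left|by right|by right|split].
    * by move=> XP; apply: Xa; rewrite XP.
    * by move=> PQ; apply: Pc; rewrite PQ.
    * by move=> XQ; apply: Xc; rewrite XQ.
- by move=> A [->//|[[]]].
- have covers Z : good Z -> Z `<=` E `\` X -> Z <> E `\` X ->
      exists2 P, part P & Z `<=` P by move=> gZ ZX ZX'; apply: ext.
  move=> Y gY; have [tY _ _] := gY.
  have [XY|XY|YX|XY] := good_nested gX tY.
  + have [YX|YX] := EM (E `\` Y = E `\` X).
      exists X; first by left.
      left; rewrite -(setDKE (good_sub gY)) YX (setDKE (good_sub gX)) //.
    have [|A pA YA] := covers _ (goodD Mm gY) _ YX.
      by move=> x [Ex nYx]; split=> // /(XY _ Ex).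
    by exists A; [right|right].
  + have [YX|YX] := EM (Y = E `\` X).
      by exists X; [left|right; rewrite YX (setDKE (good_sub gX))].
    have [|A pA YA] := covers _ gY _ YX.
      by move=> x Yx; have Ex := good_sub gY Yx; split=> // /(XY _ Ex).
    by exists A; [right|left].
  + exists X; first by left.
    by left=> x Yx; apply: YX => //; exact: good_sub gY _ _.
  + exists X; first by left.
    by right=> x [Ex Yx]; case: (XY _ Ex).
Qed.

Definition nodeT := {s : set (set T) | `[< node s >]}.
Local Notation V := nodeT.

Lemma nodeV (v : V) : node (val v).
Proof. exact/asboolP/(valP v). Qed.

Definition node_adj : rel V :=
  fun v w => `[< exists2 P, val v P & val w (E `\` P) >].

Definition node_elements (v : V) : set T := [set x | val v [set x]].

Local Notation e := node_adj.
Local Notation R := node_elements.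
Local Notation side := (side e R).

Lemma nodeV_uniq (v w : V) P : val v P -> val w P -> v = w.
Proof. by move=> vP wP; apply/val_inj/(node_uniq (nodeV v) (nodeV w) vP wP). Qed.

Lemma nodeV_ex X : good X -> (exists x y, [/\ E x, E y, x <> y & ~ X x /\ ~ X y]) ->
  exists v : V, val v X.
Proof.
move=> gX X2; have [s ns sX] := node_ex gX X2.
by exists (exist _ s (introT (asboolP _) ns)).
Qed.

Lemma goodV (v : V) P : val v P -> good P.
Proof. exact: node_good (nodeV v) _. Qed.

Lemma two_outside (v : V) P : val v P ->
  exists x y, [/\ E x, E y, x <> y & ~ P x /\ ~ P y].
Proof.
move=> vP; have [Q [vQ QP _]] := node_third (nodeV v) vP vP.
have [S [vS SP SQ]] := node_third (nodeV v) vP vQ.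
have [x Ex Qx] := good_pt (goodV vQ); have [y Ey Sy] := good_pt (goodV vS).
exists x, y; split=> //.
  by move=> xy; apply: SQ; apply: (node_disj (nodeV v) vS vQ Sy); rewrite -xy.
split=> Px; [apply: QP|apply: SP].
  exact: (node_disj (nodeV v) vQ vP Qx Px).
exact: (node_disj (nodeV v) vS vP Sy Px).
Qed.

Lemma node_adj_sym : symmetric e.
Proof.
move=> v w; apply/asboolP/asboolP => -[P vP wP]; exists (E `\` P) => //;
  by rewrite setDKE //; exact: good_sub (goodV vP).
Qed.

(* The node v lies on the same side as P of the separation (P, E \ P). *)
Definition onside P (v : V) := exists2 Q, val v Q & E `\` P `<=` Q.

Lemma onside_or P (v : V) : good P -> onside P v \/ onside (E `\` P) v.
Proof.
move=> gP; have [Q vQ [PQ|PQ]] := node_split (nodeV v) gP; [right|left]; exists Q => //.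
by rewrite setDKE //; exact: good_sub.
Qed.

Lemma onside_not P (v : V) : good P -> onside P v -> ~ onside (E `\` P) v.
Proof.
move=> gP [Q vQ PQ] [Q' vQ']; rewrite setDKE; last exact: good_sub.
move=> PQ'; have [x [Ex Qx Q'x]] := node_outside (nodeV v) vQ vQ'.
by have [/PQ'//|Px] := EM (P x); apply: Qx; apply: PQ.
Qed.

Section Edge.
Variables (s t : V) (P : set T).
Hypotheses (sP : val s P) (tP : val t (E `\` P)).

Let gP : good P. Proof. exact: goodV sP. Qed.

Let DP : E `\` (E `\` P) = P.
Proof. by rewrite setDKE //; exact: good_sub gP. Qed.

(** Changing sides means passing from a part of [a] that contains [E \ P] to a part of [b] that
    contains [P]. Being complementary, these are [E \ P] and [P], and the edge is the deleted
    one. *)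
Lemma onside_step (a b : V) : onside P a -> delete_edge e s t a b -> onside P b.
Proof.
move=> [A aA PA] /andP[/asboolP[Q aQ bQ] nst].
have [QA|QA] := EM (Q = A); last first.
  exists (E `\` Q) => // x PEx; split; first by case: PEx.
  by move=> Qx; apply: QA; apply: (node_disj (nodeV a) aQ aA Qx); exact: PA.
rewrite -{}QA in PA.
have [QP|QP] := EM (Q = E `\` P).
  have at_ : a = t by apply: (nodeV_uniq (P := Q)) => //; rewrite QP.
  have bs : b = s by apply: (nodeV_uniq (P := P)) => //; rewrite -DP -QP.
  by move: nst; rewrite at_ bs !eqxx orbT.
have [//|[B bB]] := onside_or b gP; rewrite DP => PB.
have QP' : E `\` Q `<=` P.
  by move=> x [Ex Qx]; apply: contrapT => Px; apply: Qx; apply: PA.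
have BQ : E `\` Q = B by apply: (node_subset (nodeV b)) => //; exact: subset_trans PB.
case: QP; have EQP : E `\` Q = P by apply/seteqP; split=> //; rewrite BQ.
by rewrite -EQP setDKE //; exact: good_sub (goodV aQ).
Qed.

Lemma onside_reach (a b : V) : onside P a -> reachable (delete_edge e s t) a b ->
  onside P b.
Proof. by move=> aP; move: b; apply: reach_ind => // x y _; exact: onside_step. Qed.

End Edge.

Lemma reach_onside (s t u : V) P : val s P -> val t (E `\` P) ->
  reachable (delete_edge e s t) t u -> onside P u.
Proof. by move=> sP tP; apply: (onside_reach sP tP); exists (E `\` P). Qed.

Lemma reach_offside (s t u : V) P : val s P -> val t (E `\` P) ->
  reachable (delete_edge e s t) s u -> onside (E `\` P) u.
Proof.
move=> sP tP su; apply: (@reach_onside t s); rewrite -1?delete_edgeC //.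
by rewrite setDKE //; exact: good_sub (goodV sP).
Qed.

(** Otherwise every part of [s] would lie in a part of [t]; comparison in the other direction then
    gives a common part, so [s = t]. *)
Lemma toward (s t : V) : s <> t -> exists2 P, val s P & onside P t.
Proof.
move=> st; apply: contrapT => n.
have sub P : val s P -> exists2 Q, val t Q & P `<=` Q.
  move=> sP; have [tP|[Q tQ]] := onside_or t (goodV sP).
    by case: n; exists P.
  by rewrite setDKE; [exists Q|exact: good_sub (goodV sP)].
have [P sP _] : exists2 P, val s P & True.
  by have [[_ _ _ [P [_ [_ [sP _ _ _]]]]] _ _] := nodeV s; exists P.
have [Q tQ PQ] := sub _ sP.
have [P' sP' [QP'|QP']] := node_split (nodeV s) (goodV tQ); last first.
  apply: n; exists P' => //; exists Q => // x [Ex P'x].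
  by apply: contrapT => Qx; apply: P'x; apply: QP'.
have PP' := node_subset (nodeV s) sP sP' (subset_trans PQ QP').
apply: st; apply: (nodeV_uniq (P := P)) => //.
suff -> : P = Q by [].
by apply/seteqP; split=> //; rewrite PP'.
Qed.

(** On the way towards [t] the set left behind increases strictly but stays inside a fixed part [Q]
    of [t], so [good_ind] applies with a point outside [Q]. *)
Lemma node_adj_connected (s t : V) : reachable e s t.
Proof.
have step (u : V) P : u <> t -> val u P -> onside P t -> exists2 u' : V, val u' (E `\` P) & e u u'.
  move=> ut uP [Q tQ PQ].
  have [|u' u'P] := nodeV_ex (goodD Mm (goodV uP)).
    have [x [y [Ex Ey xy [Qx Qy]]]] := two_outside tQ.
    by exists x, y; split=> //; split=> [/PQ|/PQ].
  by exists u' => //; apply/asboolP; exists P.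
have climb Q y : val t Q -> E y -> ~ Q y -> forall X, good X -> ~ X y ->
    X `<=` Q -> forall u : V, val u X -> reachable e u t.
  move=> tQ Ey Qy; apply: (good_ind Mm Mc Ey) => X gX Xy IH XQ u uX.
  have [->|ut] := EM (u = t); first exact: reach_refl.
  have [P uP tP] := toward ut; have [Q' tQ' PQ'] := tP.
  have XP : X <> P.
    move=> XP; have [x [Ex Qx Q'x]] := node_outside (nodeV t) tQ tQ'.
    by have [/XQ//|Xx] := EM (X x); apply: Q'x; apply: PQ'; split=> //; rewrite -XP.
  have XDP : X `<=` E `\` P.
    move=> x Xx; split; first exact: good_sub gX _ _.
    by move=> Px; apply: XP; exact: (node_disj (nodeV u) uX uP Xx Px).
  have QQ' : Q' = Q.
    have [x _ Xx] := good_pt gX.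
    by apply: (node_disj (nodeV t) tQ' tQ (x := x)); [apply/PQ'/XDP|exact: XQ].
  rewrite {}QQ' in PQ'.
  have [u' u'P euu'] := step _ _ ut uP tP.
  apply: (reach_cons euu'); apply: (IH (E `\` P)) => //.
  - exact: goodD (goodV uP).
  - by move=> /PQ'.
  - split=> // PX; have [x [Ex Xx Px]] := node_outside (nodeV u) uX uP.
    by apply: Xx; apply: PX.
have [->|st] := EM (s = t); first exact: reach_refl.
have [P sP tP] := toward st; have [Q tQ PQ] := tP.
have [s' s'P ess'] := step _ _ st sP tP.
have [y Ey Qy] := good_npt (goodV tQ).
apply: (reach_cons ess'); apply: (climb Q y tQ Ey Qy) s'P => //.
- exact: goodD (goodV sP).
- by move=> /PQ.
Qed.

Lemma node_adj_tree : is_tree e.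
Proof.
split.
- exact: node_adj_sym.
- move=> v; apply/negbTE/negP => /asboolP[P vP vP'].
  have [x [Ex Px Px']] := node_outside (nodeV v) vP vP'.
  by apply: Px'.
- have [x [y [z [Ex Ey Ez [xy yz xz]]]]] := (card_ge3P _).1 M3.
  have [|v _] := nodeV_ex (good_set1 Ex); last by exists v.
  by exists y, z; split=> //; split=> [yx|zx]; [apply: xy|apply: xz].
- exact: node_adj_connected.
- move=> c c2 cc; have [v [w [/asboolP[P vP wP] wv]]] := reach_cycle c2 cc.
  apply: (onside_not (goodV vP) (reach_onside vP wP wv)).
  by exists P => //; rewrite setDKE //; exact: good_sub (goodV vP).
Qed.

Lemma node_elements_ex x : E x -> exists v : V, R v x.
Proof.
move=> Ex; have [a [b [c [Ea Eb Ec [ab bc ac]]]]] := (card_ge3P _).1 M3.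
have [|v vx] := nodeV_ex (good_set1 Ex); last by exists v.
have [xa|xa] := EM (a = x).
  by exists b, c; split=> //; split=> [bx|cx]; [apply: ab|apply: ac]; rewrite xa -1?bx -1?cx.
have [xb|xb] := EM (b = x).
  by exists a, c; split=> //; split=> // cx; apply: bc; rewrite xb -cx.
by exists a, b.
Qed.

Lemma node_elements_sub (v : V) : R v `<=` E.
Proof. by move=> x vx; apply: (good_sub (goodV vx)). Qed.

Lemma node_elements_cover : \bigcup_v R v = E.
Proof.
apply/seteqP; split=> x; first by move=> [v _ /node_elements_sub].
by move=> /node_elements_ex[v vx]; exists v.
Qed.

Lemma node_elements_triv : trivIset setT R.
Proof. by move=> v w _ _ [x [vx wx]]; exact: nodeV_uniq vx wx. Qed.

(** [x] sits at the node with the part [{x}]. If that node were on the wrong side, [{x}] would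
    contain a whole side of the separation, but both sides have at least two elements. *)
Lemma node_side (s t : V) P : val s P -> val t (E `\` P) -> side s t = P.
Proof.
move=> sP tP; have gP := goodV sP; have DP := setDKE (good_sub gP).
apply/seteqP; split=> x.
- move=> [u /(reach_onside sP tP)[Q uQ PQ] ux].
  apply: contrapT => Px; have Ex := node_elements_sub ux.
  have Qx : Q = [set x] by apply: (node_disj (nodeV u) uQ ux (x := x)) => //; exact: PQ.
  have [y [z [Ey Ez yz [Py Pz]]]] := two_outside sP; rewrite Qx in PQ.
  by apply: yz; rewrite (PQ y) // (PQ z).
- move=> Px; have Ex := good_sub gP Px.
  have [u ux] := node_elements_ex Ex; exists u => //.
  have [su|//] := reach_two_ends t (node_adj_connected s u).
  have [Q uQ] := reach_offside sP tP su; rewrite DP => PQ.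
  have Qx : Q = [set x] by apply: (node_disj (nodeV u) uQ ux (x := x)) => //; exact: PQ.
  have [y [z [Ey Ez yz [Py Pz]]]] := two_outside tP; rewrite Qx in PQ.
  have inP w : E w -> ~ (E `\` P) w -> w = x.
    by move=> Ew Pw; apply: PQ; apply: contrapT => nPw; apply: Pw.
  by case: yz; rewrite (inP y) // (inP z).
Qed.

Lemma node_adhesion : uniform_adhesion M e R 2.
Proof.
move=> v w /asboolP[P vP wP]; have PE := good_sub (goodV vP).
rewrite (node_side vP wP) (node_side wP); last by rewrite setDKE.
apply/(separation2P Mm); split.
- split; last by apply/seteqP; split=> // x [[]].
  apply/seteqP; split=> x; first by case=> [[]//|/PE].
  by move=> Ex; have [Px|Px] := EM (P x); [right|left].
- by case: (goodV wP).
- by have [x [y [Ex Ey xy [Px Py]]]] := two_outside vP; exists x, y.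
- have [x [y [Ex Ey xy [Px Py]]]] := two_outside wP; exists x, y; split=> //.
    by apply: contrapT => nP; apply: Px.
  by apply: contrapT => nP; apply: Py.
Qed.

Lemma node_star v : star M e R v.
Proof.
apply: tree_star => //; [exact: node_adj_tree|exact: node_elements_cover|
  exact: node_elements_triv|exact: node_adhesion].
Qed.

Lemma node_parts v : parts e R v = val v.
Proof.
apply/seteqP; split=> P.
- move=> [[x vx ->] //|[w /asboolP[Q vQ wQ] ->]].
  by rewrite (node_side vQ wQ).
- move=> vP; have gP := goodV vP.
  have [[x [y [Px Py xy]]]|one] := EM (exists x y, [/\ P x, P y & x <> y]).
    have [|w wP] := nodeV_ex (goodD Mm gP).
      exists x, y; have [Ex Ey] := (good_sub gP Px, good_sub gP Py).
      by split=> //; split=> -[].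
    by right; exists w; [apply/asboolP; exists P|rewrite (node_side vP wP)].
  have [x Ex Px] := good_pt gP; left.
  have Pe : P = [set x].
    apply/seteqP; split=> [y Py|_ -> //].
    by apply: contrapT => yx; apply: one; exists y, x.
  by exists x => //; rewrite /node_elements /= -Pe.
Qed.

Lemma node_torso3 v : `I_3 #<= ground (torso M e R v).
Proof.
apply/(torso_ge3 Mm Mc M3 (node_star v)); rewrite node_parts.
by have [[_ _ _ ?] _ _] := nodeV v.
Qed.

Lemma node_decomposition : canonical_decomposition M e R.
Proof.
have types v := torso_circuit Mm Mc M3 (node_star v) (node_torso3 v).
have cotypes v := torso_cocircuit Mm Mc M3 (node_star v) (node_torso3 v).
have primes v := torso_prime Mm Mc M3 (node_star v) (node_torso3 v).
split.
- split; [exact: node_adj_tree|exact: node_elements_cover|exact: node_elements_triv|].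
  by move=> v w evw; exists 2%N; exact: node_adhesion.
- exact: node_adhesion.
- split; first exact: node_torso3.
  (* Two circuits or two cocircuits at the ends of an edge would produce a separation crossing the
     good set [P]. *)
  move=> v w /asboolP[P vP wP]; have [_ _ nP] := goodV vP.
  have [pv pw] := (node_part (nodeV v), node_part (nodeV w)).
  split=> -[].
  + move=> /types + /types; rewrite !node_parts => cv cw.
    have [Z tZ] := adjacent_circuit Mm Mc pv pw vP wP erefl cv cw.
    exact: nP.
  + move=> /cotypes + /cotypes; rewrite !node_parts => cv cw.
    have [Z tZ] := adjacent_cocircuit Mm Mc pv pw vP wP erefl cv cw.
    exact: nP.
- move=> v; rewrite primes types cotypes node_parts.
  have nv := nodeV v.
  exact: (node_trichotomy Mm Mc (node_part nv) (node_good nv) (node_split nv)).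
Qed.

End Nodes.

(** * Uniqueness *)

Lemma inj_surj_bijective (A B : Type) (f : A -> B) :
  injective f -> (forall b, exists a, f a = b) -> bijective f.
Proof. by move=> finj /choice[g gK]; exists g => // a; apply: finj; rewrite gK. Qed.

Section Uniqueness.
Variables (T : Type) (M : circuit_system T).
Local Notation Ci := (circuits M).
Local Notation E := (ground M).
Local Notation tsep := (tsep M).
Local Notation good := (good M).
Local Notation crossing := (crossing M).
Implicit Types (A B C D P Q S X Y Z : set T) (x y z : T).

Hypothesis Mm : is_matroid M.
Hypothesis Mc : connected_matroid M.
Hypothesis M3 : `I_3 #<= E.

Let join := join Mc.

Lemma crossing_setD P Z : crossing P Z -> crossing (E `\` P) Z.
Proof.
move=> [[a [Ea Pa Za]] [b [Eb Pb Zb]] [c [Ec Pc Zc]] [d [Ed Pd Zd]]].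
by split; [exists c|exists d|exists a; split=> // -[]|exists b; split=> // -[]].
Qed.

(** In the series case a circuit between the two corners in [P] also leaves [P], which makes three
    corners. *)
Lemma ser4_par4 P P' Z : crossing P Z -> (forall x, E x -> P' x <-> ~ P x) ->
  ser4 M P Z -> ~ par4 M P' Z.
Proof.
move=> [[a [Ea Pa Za]] [b [Eb Pb Zb]] _ _] PP' sPZ pPZ.
have [C [cC Ca Cb]] := join Ea Eb Za Zb.
have CZ : crosses C Z by split; [exists a|exists b].
have [|_ _ [c [Cc Pc Zc]] _] := sPZ _ cC; first by right.
have [Pa' Pb' Pc'] := And3 (PP' _ Ea) (PP' _ Eb) (PP' _ (circ_sub Mm cC Cc)).
by case: (par4_three pPZ cC Ca Cb Cc); rewrite quadE => -[]; tauto.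
Qed.

Variables (V : eqType) (e : rel V) (R : V -> set T).
Hypothesis can : canonical_decomposition M e R.

Local Notation side := (side e R).
Local Notation parts := (parts e R).

Let te : is_tree e. Proof. by case: can => -[]. Qed.

Let RE : \bigcup_v R v = E. Proof. by case: can => -[]. Qed.

Let adh : uniform_adhesion M e R 2. Proof. by case: can. Qed.

Let star_ v : star M e R v.
Proof. by apply: tree_star => //; case: can => -[]. Qed.

Let N3 v : `I_3 #<= ground (torso M e R v).
Proof. by case: can => _ _ [+ _] _; exact. Qed.

Let ptn v : partition_of M (parts v).
Proof. exact: (parts_partition Mm Mc M3 (star_ v) (N3 v)). Qed.

Let types v : prime_type M (parts v) \/ circuit_type M (parts v) \/
  cocircuit_type M (parts v).
Proof.
rewrite -(torso_prime Mm Mc M3 (star_ v) (N3 v)).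
rewrite -(torso_circuit Mm Mc M3 (star_ v) (N3 v)).
by rewrite -(torso_cocircuit Mm Mc M3 (star_ v) (N3 v)); case: can => _ _ _; exact.
Qed.

Let sideD v w : e v w -> side w v = E `\` side v w.
Proof.
move=> evw; have evw' : e w v by rewrite (tree_sym te).
apply/seteqP; split=> x.
  by move=> Sx; have Ex := side_sub RE Sx; split=> //; apply/(sideC Mm adh evw' Ex).
by move=> [Ex Sx]; apply/(sideC Mm adh evw' Ex).
Qed.

Let side_parts v w : e v w -> parts v (side v w).
Proof. by move=> evw; right; exists w. Qed.

(* A 2-separation crossing an edge separation would force both torsos to be
   circuits, or both to be cocircuits. *)
Lemma side_good v w : e v w -> good (side v w).
Proof.
move=> evw; have evw' : e w v by rewrite (tree_sym te).
have [tP PE _] := star_side (star_ v) evw.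
split=> // Z tZ PZ; have P'Z := crossing_setD PZ.
have inv : ~ (circuit_type M (parts v) /\ circuit_type M (parts w)) /\
  ~ (cocircuit_type M (parts v) /\ cocircuit_type M (parts w)).
  rewrite -!(torso_circuit Mm Mc M3 (star_ _) (N3 _)).
  by rewrite -!(torso_cocircuit Mm Mc M3 (star_ _) (N3 _)); case: can => _ _ [_ +] _; exact.
have P'p := side_parts evw'; rewrite (sideD evw) in P'p.
have tP' : tsep (E `\` side v w) by have [/(_ _ P'p)[]] := ptn w.
have DP x : E x -> (E `\` side v w) x <-> ~ side v w x by move=> Ex; split=> [[]|].
have DP' x : E x -> side v w x <-> ~ (E `\` side v w) x.
  move=> Ex; split=> [Sx [_ nSx] //|n]; apply: contrapT => Sx.
  by apply: n; split.
have [sr|pr] := ser_or_par Mm Mc tP tZ PZ; have [sr'|pr'] := ser_or_par Mm Mc tP' tZ P'Z.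
- apply: inv.1; split.
    exact: (crossed_ser Mm Mc (ptn v) (side_parts evw) tZ PZ sr (types v)).
  exact: (crossed_ser Mm Mc (ptn w) P'p tZ P'Z sr' (types w)).
- exact: (ser4_par4 PZ DP sr pr').
- exact: (ser4_par4 P'Z DP' sr' pr).
- apply: inv.2; split.
    exact: (crossed_par Mm Mc (ptn v) (side_parts evw) tZ PZ pr (types v)).
  exact: (crossed_par Mm Mc (ptn w) P'p tZ P'Z pr' (types w)).
Qed.

Lemma parts_good v : parts v `<=` good.
Proof.
move=> P [[x Rx ->]|[w evw ->]]; last exact: side_good.
by apply: good_set1 => //; rewrite -RE; exists v.
Qed.

(** If [X] cuts a part, nestedness suffices. Otherwise let [P] be a part inside [X] and [Q] one
    outside. In the circuit and cocircuit cases [P ∪ Q] is separated, in series or in parallel, and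
    would cross [X] if the claim failed; prime type applies to [X] itself. *)
Lemma parts_split v X : good X -> exists2 P, parts v P & X `<=` P \/ E `\` X `<=` P.
Proof.
move=> gX; have [tX XE nX] := gX; have [pt pc pd _] := ptn v.
have [uX|/existsNP[P /not_implyP[vP nPX]]] := EM (union_of (parts v) X); last first.
  exists P => //; apply: contrapT => n.
  have [PX|PX|XP|PX] := good_nested (parts_good vP) tX; have [_ PE] := pt _ vP.
  - by apply: nPX; left=> x Px; apply: PX => //; exact: PE.
  - by apply: nPX; right=> x Px; apply: PX => //; exact: PE.
  - by apply: n; left=> x Xx; apply: XP => //; exact: XE.
  - by apply: n; right=> x [Ex Xx]; case: (PX _ Ex).
apply: contrapT => n.
have nP P : parts v P -> ~ X `<=` P /\ ~ E `\` X `<=` P.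
  by move=> vP; split=> h; apply: n; exists P => //; [left|right].
have [[a Ea Xa] [b Eb Xb]] := tsep_meets Mm tX.
have [P vP Pa] := pc _ Ea; have [Q vQ Qb] := pc _ Eb.
have PX := part_in_union uX vP Pa Xa.
have QX := part_in_union (union_ofC uX) vQ Qb Xb.
have [a2 Xa2 Pa2] : exists2 x, X x & ~ P x.
  apply: contrapT => m; apply: (nP _ vP).1 => x Xx; apply: contrapT => Px.
  by apply: m; exists x.
have [b2 [Eb2 Xb2] Qb2] : exists2 x, (E `\` X) x & ~ Q x.
  apply: contrapT => m; apply: (nP _ vQ).2 => x Xx; apply: contrapT => Qx.
  by apply: m; exists x.
have Ea2 := XE _ Xa2.
have PQ x : P x -> ~ Q x by move=> /PX Xx /QX; apply.
suff tPQ : tsep (P `|` Q).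
  apply: (nX _ tPQ); split.
  - by exists a; split=> //; left.
  - by exists a2; split=> // -[//|/QX]; apply.
  - by exists b; split=> //; right.
  - by exists b2; split=> // -[/PX|].
have [[tP _] [tQ _]] := (pt _ vP, pt _ vQ).
have out : exists2 x, E x & ~ P x /\ ~ Q x.
  by exists a2 => //; split=> // /QX; apply.
have PneQ : P <> Q by move=> PQ'; apply: (PQ a) => //; rewrite -PQ'.
have [pr|[ct|ct]] := types v.
- have notpart A : parts v A -> ~ (forall x, E x -> X x <-> A x) /\
      ~ (forall x, E x -> (~` X) x <-> A x).
    move=> vA; have [n1 n2] := nP _ vA; split=> h.
      by apply: n1 => x Xx; apply/h => //; exact: XE.
    by apply: n2 => x [Ex Xx]; apply/h.
  by have [[A vA hA]|[A vA hA]] := pr _ tX uX; [case: (notpart _ vA).1|case: (notpart _ vA).2].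
- apply: serU => // C cC.
  split=> -[[x Cx Px] [y Cy Py]].
    have [z Cz Qz] := ct _ cC (nonwithin_two (ptn v) vP Cx Cy Px Py) _ vQ.
    by split; [exists z|exists x => //; exact: PQ].
  have [z Cz Pz] := ct _ cC (nonwithin_two (ptn v) vQ Cx Cy Px Py) _ vP.
  by split; [exists z|exists x => // /PQ].
- have [C [cC CPQ CP CQ]] := ct _ _ vP vQ PneQ.
  exact: (parU Mm Mc tP tQ PQ cC CPQ CP CQ out).
Qed.

Lemma parts_node v : node M (parts v).
Proof. by split; [exact: ptn|exact: parts_good|move=> X; exact: parts_split]. Qed.

Lemma parts_two v P x y : parts v P -> P x -> P y -> x <> y ->
  exists2 w, e v w & P = side v w.
Proof.
by move=> [[z _ ->] -> -> //|[w evw ->] _ _ _]; exists w.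
Qed.

Lemma node_elements_parts v x : R v x <-> parts v [set x].
Proof.
split=> [Rx|[[y Ry xy]|[w evw xS]]]; first by left; exists x.
  by have -> : x = y by have : [set x] x by []; rewrite xy.
have [_ _ [a [b []]]] := star_side (star_ v) evw.
by rewrite -xS => -> ->.
Qed.

(** Some element is outside both [side v w] and [side v' u]. But the complement of [side v w] is the
    side of [v], which [tree_first_edges] puts inside [side v' u]. *)
Lemma parts_inj v v' : parts v = parts v' -> v = v'.
Proof.
move=> pp; apply: contrapT => vv'.
have [w [u [evw evu sub]]] := tree_first_edges te vv'.
have v'w : parts v' (side v w) by rewrite -pp; exact: side_parts.
have [x [Ex Sx S'x]] := node_outside Mm (parts_node v') v'w (side_parts evu).
have : side w v x by rewrite (sideD evw).
move=> [t wt Rt]; apply: S'x; exists t => //; apply: sub.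
by rewrite delete_edgeC.
Qed.

(** Otherwise [X] could be pursued through the tree without end: [w] does not split [X], which
    therefore lies in a further [side w u], and the set left behind increases while avoiding
    [x1]. *)
Lemma not_sub_side X : good X -> (exists x y, [/\ X x, X y & x <> y]) ->
  (forall v, ~ parts v X) -> (forall v, ~ parts v (E `\` X)) ->
  forall v w, e v w -> ~ X `<=` side v w.
Proof.
move=> gX [x1 [x2 [X1 X2 x12]]] nX nX' v w evw.
have PE := good_sub (side_good evw).
have evw' : e w v by rewrite (tree_sym te).
suff h : forall Z, good Z -> ~ Z x1 ->
    forall v w, e v w -> side w v = Z -> ~ X `<=` side v w.
  move=> XP; apply: (h (side w v) _ _ v w evw erefl) => //; first exact: side_good.
  by rewrite (sideD evw) => -[_]; apply; exact: XP.
apply: (good_ind Mm Mc (good_sub gX X1)) => Z gZ nZ IH {evw evw' PE} {}v {}w evw wZ XP.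
have evw' : e w v by rewrite (tree_sym te).
have wZp : parts w Z by rewrite -wZ; exact: side_parts.
have ZX x : Z x -> ~ X x by rewrite -wZ (sideD evw) => -[_ nP] /XP.
have nw := parts_node w.
have [Q wQ [XQ|XQ]] := parts_split w gX; last first.
  have ZQ : Z = Q.
    apply: (node_subset Mm nw wZp wQ) => x Zx; apply: XQ; split; last exact: ZX.
    exact: good_sub gZ _ _.
  apply: (nX' w); suff -> : E `\` X = Z by [].
  apply/seteqP; split=> [x /XQ|x Zx]; first by rewrite ZQ.
  by split; [exact: good_sub gZ _ _|exact: ZX].
have QZ x : Z x -> ~ Q x.
  move=> Zx Qx; have ZQ := node_disj nw wZp wQ Zx Qx.
  by apply: nZ; rewrite ZQ; exact: XQ.
have [u ewu Qu] := parts_two wQ (XQ _ X1) (XQ _ X2) x12.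
have uQ : side u w = E `\` Q by rewrite (sideD ewu) Qu.
apply: (IH (E `\` Q)) ewu uQ _.
- by apply: goodD => //; exact: (parts_good wQ).
- by move=> [_]; apply; exact: XQ.
- split; first by move=> x Zx; split; [exact: good_sub gZ _ _|exact: QZ].
  move=> QZ'; have [x [Ex Zx Qx]] := node_outside Mm nw wZp wQ.
  by apply: Zx; apply: QZ'.
- by rewrite -Qu.
Qed.

(** By [node_uniq] a single common part is enough, and singletons occur at the node of their
    element. If a larger [X] were no part of any torso, it or its complement would lie in a side,
    against [not_sub_side]. *)
Lemma parts_surj s : node M s -> exists v, parts v = s.
Proof.
move=> ns.
have [X sX] : exists X, s X by have [[_ _ _ [P [_ [_ [sP _ _ _]]]]] _ _] := ns; exists P.
have gX := node_good ns sX.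
suff [v vX] : exists v, parts v X.
  by exists v; exact: (node_uniq Mm (parts_node v) ns vX sX).
have [x Ex Xx] := good_pt Mm gX.
have [x2|one] := EM (exists y, X y /\ x <> y); last first.
  have XE1 : X = [set x].
    apply/seteqP; split=> [y Xy|_ -> //]; apply: contrapT => yx.
    by apply: one; exists y; split=> // /esym.
  move: (Ex); rewrite -{1}RE => -[v _ Rv]; exists v.
  by rewrite XE1; apply/node_elements_parts.
apply: contrapT => nv.
have nX v : ~ parts v X by move=> vX; apply: nv; exists v.
have [Y [sY YX _]] := node_third ns sX sX.
have [Z [sZ ZX ZY]] := node_third ns sX sY.
have [y Ey Yy] := good_pt Mm (node_good ns sY).
have [z Ez Zz] := good_pt Mm (node_good ns sZ).
have Xy : ~ X y by move=> Xy; apply: YX; exact: (node_disj ns sY sX Yy Xy).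
have Xz : ~ X z by move=> Xz; apply: ZX; exact: (node_disj ns sZ sX Zz Xz).
have yz : y <> z by move=> yz; apply: ZY; apply: (node_disj ns sZ sY Zz); rewrite -yz.
have X2 : exists x y, [/\ X x, X y & x <> y] by have [x' [? ?]] := x2; exists x, x'.
have DX2 : exists x y, [/\ (E `\` X) x, (E `\` X) y & x <> y] by exists y, z.
have DX : E `\` (E `\` X) = X by rewrite setDKE //; exact: good_sub gX.
have nX' v : ~ parts v (E `\` X).
  move=> vX; have [w evw Xs] : exists2 w, e v w & E `\` X = side v w.
    by apply: (parts_two vX _ _ yz).
  by apply: (nX w); rewrite -DX Xs -(sideD evw); apply: side_parts; rewrite (tree_sym te).
have [v _] := tree_nonempty te.
have [P vP [XP|XP]] := parts_split v gX.
  have [a [b [Xa Xb ab]]] := X2.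
  have [w evw Pw] := parts_two vP (XP _ Xa) (XP _ Xb) ab.
  by apply: (not_sub_side gX X2 nX nX' evw); rewrite -Pw.
have [w evw Pw] := parts_two vP (XP y (conj Ey Xy)) (XP z (conj Ez Xz)) yz.
apply: (not_sub_side (goodD Mm gX) DX2 nX' _ evw); last by rewrite -Pw.
by rewrite DX.
Qed.

Definition to_node v : nodeT M :=
  exist _ (parts v) (introT (asboolP _) (parts_node v)).

Lemma to_node_bij : bijective to_node.
Proof.
apply: inj_surj_bijective.
  by move=> v w /(congr1 val) /=; exact: parts_inj.
move=> s; have [v vs] := parts_surj (nodeV s).
by exists v; apply: val_inj.
Qed.

Lemma to_node_adj v w : node_adj (to_node v) (to_node w) = e v w.
Proof.
apply/asboolP/idP => /= [[P vP wP]|evw]; last first.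
  exists (side v w); first exact: side_parts.
  by rewrite -sideD //; apply: side_parts; rewrite (tree_sym te).
have PE := good_sub (parts_good vP).
(* Two further parts of [w] lie inside [P], so [P] is not a singleton and must be a side at [v]. *)
have [Q [wQ QP _]] := node_third (parts_node w) wP wP.
have [S [wS SP SQ]] := node_third (parts_node w) wP wQ.
have [x Ex Qx] := good_pt Mm (parts_good wQ).
have [y Ey Sy] := good_pt Mm (parts_good wS).
have inP A z : parts w A -> A <> E `\` P -> E z -> A z -> P z.
  move=> wA AP Ez Az; apply: contrapT => Pz; apply: AP.
  exact: (node_disj (parts_node w) wA wP Az).
have xy : x <> y.
  by move=> xy; apply: SQ; apply: (node_disj (parts_node w) wS wQ Sy); rewrite -xy.
have [u evu Pu] := parts_two vP (inP _ _ wQ QP Ex Qx) (inP _ _ wS SP Ey Sy) xy.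
suff -> : w = u by [].
apply: parts_inj; apply: (node_uniq Mm (parts_node w) (parts_node u) wP).
by rewrite Pu -sideD //; apply: side_parts; rewrite (tree_sym te).
Qed.

End Uniqueness.

Theorem theorem1 :
  forall (T : Type) (M : circuit_system T),
  is_matroid M -> connected_matroid M -> `I_3 #<= ground M ->
  (exists (V : eqType) (e : rel V) (R : V -> set T),
     canonical_decomposition M e R /\
     forall v : V, is_matroid (torso M e R v)) /\
  (forall (V V' : eqType) (e : rel V) (e' : rel V')
          (R : V -> set T) (R' : V' -> set T),
     canonical_decomposition M e R -> canonical_decomposition M e' R' ->
     exists f : V -> V',
       graph_isomorphism e e' f /\ forall v : V, R v = R' (f v)).
Proof.
move=> T M Mm Mc M3; split.
  exists (nodeT M), (@node_adj T M), (@node_elements T M).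
  split; first exact: node_decomposition.
  by move=> v; apply: (torso_matroid Mm Mc M3); exact: node_star.
(* Both trees are isomorphic to the tree of nodes, and the elements at a node are recovered from its
   singleton parts. *)
move=> V V' e e' R R' can can'.
have [g fK gK] := to_node_bij Mm Mc M3 can'.
have [h hK Kh] := to_node_bij Mm Mc M3 can.
exists (g \o to_node Mm Mc M3 can); split; first split.
- by apply: bij_comp; [exists (to_node Mm Mc M3 can')|exists h].
- by move=> v w /=; rewrite -(to_node_adj Mm Mc M3 can') !gK to_node_adj.
- move=> v /=; apply/seteqP; split=> x /=.
    move=> /(node_elements_parts Mm can) vx.
    apply/(node_elements_parts Mm can').
    by have /(congr1 val) /= -> := gK (to_node Mm Mc M3 can v).
  move=> /(node_elements_parts Mm can').
  have /(congr1 val) /= -> := gK (to_node Mm Mc M3 can v).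
  by move=> /(node_elements_parts Mm can).
Qed.
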